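(* Consider all $(T_Q+T)$-policies with $Q\ge0$, $T\ge0$, $(Q,T)\ne(0,0)$, and let $\mathrm{AC}(T_Q+T)$ be the long-run average cost of such a policy. (a) If $\sum_{i=1}^n\omega_i(2D\sigma_i^2-D_i\sigma^2)>0$, then the jointly optimal $(T_Q+T)$-policy (minimizing over both $Q$ and $T$) is the optimal quantity policy: the minimum of $\mathrm{AC}(T_Q+T)$ over all admissible $(Q,T)$ is attained at $T=0$ and $Q=Q^*$, where $Q^*$ minimizes $\mathrm{AC}(T_Q)$ over $Q>0$. (b) If $\sum_{i=1}^n\omega_i(2D\sigma_i^2-D_i\sigma^2)<0$, then the jointly optimal $(T_Q+T)$-policy is the optimal time policy: the minimum of $\mathrm{AC}(T_Q+T)$ over all admissible $(Q,T)$ is attained at $Q=0$ and $T=T^*$, where $T^*$ minimizes $\mathrm{AC}(T)$ over $T>0$.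
   Context: Let $n\ge 1$, let $B_1,\dots,B_n$ be independent standard Brownian motions (started at $0$), and let $N_i(t)=D_it+\sigma_iB_i(t)$ with $D_i>0$, $\sigma_i>0$ for $i=1,\dots,n$ (cumulative demand of items of type $i$). Put $D=\sum_{i=1}^nD_i$ and $\sigma^2=\sum_{i=1}^n\sigma_i^2$. The cost parameters are: $A_D>0$ (fixed cost of a clearing), $c_i\in\mathbb{R}$ (unit transport cost for type $i$), $\omega_i>0$ (waiting cost per unit of type $i$ per unit time). For a stopping time $\tau$ (the clearing cycle of a renewal-type clearing policy) of the natural filtration of $(N_1,\dots,N_n)$ with $0<\mathbb{E}[\tau]<\infty$, the long-run average cost is $$\mathrm{AC}(\tau)=\frac{A_D+\mathbb{E}\left[\sum_{i=1}^nc_iN_i(\tau)\right]+\mathbb{E}\left[\sum_{i=1}^n\int_0^\tau\omega_iN_i(u)\,du\right]}{\mathbb{E}[\tau]}.$$ For $Q\ge0$ let $T_Q=\inf\{t>0:\sum_{i=1}^nN_i(t)\ge Q\}$ (so $T_0=0$ almost surely). The $(T_Q+T)$-policy with parameters $Q\ge 0$, $T\ge0$ has clearing cycle $\tau=T_Q+T$, i.e. it clears a time $T$ after $Q$ units have accumulated. The quantity policy with parameter $Q>0$ is the case $T=0$ ($\tau=T_Q$), and the time policy with parameter $T>0$ is the case $Q=0$ (deterministic $\tau=T$). *)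

(* Defs.v *)
From mathcomp Require Export all_boot all_order all_algebra.
From mathcomp Require Export all_classical all_reals all_analysis.

Set Implicit Arguments.
Unset Strict Implicit.
Unset Printing Implicit Defensive.

Import Order.TTheory GRing.Theory Num.Theory.
Import numFieldNormedType.Exports.

Local Open Scope classical_set_scope.
Local Open Scope ring_scope.

Section independence.
Context {d : measure_display} {Omega : measurableType d} {R : realType}.
Variable P : probability Omega R.

Definition mutually_independent (I : finType) (F : I -> set_system Omega) :=
  forall (J : {set I}) (A : I -> set Omega), (forall i, i \in J -> F i (A i)) ->
    P (\bigcap_(i in [set` J]) A i) = (\prod_(i in J) P (A i))%E.

Definition sigma_of_variable (X : Omega -> R) : set_system Omega :=
  preimage_set_system setT X measurable.

(* A process is indexed by all of R, but only its values at times t >= 0 are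
   ever constrained or used. *)
Definition sigma_of_process (X : R -> Omega -> R) : set_system Omega :=
  <<s \bigcup_(t in [set t : R | 0 <= t]) sigma_of_variable (X t) >>.

Definition independent_processes (I : finType) (X : I -> R -> Omega -> R) :=
  mutually_independent (fun i => sigma_of_process (X i)).

(* The second parameter of normal_prob is the standard deviation. *)
Record standard_brownian_motion (B : R -> {RV P >-> R}) : Prop := {
  brownian_start : {ae P, forall w, B 0 w = 0} ;
  brownian_continuous :
    {ae P, forall w, {within `[0, +oo[, continuous (fun t : R => B t w)}} ;
  brownian_gaussian : forall s t : R, 0 <= s -> s < t ->
    forall A : set R, measurable A ->
      P ((fun w => B t w - B s w) @^-1` A) = normal_prob 0 (Num.sqrt (t - s)) A ;
  brownian_independent : forall (k : nat) (t : nat -> R),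
    0 <= t 0%N -> {homo t : i j / (i <= j)%N >-> i <= j} ->
    mutually_independent (fun j : 'I_k =>
      sigma_of_variable (fun w => B (t j.+1) w - B (t j) w)) }.

End independence.

Section clearing.
Context {d : measure_display} {Omega : measurableType d} {R : realType}.
Variables (P : probability Omega R) (n : nat).

Definition cumulative_demand (D sigma : 'I_n -> R)
    (B : 'I_n -> R -> {RV P >-> R}) (i : 'I_n) (t : R) (w : Omega) : R :=
  D i * t + sigma i * B i t w.

(* Random times take values in \bar R since the infimum below is +oo when the
   level Q is never reached. *)
Definition hitting_time (N : 'I_n -> R -> Omega -> R) (Q : R) (w : Omega)
    : \bar R :=
  ereal_inf [set t%:E | t in [set t : R | 0 < t /\ Q <= \sum_(i < n) N i t w]].

Definition clearing_time (N : 'I_n -> R -> Omega -> R) (Q T : R) (w : Omega)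
    : \bar R :=
  (hitting_time N Q w + T%:E)%E.

(* fine (tau w) is the value of tau w as a real number; when tau has finite
   expectation it only differs from tau w on a null event. *)
Definition average_cost (A_D : R) (c omega : 'I_n -> R)
    (N : 'I_n -> R -> Omega -> R) (tau : Omega -> \bar R) : \bar R :=
  ((A_D%:E
    + 'E_P[fun w => (\sum_(i < n) c i * N i (fine (tau w)) w)%R]
    + 'E_P[fun w => (\sum_(i < n)
        \int[lebesgue_measure]_(u in `[0, fine (tau w)]) (omega i * N i u w))%R])
   / \int[P]_w tau w)%E.

End clearing.

Definition minimizes_on {R : realType} {X : Type} (S : set X) (f : X -> \bar R)
    (x : X) : Prop :=
  S x /\ forall y, S y -> (f x <= f y)%E.

(* Main.v *)
From HB Require Import structures.
Require Import Defs.
From mathcomp Require Import measurable_realfun ring lra.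

(** All expectations are first computed on the grids of mesh h0/2^k.  For a
    bounded stopping index tau of a grid, independence of the increments gives
    the Wald identities E W_i(tau) = 0 and E W_i(tau) W_j(tau) = delta_ij E tau,
    and a discrete integration by parts gives
    E \int_0^tau W_i = E[tau W_i(tau)].  Doob's L^2 inequality provides an
    integrable envelope, so these identities pass to the limit theta_Q of the
    times at which the grids hit the level Q.  By continuity theta_q <= T_Q <=
    theta_Q for q < Q, and E theta_Q = Q/D then forces T_Q = theta_Q almost
    surely.

    With a = Q/D, L = a + T, m = \sum_i omega_i D_i and
    S = \sum_i omega_i (2 D sigma_i^2 - D_i sigma^2), this yields
    AC(T_Q + T) = A_D/L + \sum_i c_i D_i + m L/2 - (a/L) S/(2 D^2).
    For fixed L only the last term depends on the policy, and it is monotone in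
    the ratio a/L, which ranges over [0, 1]: the quantity policies are a/L = 1
    and the time policies a/L = 0. *)

Set Implicit Arguments.
Unset Strict Implicit.
Unset Printing Implicit Defensive.

Import Order.TTheory GRing.Theory Num.Theory.
Import numFieldNormedType.Exports HBNNSimple.

Local Open Scope classical_set_scope.
Local Open Scope ring_scope.

(** * Square-integrable variables and convergence of means *)

(** Where S comes from: at passage the total demand is pinned at Q, so its noise part equals Q - D
    theta. Squaring this gives Var theta = sigma^2 a / D^2, and multiplying it by W_j gives
    E[theta W_j] = - sigma_j a / D. Weighted by omega_i, the terms D_i sigma^2 a / (2 D^2) and -
    sigma_i^2 a / D add up to - a S / (2 D^2).

    The obstacle is an envelope that serves all grids at once. The hitting indices are cut off to be
    bounded, with a cutoff time that grows with k. The maxima of the motions are taken up to the hit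
    of the fixed grid of mesh h0, watched inside the k-th grid: they then increase with k and a
    bound on their means is enough. That bound looks circular, since the squared maxima are
    controlled by the mean time and the time by the maxima. It closes because the time grows only
    like the square root of the squared maxima.

    The passage times are handled only up to null sets, through integrable versions. Choosing h0 = T
    when T > 0 puts the delay T on every grid. *)

Section mean.
Context {d : measure_display} {T : measurableType d} {R : realType}.
Variable P : probability T R.
Implicit Types (X Y Z : T -> R).

Definition L1 X := P.-integrable setT (EFin \o X).

Definition mean X : R := \int[P]_w X w.

Lemma L1_measurable X : L1 X -> measurable_fun setT X.
Proof. by move=> /integrableP[/measurable_EFinP]. Qed.

Lemma L1_le X Y : measurable_fun setT X -> L1 Y ->
  (forall w, `|X w| <= Y w) -> L1 X.
Proof.
move=> mX iY XY; apply: (le_integrable measurableT _ _ iY).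
  exact/measurable_EFinP.
by move=> w _ /=; rewrite lee_fin (le_trans (XY w))// ler_norm.
Qed.

Lemma L1_cst (k : R) : L1 (fun=> k).
Proof. exact: finite_measure_integrable_cst. Qed.

Lemma L1D X Y : L1 X -> L1 Y -> L1 (fun w => X w + Y w).
Proof. exact: integrableD. Qed.

Lemma L1B X Y : L1 X -> L1 Y -> L1 (fun w => X w - Y w).
Proof. exact: integrableB. Qed.

Lemma L1Z (k : R) X : L1 X -> L1 (fun w => k * X w).
Proof. exact: integrableZl. Qed.

Lemma L1_sum (I : Type) (s : seq I) (Q : pred I) (X : I -> T -> R) :
  (forall i, L1 (X i)) -> L1 (fun w => \sum_(i <- s | Q i) X i w).
Proof.
move=> iX; have := @integrable_sum _ _ _ P setT measurableT I s Q
  (fun i => EFin \o X i) (fun i _ => iX i).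
by apply: eq_integrable => // w _ /=; rewrite sumEFin.
Qed.

Lemma L1_norm X : L1 X -> L1 (fun w => `|X w|).
Proof. exact: integrable_norm. Qed.

Lemma meanE X : L1 X -> (\int[P]_w (X w)%:E = (mean X)%:E)%E.
Proof.
by move=> iX; rewrite /mean /Rintegral fineK//; exact: integrable_fin_num.
Qed.

Lemma mean_cst (k : R) : mean (fun=> k) = k.
Proof.
rewrite /mean Rintegral_cst; [|exact: measurableT].
by rewrite -[X in fine X]/(P setT) probability_setT mulr1.
Qed.

Lemma meanD X Y : L1 X -> L1 Y -> mean (fun w => X w + Y w) = mean X + mean Y.
Proof. by move=> iX iY; rewrite /mean RintegralD. Qed.

Lemma meanB X Y : L1 X -> L1 Y -> mean (fun w => X w - Y w) = mean X - mean Y.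
Proof. by move=> iX iY; rewrite /mean RintegralB. Qed.

Lemma meanZ (k : R) X : L1 X -> mean (fun w => k * X w) = k * mean X.
Proof. by move=> iX; rewrite /mean RintegralZl. Qed.

Lemma mean_sum (I : Type) (s : seq I) (Q : pred I) (X : I -> T -> R) :
  (forall i, L1 (X i)) ->
  mean (fun w => \sum_(i <- s | Q i) X i w) = \sum_(i <- s | Q i) mean (X i).
Proof.
move=> iX; elim: s => [|i s IHs].
  rewrite big_nil -[RHS](mean_cst 0); congr mean.
  by apply/funext => w; rewrite big_nil.
rewrite big_cons; case: ifPn => Qi; last first.
  by rewrite -IHs; congr mean; apply/funext => w; rewrite big_cons (negbTE Qi).
rewrite -IHs -meanD//; last exact: L1_sum.
by congr mean; apply/funext => w; rewrite big_cons Qi.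
Qed.

Lemma mean_le X Y : L1 X -> L1 Y -> (forall w, X w <= Y w) -> mean X <= mean Y.
Proof. by move=> iX iY XY; apply: le_Rintegral => // w _; exact: XY. Qed.

Lemma mean_ge0 X : (forall w, 0 <= X w) -> 0 <= mean X.
Proof. by move=> X0; apply: Rintegral_ge0 => w _; exact: X0. Qed.

Lemma eq_mean X Y : X =1 Y -> mean X = mean Y.
Proof. by move=> /funext->. Qed.

Lemma eq_L1 X Y : X =1 Y -> L1 X -> L1 Y.
Proof. by move=> /funext->. Qed.

(** Measurability of X is a separate clause because integrability of the square only makes the
    square measurable. *)
Definition L2 X := measurable_fun setT X /\ L1 (fun w => X w ^+ 2).

Lemma eq_L2 X Y : X =1 Y -> L2 X -> L2 Y.
Proof. by move=> /funext->. Qed.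

Lemma L2_cst (k : R) : L2 (fun=> k).
Proof. by split; [exact: measurable_cst|exact: L1_cst]. Qed.

Lemma L2_le X Y : measurable_fun setT X -> L2 Y ->
  (forall w, `|X w| <= `|Y w|) -> L2 X.
Proof.
move=> mX [mY iY] XY; split=> //; apply: L1_le iY _.
  exact: measurable_funX.
by move=> w; rewrite ger0_norm ?sqr_ge0// -[leLHS]real_normK ?num_real// -[leRHS]real_normK ?num_real// lerXn2r ?nnegrE.
Qed.

Lemma L2_mul X Y : L2 X -> L2 Y -> L1 (fun w => X w * Y w).
Proof.
move=> [mX iX] [mY iY].
apply: (@L1_le _ (fun w => X w ^+ 2 + Y w ^+ 2)); [|exact: L1D|].
  exact: measurable_funM.
move=> w; rewrite ler_norml.
have /= p1 := sqr_ge0 (X w + Y w); have /= p2 := sqr_ge0 (X w - Y w).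
have /= p3 := sqr_ge0 (X w); have /= p4 := sqr_ge0 (Y w).
by apply/andP; split; nra.
Qed.

Lemma L2_L1 X : L2 X -> L1 X.
Proof.
move=> l2; apply: eq_L1 (L2_mul l2 (L2_cst 1)) => w.
by rewrite mulr1.
Qed.

Lemma L2D X Y : L2 X -> L2 Y -> L2 (fun w => X w + Y w).
Proof.
move=> lX lY; split; first exact: measurable_funD lX.1 lY.1.
apply: eq_L1 (L1D (L1D lX.2 (L1Z 2 (L2_mul lX lY))) lY.2) => w.
by ring.
Qed.

Lemma L2Z (k : R) X : L2 X -> L2 (fun w => k * X w).
Proof.
move=> [mX iX]; split; first exact: measurable_funM.
by apply: eq_L1 (L1Z (k ^+ 2) iX) => w; rewrite exprMn.
Qed.

Lemma L2B X Y : L2 X -> L2 Y -> L2 (fun w => X w - Y w).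
Proof.
move=> lX lY; have := L2D lX (L2Z (-1) lY).
by under eq_fun do rewrite mulN1r.
Qed.

Lemma L2_sum (I : Type) (s : seq I) (Q : pred I) (X : I -> T -> R) :
  (forall i, L2 (X i)) -> L2 (fun w => \sum_(i <- s | Q i) X i w).
Proof.
move=> lX; elim: s => [|i s IHs].
  under eq_fun do rewrite big_nil.
  exact: L2_cst.
under eq_fun do rewrite big_cons.
by case: (Q i) => //; exact: L2D.
Qed.

Lemma L2_max X Y : L2 X -> L2 Y -> L2 (fun w => Num.max (X w) (Y w)).
Proof.
move=> [mX iX] [mY iY]; split; first exact: measurable_maxr.
apply: (L1_le _ (L1D iX iY)) => [|w].
  by apply: measurable_funX; exact: measurable_maxr.
rewrite ger0_norm ?sqr_ge0//.
by rewrite /Order.max; case: ifP => _; rewrite ?lerDl ?lerDr sqr_ge0.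
Qed.

End mean.

Section ae_integral.
Context {d : measure_display} {T : measurableType d} {R : realType}.
Variable mu : {measure set T -> \bar R}.
Local Open Scope ereal_scope.

(** A simple function below f can be set to 0 on the exceptional null set without changing its
    integral, and it then lies below g. *)
Let ge0_ae_le_integral_nonmeas (f g : T -> \bar R) : (forall x, 0 <= f x) ->
  (forall x, 0 <= g x) -> ae_eq mu setT f g -> \int[mu]_x f x <= \int[mu]_x g x.
Proof.
move=> f0 g0 [N [mN N0 fgN]].
rewrite !ge0_integralTE//; apply: ge_ereal_sup => _ /= [h hf <-].
have mNC : measurable (~` N) by exact: measurableC.
rewrite -integralT_nnsfun.
have [p hE] : exists p : {nnsfun T >-> R}, forall x, p x = (h \_ (~` N)) x.
  by exists (proj_nnsfun h mNC) => x; rewrite mrestrict.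
have -> : \int[mu]_x (h x)%:E = \int[mu]_x (p x)%:E.
  apply: ae_eq_integral => //; [exact/measurable_EFinP|exact/measurable_EFinP|].
  exists N; split=> // x /=; apply: contra_notP => Nx _.
  by rewrite hE patchE mem_set.
rewrite integralT_nnsfun; apply: ereal_sup_ubound; exists p => //= x.
rewrite hE patchE; case: (boolP (x \in ~` N)) => xN //.
rewrite (le_trans (hf x))//.
suff -> : f x = g x by [].
by apply: contrapT => fg; move: xN; rewrite inE; apply; apply: fgN => /= /(_ I).
Qed.

(* The integral is defined through simple functions, so neither f nor g needs
   to be measurable. *)
Lemma ae_eq_integral_nonmeasurable (f g : T -> \bar R) : ae_eq mu setT f g ->
  \int[mu]_x f x = \int[mu]_x g x.
Proof.
have ge0 (f' g' : T -> \bar R) : (forall x, 0 <= f' x) -> (forall x, 0 <= g' x) ->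
    ae_eq mu setT f' g' -> \int[mu]_x f' x = \int[mu]_x g' x.
  move=> f0 g0 fg; apply/eqP; rewrite eq_le !ge0_ae_le_integral_nonmeas//.
  exact: ae_eq_sym.
move=> /ae_eq_funeposneg[fgp fgn].
by rewrite integralE [RHS]integralE (ge0 _ _ _ _ fgp)// (ge0 _ _ _ _ fgn).
Qed.

End ae_integral.

Section convergence.
Context {d : measure_display} {T : measurableType d} {R : realType}.
Variable P : probability T R.

(** The passage and hitting times are defined pathwise and are well behaved only on almost every
    path, so a mean is asserted through an integrable version rather than through measurability of
    f. *)
Definition has_mean (f : T -> R) (l : R) := exists h : T -> R,
  [/\ L1 P h, {ae P, forall w, f w = h w} & mean P h = l].

Lemma L1_has_mean f : L1 P f -> has_mean f (mean P f).
Proof. by move=> l1f; exists f; split=> //; exact: aeW. Qed.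

Lemma has_mean_integral f l : has_mean f l -> (\int[P]_w (f w)%:E = l%:E)%E.
Proof.
move=> [h [l1h fh <-]]; rewrite -meanE//; apply: ae_eq_integral_nonmeasurable.
by apply: filterS fh => w /= -> _.
Qed.

Lemma has_meanB f g a b : has_mean f a -> has_mean g b ->
  has_mean (fun w => f w - g w) (a - b).
Proof.
move=> [f' [if' ff' <-]] [g' [ig' gg' <-]]; exists (fun w => f' w - g' w).
split; [exact: L1B| |by rewrite meanB].
by apply: filterS2 ff' gg' => w -> ->.
Qed.

(* The limit f need not be measurable: it is almost everywhere equal to the
   upper limit of the f_k. *)
Lemma has_mean_lim (f_ : nat -> T -> R) (f g : T -> R) (l : R) :
  (forall k, L1 P (f_ k)) ->
  {ae P, forall w, f_ ^~ w @ \oo --> f w} ->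
  L1 P g -> {ae P, forall w, forall k, `|f_ k w| <= g w} ->
  (fun k => mean P (f_ k)) @ \oo --> l ->
  has_mean f l.
Proof.
move=> if_ ff ig fg ml.
pose F_ k w := (f_ k w)%:E.
pose F w := limn_esup (F_ ^~ w).
have mF_ k : measurable_fun setT (F_ k).
  by apply/measurable_EFinP; exact: L1_measurable (if_ k).
have mF : measurable_fun setT F by exact: measurable_fun_limn_esup.
have FF : {ae P, forall w, F_ ^~ w @ \oo --> (f w)%:E /\ F w = (f w)%:E}.
  apply: filterS ff => w fw.
  have cF : F_ ^~ w @ \oo --> (f w)%:E by apply/fine_cvgP; split => //; exact: nearW.
  by split => //; rewrite /F (cvg_limn_einf_sup cF).2.
have FG : {ae P, forall w n, setT w -> (`|F_ n w| <= (EFin \o g) w)%E}.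
  by apply: filterS fg => w fgw n _; rewrite /F_ /= lee_fin.
have FF' : {ae P, forall w, setT w -> F_ ^~ w @ \oo --> F w}.
  by apply: filterS FF => w [? ->].
have [iF _ cF] := @dominated_convergence _ _ _ P setT measurableT F_ F (EFin \o g)
   mF_ mF FF' ig FG.
pose h w := fine (F w).
have hF : {ae P, forall w, F w = (h w)%:E}.
  by apply: filterS FF => w [_]; rewrite /h => ->.
have mh : measurable_fun setT h by exact: (measurableT_comp (fine_measurable measurableT)).
have ih : L1 P h.
  move: iF => /integrableP[_ iF]; apply/integrableP; split.
    exact/measurable_EFinP.
  rewrite (_ : (\int[P]_x _ = \int[P]_x `|F x|)%E)//.
  by apply: ae_eq_integral_nonmeasurable; apply: filterS hF => w /= -> _.
exists h; split => //; first by apply: filterS FF => w [_]; rewrite /h => ->.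
have -> : mean P h = fine (\int[P]_w F w)%E.
  rewrite /mean /Rintegral; congr fine; apply: ae_eq_integral_nonmeasurable.
  by apply: filterS hF => w /= -> _.
have /fine_cvgP[_ cF'] : (fun n => \int[P]_(x in setT) F_ n x)%E @ \oo -->
    (fine (\int[P]_w F w))%:E.
  by rewrite fineK//; exact: integrable_fin_num.
exact: cvg_unique cF' ml.
Qed.

Lemma mean_cvg_cst (f_ : nat -> T -> R) (g : T -> R) (c : R) :
  (forall k, L1 P (f_ k)) -> {ae P, forall w, f_ ^~ w @ \oo --> c} ->
  L1 P g -> {ae P, forall w, forall k, `|f_ k w| <= g w} ->
  (fun k => mean P (f_ k)) @ \oo --> c.
Proof.
move=> if_ fc ig fg.
have mf k : measurable_fun setT (EFin \o f_ k).
  by apply/measurable_EFinP; exact: L1_measurable (if_ k).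
have mc : measurable_fun setT (fun _ : T => c%:E) by exact: measurable_cst.
have fcE : {ae P, forall w, setT w -> (fun k => (EFin \o f_ k) w) @ \oo --> c%:E}.
  by apply: filterS fc => w fw _; apply/fine_cvgP; split => //; exact: nearW.
have fgE : {ae P, forall w k, setT w -> (`|(EFin \o f_ k) w| <= (EFin \o g) w)%E}.
  by apply: filterS fg => w fgw k _; rewrite /= lee_fin.
have [_ _] := @dominated_convergence _ _ _ P setT measurableT (fun k => EFin \o f_ k)
  (fun=> c%:E) (EFin \o g) mf mc fcE ig fgE.
rewrite (meanE (L1_cst P c)) mean_cst.
under eq_fun do rewrite (meanE (if_ _)).
by move=> /fine_cvgP[_].
Qed.

(** By monotone convergence the pointwise limit of the X k has integral at most C, so it is itself
    an envelope. It is finite only almost everywhere, hence the passage through [fine]. *)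
Lemma monotone_domination (X : nat -> T -> R) (C : R) :
  (forall k, L1 P (X k)) -> (forall k w, 0 <= X k w) ->
  (forall w, nondecreasing_seq (X ^~ w)) -> (forall k, mean P (X k) <= C) ->
  exists2 g, L1 P g & {ae P, forall w k, X k w <= g w}.
Proof.
move=> iX X0 ndX XC.
pose F w := limn (fun k => (X k w)%:E).
have mX k : measurable_fun setT (EFin \o X k).
  by apply/measurable_EFinP; exact: L1_measurable (iX k).
have ndXE w : nondecreasing_seq (fun k => (X k w)%:E).
  by move=> m n mn; rewrite lee_fin; exact: ndX.
have cvgX w : (fun k => (X k w)%:E) @ \oo --> F w.
  by apply: ereal_nondecreasing_is_cvgn.
have XF k w : ((X k w)%:E <= F w)%E.
    rewrite /F (cvg_lim _ (ereal_nondecreasing_cvgn (ndXE w)))//.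
    by apply: ereal_sup_ubound; exists k.
have mF : measurable_fun setT F.
  by apply: (@emeasurable_fun_cvg _ _ _ _ (fun k w => (X k w)%:E)).
have F0 w : (0 <= F w)%E by rewrite (le_trans _ (XF 0%N w))// lee_fin.
have iF : P.-integrable setT F.
  apply/integrableP; split=> //.
  under eq_integral do rewrite gee0_abs//.
  rewrite /F monotone_convergence//; last first.
    by move=> k w _; rewrite lee_fin.
  apply: (@le_lt_trans _ _ C%:E); last exact: ltry.
  apply: lime_le.
    apply: ereal_nondecreasing_is_cvgn => m n mn.
    rewrite (meanE (iX m)) (meanE (iX n)) lee_fin.
    by apply: mean_le => // w; exact: ndX.
  by apply: nearW => k; rewrite (meanE (iX k)) lee_fin.
have fF := integrable_ae measurableT iF.
exists (fun w => fine (F w)).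
  move: (iF) => /integrableP[_ iF']; apply/integrableP; split.
    apply/measurable_EFinP; exact: (measurableT_comp (fine_measurable measurableT)).
  rewrite (_ : (\int[P]_x _ = \int[P]_x `|F x|)%E)//.
  by apply: ae_eq_integral_nonmeasurable; apply: filterS fF => w /(_ I) fw _; rewrite -[in RHS](fineK fw).
by apply: filterS fF => w /(_ I) fw k; rewrite -lee_fin fineK.
Qed.

(** Y need not be measurable. It lies below the infimum of the integrable versions of the Z m, which
    is measurable and has integral at most every z m, hence 0. *)
Lemma squeeze_ae0 (Y : T -> R) (Z : nat -> T -> R) (z : nat -> R) :
  (forall w, 0 <= Y w) -> (forall m, {ae P, forall w, Y w <= Z m w}) ->
  (forall m, has_mean (Z m) (z m)) -> z @ \oo --> 0 ->
  {ae P, forall w, Y w = 0}.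
Proof.
move=> Y0 YZ Zz z0.
pose h m := projT1 (cid (Zz m)).
have hP m : [/\ L1 P (h m), {ae P, forall w, Z m w = h m w} & mean P (h m) = z m].
  exact: projT2 (cid (Zz m)).
have Yh : {ae P, forall w m, Y w <= h m w}.
  apply/ae_foralln => m; have [_ Zh _] := hP m.
  by apply: filterS2 (YZ m) Zh => w + <-.
pose f m w := (`|h m w|)%:E.
have mf m : measurable_fun setT (f m).
  have [ih _ _] := hP m; apply/measurable_EFinP/measurableT_comp => //.
  exact: L1_measurable ih.
have If m : (\int[P]_w f m w)%E = (z m)%:E.
  have [ih _ <-] := hP m; rewrite -meanE//; apply: ae_eq_integral_nonmeasurable.
  by apply: filterS Yh => w Yhw _; rewrite /f ger0_norm// (le_trans (Y0 w)).
pose G w := einfs (f ^~ w) 0%N.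
have mG : measurable_fun setT G by exact: measurable_fun_einfs.
have G0 w : (0 <= G w)%E by apply: le_ereal_inf_tmp => _ [m _ <-]; rewrite lee_fin.
have IG : (\int[P]_w G w)%E = 0%E.
  apply/eqP; rewrite eq_le integral_ge0// andbT.
  have Iz m : (\int[P]_w G w <= (z m)%:E)%E.
    rewrite -If; apply: ge0_le_integral => //.
    by move=> w _; apply: ereal_inf_lbound; exists m.
  have z0' : (fun m => (z m)%:E) @ \oo --> 0%:E.
    by apply/fine_cvgP; split => //; exact: nearW.
  rewrite -[leRHS](cvg_lim _ z0')//; apply: lime_ge; last exact: nearW.
  by apply/cvg_ex; exists 0%:E.
have /ae_eq_integral_abs : (\int[P]_w `|G w| = 0)%E.
  by under eq_integral do rewrite gee0_abs//.
move=> /(_ measurableT mG) G0'.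
apply: filterS2 Yh G0' => w Yhw /(_ I) Gw.
apply/eqP; rewrite eq_le Y0 andbT -lee_fin -[leRHS]Gw.
apply: le_ereal_inf_tmp => _ [m _ <-]; rewrite lee_fin (le_trans (Yhw m))//.
exact: ler_norm.
Qed.

End convergence.

(** * Expectation of a product of independent variables *)

Section independent_product.
Context {d : measure_display} {T : measurableType d} {R : realType}.
Variable P : probability T R.

(** Independence says that the joint law and the product of the marginal laws agree on rectangles,
    hence everywhere. Fubini then becomes available. *)
Let joint_integral (X Y : {RV P >-> R}) (f : R * R -> \bar R) :
  (forall A B : set R, measurable A -> measurable B ->
    P (X @^-1` A `&` Y @^-1` B) = (P (X @^-1` A) * P (Y @^-1` B))%E) ->
  measurable_fun setT f -> P.-integrable setT (fun w => f (X w, Y w)) ->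
  (distribution P X \x distribution P Y)%E.-integrable setT f /\
  (\int[P]_w f (X w, Y w) = \int[distribution P X \x distribution P Y]_z f z)%E.
Proof.
move=> XY mf fi.
have mXY : measurable_fun setT (fun w => (X w, Y w)) by exact: measurable_fun_pair.
pose Z : {mfun T >-> (R * R)%type} :=
  HB.pack (fun w => (X w, Y w)) (isMeasurableFun.Build _ _ _ _ _ mXY).
have E A : measurable A ->
    (distribution P X \x distribution P Y)%E A = distribution P Z A.
  apply: product_measure_unique => U V mU mV.
  by rewrite /distribution /pushforward -XY.
have iZ : (distribution P Z).-integrable setT f by exact: integrable_pushforward.
split; last first.
  rewrite (eq_measure_integral (distribution P Z)); last by move=> A mA _; exact: E.
  by rewrite integral_distribution.
move/integrableP : iZ => [_ iZ]; apply/integrableP; split => //.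
by rewrite (eq_measure_integral (distribution P Z))// => A mA _; exact: E.
Qed.

Lemma mean_indepM (X Y : T -> R) :
  (forall A B : set R, measurable A -> measurable B ->
    P (X @^-1` A `&` Y @^-1` B) = (P (X @^-1` A) * P (Y @^-1` B))%E) ->
  L1 P X -> L1 P Y -> L1 P (fun w => X w * Y w) ->
  mean P (fun w => X w * Y w) = mean P X * mean P Y.
Proof.
move=> XY iX iY iXY.
have mX := L1_measurable iX; have mY := L1_measurable iY.
pose X' : {RV P >-> R} := HB.pack X (isMeasurableFun.Build _ _ _ _ _ mX).
pose Y' : {RV P >-> R} := HB.pack Y (isMeasurableFun.Build _ _ _ _ _ mY).
have mM : measurable_fun setT (fun z : R * R => (z.1 * z.2)%:E).
  by apply/measurable_EFinP; apply: measurable_funM.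
have [iM E] := @joint_integral X' Y' (fun z => (z.1 * z.2)%:E) XY mM iXY.
apply: EFin_inj; rewrite -meanE// E -integral12_prod_meas1//.
rewrite /fubini_F/=.
have iY' : (distribution P Y').-integrable setT EFin by exact: integrable_pushforward.
have iX' : (distribution P X').-integrable setT EFin by exact: integrable_pushforward.
under eq_integral.
  move=> x _; under eq_integral do rewrite EFinM.
  rewrite integralZl// integral_distribution//= meanE//.
  over.
by rewrite integralZr//= integral_distribution//= meanE// EFinM.
Qed.

End independent_product.

(** * Moments of Gaussian variables *)

Section gaussian_moments.
Context {R : realType}.
Variable s : R.
Hypothesis s_gt0 : 0 < s.
Let mu := @lebesgue_measure R.
Let phi : R -> R := normal_pdf 0 s.
Local Open Scope ereal_scope.

Let phi_ge0 x : (0 <= phi x)%R. Proof. exact: normal_pdf_ge0. Qed.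

Let mphi : measurable_fun setT phi. Proof. exact: measurable_normal_pdf. Qed.

Let indic_normal (A : set R) : measurable A ->
  \int[normal_prob 0 s]_x (\1_A x)%:E = \int[mu]_x (\1_A x * phi x)%:E.
Proof.
move=> mA; rewrite integral_indic// setIT /normal_prob [LHS]integral_mkcond.
apply: eq_integral => x _; rewrite patchE indicE.
by case: (x \in A); rewrite ?mul1r ?mul0r.
Qed.

Let nnsfun_normal (f : {nnsfun R >-> R}) :
  \int[normal_prob 0 s]_x (f x)%:E = \int[mu]_x (f x * phi x)%:E.
Proof.
have mf1 r : measurable (f @^-1` [set r]).
  by rewrite -[X in measurable X]setTI; exact: measurable_funP1.
have mi1 r : measurable_fun [set: R] (\1_(f @^-1` [set r]) : R -> R).
  exact: measurable_indic.
have mi r : measurable_fun [set: R] (fun x => r * \1_(f @^-1` [set r]) x)%R.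
  exact: measurable_funM.
under [LHS]eq_integral do rewrite fimfunE -fsumEFin//.
rewrite [LHS]ge0_integral_fsum//; last 2 first.
  - by move=> r; apply/measurable_EFinP; exact: mi.
  - by move=> n x _; rewrite EFinM nnfun_muleindic_ge0.
under [RHS]eq_integral.
  move=> x xD; rewrite fimfunE EFinM -fsumEFin// ge0_mule_fsuml; last first.
    by move=> r; rewrite EFinM nnfun_muleindic_ge0.
  over.
rewrite [RHS]ge0_integral_fsum//; last 2 first.
  - move=> r; apply: emeasurable_funM; apply/measurable_EFinP => //.
    exact: mi.
  - by move=> n x _; rewrite EFinM mule_ge0//; rewrite ?nnfun_muleindic_ge0 ?lee_fin.
apply: eq_fsbigr => r; rewrite inE => -[x _ <-].
under eq_integral do rewrite EFinM.
have f0 : 0 <= (f x)%:E by rewrite lee_fin.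
rewrite ge0_integralZl//; last by apply/measurable_EFinP; exact: mi1.
rewrite indic_normal//.
under [RHS]eq_integral do rewrite -EFinM -mulrA EFinM.
rewrite ge0_integralZl//.
- by apply/measurable_EFinP; apply: (measurable_funM (mi1 _)).
- by move=> y _; rewrite lee_fin mulr_ge0.
Qed.

(** [normal_prob] gives the measure of a set as an integral of the density. Linearity extends this
    to simple functions and monotone convergence to all nonnegative measurable ones. *)
Lemma integral_normal_prob (f : R -> R) : measurable_fun setT f ->
  (forall x, (0 <= f x)%R) ->
  \int[normal_prob 0 s]_x (f x)%:E = \int[mu]_x (f x * phi x)%:E.
Proof.
move=> mf f0.
have mEf : measurable_fun setT (EFin \o f) by exact/measurable_EFinP.
pose f_ := nnsfun_approx measurableT mEf.
have mf_ n : measurable_fun setT (f_ n : _ -> R) by exact: measurable_funTS.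
have cvgf x : (f_ ^~ x @ \oo --> f x)%R.
  have /fine_cvgP[_] : (EFin \o f_ ^~ x) @ \oo --> (f x)%:E.
    by apply: (cvg_nnsfun_approx _ mEf) => // y _; rewrite lee_fin.
  exact.
have ndf : {homo f_ : m n / (m <= n)%N >-> forall x, (m x <= n x)%R}.
  by move=> m n mn x; exact/lefP/nd_nnsfun_approx.
transitivity (limn (fun n => \int[normal_prob 0 s]_x (f_ n x)%:E)).
  rewrite -monotone_convergence//=.
  - apply: eq_integral => x _; apply/esym/cvg_lim => //.
    by apply/fine_cvgP; split; [exact: nearW|exact: cvgf].
  - by move=> n; apply/measurable_EFinP; exact: (mf_ n).
  - by move=> n x _; rewrite lee_fin.
  - by move=> x _ m n mn; rewrite lee_fin ndf.
transitivity (limn (fun n => \int[mu]_x (f_ n x * phi x)%:E)).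
  apply: congr_lim; apply/funext => n; exact: nnsfun_normal.
rewrite -monotone_convergence//=.
- apply: eq_integral => x _; apply/cvg_lim => //.
  apply/fine_cvgP; split; [exact: nearW|].
  by apply: cvgM; [exact: cvgf|exact: cvg_cst].
- by move=> n; apply/measurable_EFinP; apply: (measurable_funM (mf_ n)).
- by move=> n x _; rewrite lee_fin mulr_ge0.
- by move=> x _ m n mn; rewrite lee_fin ler_wpM2r// ndf.
Qed.

Let phiE x : phi x = (normal_peak s * expR (- (x ^+ 2 / (s ^+ 2 *+ 2))))%R.
Proof. by rewrite /phi normal_pdfE ?gt_eqF// /normal_fun subr0 mulNr. Qed.

Let phiN x : phi (- x) = phi x.
Proof. by rewrite !phiE sqrrN. Qed.

Local Close Scope ereal_scope.

Let is_derive_phi (x : R) : is_derive x 1 phi (- (x / s ^+ 2) * phi x).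
Proof.
have s0 : s != 0 by rewrite gt_eqF.
have phi' : phi = (fun x => normal_peak s * expR (- (x ^+ 2 / (s ^+ 2 *+ 2)))).
  by apply/funext => y; rewrite phiE.
rewrite phiE phi'; apply: is_derive_eq.
rewrite /= /GRing.scale/=.
by field.
Qed.

Let cphi : continuous phi.
Proof. by apply: continuous_normal_pdf; rewrite gt_eqF. Qed.

(** An antiderivative of (s^2 - x^2) phi, because phi' = - (x / s^2) phi. It vanishes at 0 and at
    infinity, which is the identity E x^2 = s^2 on the half line. *)
Let F (x : R) : R := s ^+ 2 * (x * phi x).

Let is_derive_F (x : R) : is_derive x 1 F ((s ^+ 2 - x ^+ 2) * phi x).
Proof.
have s0 : s != 0 by rewrite gt_eqF.
have dphi := is_derive_phi x.
apply: is_derive_eq; rewrite /= /GRing.scale/=.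
by field.
Qed.

(** Since expR u >= u, the product x phi(x) is at most a constant divided by x. *)
Let xphi_cvg0 : x * phi x @[x --> +oo] --> (0 : R).
Proof.
apply/cvgrPdist_lt => e e0.
near=> x; rewrite sub0r normrN.
have x0 : 0 < x by near: x; exact: nbhs_pinfty_gt.
have s2 : 0 < s ^+ 2 *+ 2 by rewrite pmulrn_lgt0// exprn_gt0.
have u0 : 0 < x ^+ 2 / (s ^+ 2 *+ 2) by rewrite divr_gt0// exprn_gt0.
rewrite ger0_norm ?mulr_ge0 ?(ltW x0)//.
have pk : 0 < normal_peak s by rewrite normal_peak_gt0// gt_eqF.
apply: (@le_lt_trans _ _ (normal_peak s * (s ^+ 2 *+ 2) / x)).
  have -> : normal_peak s * (s ^+ 2 *+ 2) / x =
      x * (normal_peak s * (x ^+ 2 / (s ^+ 2 *+ 2))^-1).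
    by field; rewrite (gt_eqF s_gt0) (gt_eqF x0).
  rewrite phiE !ler_pM2l// expRN lef_pV2 ?posrE ?expR_gt0//.
  by rewrite (le_trans _ (expR_ge1Dx _))// ?lerDr ?ler01.
rewrite ltr_pdivrMr// -ltr_pdivrMl//.
near: x; apply: nbhs_pinfty_gt; exact: num_real.
Unshelve. all: by end_near. Qed.

Let cM (f : R -> R) : continuous f -> continuous (fun x => f x * phi x).
Proof. by move=> cf x; apply: cvgM; [exact: cf|exact: cphi]. Qed.

Let csq : continuous (fun x : R => x ^+ 2).
Proof. by move=> x; exact: exprn_continuous. Qed.

Let dF x : derivable F x 1. Proof. exact: ex_derive. Qed.

Let cF : continuous F.
Proof. by move=> x; apply: differentiable_continuous; apply/derivable1_diffP. Qed.

(** The integrand s^2 - x^2 changes sign at s. The half line is cut there so that [bulk] and [tail]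
    both integrate nonnegative functions. *)
Let bulk : (\int[mu]_(x in `[0%R, s]) ((s ^+ 2 - x ^+ 2) * phi x)%:E =
  (s ^+ 2 * (s * phi s))%:E)%E.
Proof.
rewrite (@continuous_FTC2 _ _ F)//.
- by rewrite /F mul0r mulr0 sube0.
- apply: continuous_subspaceT; apply: cM => x; apply: cvgB; [exact: cvg_cst|exact: csq].
- split => //; [apply: cvg_at_right_filter|apply: cvg_at_left_filter]; exact: cF.
- by move=> x _; rewrite derive1E; exact: derive_val.
Qed.

Let tail : (\int[mu]_(x in `[s, +oo[) ((x ^+ 2 - s ^+ 2) * phi x)%:E =
  (s ^+ 2 * (s * phi s))%:E)%E.
Proof.
rewrite (@ge0_continuous_FTC2y _ _ (- F) _ 0)//.
- by rewrite sub0e -EFinN opprK.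
- move=> x sx; rewrite mulr_ge0// subr_ge0 lerXn2r ?nnegrE// ?ltW//.
  exact: lt_le_trans sx.
- apply: continuous_subspaceT; apply: cM => x; apply: cvgB; [exact: csq|exact: cvg_cst].
- rewrite -oppr0; apply: cvgN; rewrite -[X in _ --> X](mulr0 (s ^+ 2)).
  by apply: cvgM; [exact: cvg_cst|exact: xphi_cvg0].
- by move=> x _; apply: derivableN.
- by apply: cvg_at_right_filter; apply: cvgN; exact: cF.
- move=> x _; have DF : 'D_1 F x = (s ^+ 2 - x ^+ 2) * phi x by exact: derive_val.
  by rewrite derive1E deriveN// DF -mulNr opprB.
Qed.

Let integral_split (f : R -> R) : continuous f -> (forall x, 0 <= f x) ->
  (\int[mu]_(x in [set x | (0 <= x)%R]) (f x)%:E =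
   \int[mu]_(x in `[0%R, s]) (f x)%:E + \int[mu]_(x in `[s, +oo[) (f x)%:E)%E.
Proof.
move=> cf f0.
have mf (A : set R) : measurable_fun A (EFin \o f).
  by apply/measurable_EFinP/measurable_funTS; exact: continuous_measurable_fun.
rewrite -[X in (_ + X)%E]integral_itv_obnd_cbnd//.
rewrite -ge0_integral_setU//.
- congr (integral _ _ _); apply/seteqP; split => x /=; rewrite !in_itv/= ?andbT.
    by move=> x0; case: (leP x s) => xs; [left; rewrite x0|right].
  by case=> [/andP[]//|sx]; rewrite ltW// (lt_trans s_gt0).
- exact: mf.
- by move=> x _; rewrite lee_fin.
- apply/disj_set2P; apply/seteqP; split => // x /= [].
  by rewrite !in_itv/= andbT => /andP[_ xs]; rewrite ltNge xs.
Qed.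

Let second_moment_half :
  (\int[mu]_(x in [set x | (0 <= x)%R]) (x ^+ 2 * phi x)%:E =
  (s ^+ 2)%:E * \int[mu]_(x in [set x | (0 <= x)%R]) (phi x)%:E)%E.
Proof.
(* k is the value of [F] at s: the excess of s^2 phi over x^2 phi on [0, s] and its deficit beyond
   s. It is moved across by additions only, as the integrals are extended reals. *)
set k := (s ^+ 2 * (s * phi s))%:E.
have mE (f : R -> R) (A : set R) : continuous f -> measurable_fun A (fun x => (f x)%:E).
  by move=> cf; apply/measurable_EFinP/measurable_funTS; exact: continuous_measurable_fun.
have ge0D (A : set R) (f g h : R -> R) : measurable A ->
    continuous f -> continuous g -> (forall x, A x -> 0 <= f x) ->
    (forall x, A x -> 0 <= g x) -> (forall x, h x = f x + g x) ->
    (\int[mu]_(x in A) (h x)%:E =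
     \int[mu]_(x in A) (f x)%:E + \int[mu]_(x in A) (g x)%:E)%E.
  move=> mA cf cg f0 g0 hE; under eq_integral do rewrite hE EFinD.
  by rewrite ge0_integralD//; [exact: (mE _ _ cf)|exact: (mE _ _ cg)].
have s2 (A : set R) : measurable A ->
    (\int[mu]_(x in A) (s ^+ 2 * phi x)%:E = (s ^+ 2)%:E * \int[mu]_(x in A) (phi x)%:E)%E.
  move=> mA; under eq_integral do rewrite EFinM.
  have s20 : (0 <= (s ^+ 2)%:E)%E by rewrite lee_fin sqr_ge0.
  have mphiA : measurable_fun A (EFin \o phi).
    by apply/measurable_EFinP/measurable_funTS; exact: mphi.
  by rewrite ge0_integralZl// => x _; rewrite lee_fin.
have cd : continuous (fun x : R => s ^+ 2 - x ^+ 2).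
  by move=> x; apply: cvgB; [exact: cvg_cst|exact: csq].
have cd' : continuous (fun x : R => x ^+ 2 - s ^+ 2).
  by move=> x; apply: cvgB; [exact: csq|exact: cvg_cst].
have cs : continuous (fun x : R => s ^+ 2 * phi x).
  by move=> x; apply: cvgM; [exact: cvg_cst|exact: cphi].
have x2 x : 0 <= x ^+ 2 * phi x by rewrite mulr_ge0// sqr_ge0.
have E1 : (k + \int[mu]_(x in `[0%R, s]) (x ^+ 2 * phi x)%:E =
    (s ^+ 2)%:E * \int[mu]_(x in `[0%R, s]) (phi x)%:E)%E.
  rewrite /k -bulk -s2//; apply/esym/ge0D => //; [exact: (cM cd)|exact: (cM csq)| |].
    move=> x /=; rewrite in_itv/= => /andP[x0 xs]; rewrite mulr_ge0// subr_ge0.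
    by rewrite lerXn2r// nnegrE ltW.
  by move=> x; ring.
have E2 : (\int[mu]_(x in `[s, +oo[) (x ^+ 2 * phi x)%:E =
    k + (s ^+ 2)%:E * \int[mu]_(x in `[s, +oo[) (phi x)%:E)%E.
  rewrite /k -tail -s2//; apply/ge0D => //; [exact: (cM cd')| | |].
  - move=> x /=; rewrite in_itv/= andbT => sx; rewrite mulr_ge0// subr_ge0.
    by rewrite lerXn2r// nnegrE (le_trans (ltW s_gt0)).
  - by move=> x _; rewrite mulr_ge0// sqr_ge0.
  - by move=> x; ring.
rewrite (integral_split (cM csq) x2) (integral_split cphi phi_ge0).
have I0 (A : set R) : (0 <= \int[mu]_(x in A) (phi x)%:E)%E.
  by apply: integral_ge0 => x _; rewrite lee_fin.
rewrite ge0_muleDr//.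
by rewrite -E1 E2 addeA; congr (_ + _)%E; rewrite addeC.
Qed.

Lemma normal_second_moment : (\int[normal_prob 0 s]_x (x ^+ 2)%:E = (s ^+ 2)%:E)%E.
Proof.
rewrite integral_normal_prob; last 2 first.
- exact: continuous_measurable_fun.
- by move=> x; exact: sqr_ge0.
rewrite ge0_symfun_integralT.
- rewrite second_moment_half muleCA -ge0_symfun_integralT.
  + by rewrite integral_normal_pdf mule1.
  + by [].
  + exact: cphi.
  + by move=> x /=; rewrite phiN.
- by move=> x; rewrite mulr_ge0// sqr_ge0.
- exact: (cM csq).
- by move=> x /=; rewrite phiN sqrrN.
Qed.

Let integralN (G : R -> R) : continuous G -> (forall x, 0 <= G x) ->
  (\int[mu]_x (G (- x))%:E = \int[mu]_x (G x)%:E)%E.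
Proof.
have splitT (f : R -> R) : continuous f -> (forall x, 0 <= f x) ->
    (\int[mu]_x (f x)%:E = \int[mu]_(x in `]-oo, (- (0 : R))%R]) (f x)%:E +
      \int[mu]_(x in `[0%R, +oo[) (f x)%:E)%E.
  move=> cf f0.
  have mf (A : set R) : measurable_fun A (EFin \o f).
    by apply/measurable_EFinP/measurable_funTS; exact: continuous_measurable_fun.
  rewrite -[X in (_ + X)%E]integral_itv_obnd_cbnd// oppr0.
  rewrite -ge0_integral_setU//.
  - congr (integral _ _ _); apply/seteqP; split => x //= _; rewrite !in_itv/= ?andbT.
    by case: (leP x 0) => x0; [left|right].
  - exact: mf.
  - by move=> x _; rewrite lee_fin.
  - apply/disj_set2P; apply/seteqP; split => // x /= [].
    by rewrite !in_itv/= andbT => x0; rewrite ltNge x0.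
have subst (f : R -> R) : continuous f -> (forall x, 0 <= f x) ->
    (\int[mu]_(x in `]-oo, (- (0 : R))%R]) (f x)%:E = \int[mu]_(x in `[0%R, +oo[) (f (- x))%:E)%E.
  move=> cf f0; rewrite ge0_integration_by_substitutionNy//.
  by apply: continuous_subspaceT.
move=> cG G0.
have cGN : continuous (fun x => G (- x)).
  by move=> x; apply: continuous_comp; [exact: opp_continuous|exact: cG].
rewrite (splitT _ cG G0) (splitT _ cGN) ?(subst _ cG)// (subst _ cGN)// addeC.
by under [X in (_ + X)%E = _]eq_integral do rewrite opprK.
Qed.

(** Mean zero, phrased with the nonnegative functions |x| + x and |x| - x so that the symmetry of
    the density applies before integrability is known. *)
Lemma normal_first_moment :
  (\int[normal_prob 0 s]_x (`|x| + x)%:E = \int[normal_prob 0 s]_x (`|x| - x)%:E)%E.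
Proof.
have ge0 x : 0 <= `|x| + x :> R by rewrite -lerBlDr sub0r -normrN ler_norm.
have ge0' x : 0 <= `|x| - x :> R by rewrite subr_ge0 ler_norm.
have c1 : continuous (fun x : R => `|x| + x).
  by move=> x; apply: cvgD; [exact: norm_continuous|exact: cvg_id].
have c2 : continuous (fun x : R => `|x| - x).
  by move=> x; apply: cvgB; [exact: norm_continuous|exact: cvg_id].
rewrite (integral_normal_prob (continuous_measurable_fun c1) ge0).
rewrite (integral_normal_prob (continuous_measurable_fun c2) ge0').
rewrite -integralN; [|exact: (cM c1)|by move=> x; rewrite mulr_ge0].
by apply: eq_integral => x _; rewrite phiN normrN.
Qed.

End gaussian_moments.

Section gaussian_variable.
Context {d : measure_display} {T : measurableType d} {R : realType}.
Variables (P : probability T R) (s : R) (X : T -> R).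
Hypotheses (s_gt0 : 0 < s) (mX : measurable_fun setT X).
Hypothesis X_normal : forall A : set R, measurable A ->
  P (X @^-1` A) = normal_prob 0 s A.

(* The measurable structure of R is pinned to the one in the type of normal_prob. *)
Let X' : {mfun T >-> measurableTypeR R} :=
  HB.pack X (isMeasurableFun.Build _ _ T (measurableTypeR R) X mX).

Let normal_integral (f : R -> R) : measurable_fun setT f -> (forall x, 0 <= f x) ->
  (\int[P]_w (f (X w))%:E = \int[normal_prob 0 s]_x (f x)%:E)%E.
Proof.
move=> mf f0.
have mEf : measurable_fun setT (EFin \o f) by exact/measurable_EFinP.
have Ef0 y : (0 <= (EFin \o f) y)%E by rewrite lee_fin.
rewrite -(@ge0_integral_distribution _ _ _ _ _ P X' (EFin \o f) mEf Ef0).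
have E (A : set R) : measurable A -> A `<=` setT -> distribution P X' A = normal_prob 0 s A.
  by move=> mA _; exact: X_normal.
exact: (@eq_measure_integral _ (measurableTypeR R) R setT (normal_prob 0 s) (distribution P X') (EFin \o f) E).
Qed.

Lemma L2_gaussian : L2 P X.
Proof.
split=> //; apply/integrableP; split.
  by apply/measurable_EFinP; exact: measurable_funX.
under eq_integral do rewrite /= ger0_norm ?sqr_ge0//.
rewrite (@normal_integral (fun x => x ^+ 2)).
- by rewrite normal_second_moment// ltry.
- exact: measurable_funX.
- by move=> x; exact: sqr_ge0.
Qed.

Lemma mean_sqr_gaussian : mean P (fun w => X w ^+ 2) = s ^+ 2.
Proof.
apply: EFin_inj; rewrite -meanE; last by case: L2_gaussian.
rewrite (@normal_integral (fun x => x ^+ 2)).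
- by rewrite normal_second_moment.
- exact: measurable_funX.
- by move=> x; exact: sqr_ge0.
Qed.

Lemma mean_gaussian : mean P X = 0.
Proof.
have iX := L2_L1 L2_gaussian; have inX := L1_norm iX.
have E : mean P (fun w => `|X w| + X w) = mean P (fun w => `|X w| - X w).
  apply: EFin_inj; rewrite -!meanE; [|exact: L1B|exact: L1D].
  rewrite (@normal_integral (fun x => `|x| + x)); last 2 first.
  - by apply: measurable_funD => //; exact: measurable_normr.
  - by move=> x; rewrite -lerBlDr sub0r -normrN ler_norm.
  rewrite (@normal_integral (fun x => `|x| - x)); last 2 first.
  - by apply: measurable_funB => //; exact: measurable_normr.
  - by move=> x; rewrite subr_ge0 ler_norm.
  exact: normal_first_moment.
move: E; rewrite meanD// meanB//; lra.
Qed.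

End gaussian_variable.

(** * Independence of one coordinate from the sigma-algebra of others *)

Section finite_independence.
Context {d : measure_display} {T : measurableType d} {R : realType}.
Variables (P : probability T R) (K : finType) (X : K -> T -> R).
Implicit Types (C : pred K) (E : set T) (f : T -> R).

(** A pi-system generating the sigma-algebra of the coordinates in C, on which finite measures can
    be compared. *)
Definition cylinder C : set_system T := [set E | exists A : K -> set R,
  (forall k, measurable (A k)) /\ E = \bigcap_(k in [set k | C k]) X k @^-1` A k].

Definition adapted C f :=
  @measurable_fun _ _ (g_sigma_algebraType (cylinder C)) R setT f.

Lemma cylinderI C : setI_closed (cylinder C).
Proof.
move=> _ _ [A [mA ->]] [B [mB ->]]; exists (fun k => A k `&` B k); split.
  by move=> k; exact: measurableI.
apply/seteqP; split=> [w [Aw Bw] k Ck|w AB]; first by split; [exact: Aw|exact: Bw].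
by split=> k Ck; have [] := AB k Ck.
Qed.

Lemma cylinderT C : cylinder C setT.
Proof.
exists (fun=> setT); split=> [k|]; first exact: measurableT.
by apply/seteqP; split.
Qed.

Lemma cylinder_subset C C' : (forall k, C k -> C' k) -> cylinder C `<=` cylinder C'.
Proof.
move=> CC' _ [A [mA ->]]; exists (fun k => if C k then A k else setT); split.
  by move=> k; case: ifP.
apply/seteqP; split=> [w Aw k _ /=|w Aw k Ck].
  by case: ifPn => // Ck; exact: Aw.
by have := Aw k (CC' _ Ck); rewrite /preimage/= Ck.
Qed.

Lemma adapted_subset C C' f : (forall k, C k -> C' k) -> adapted C f -> adapted C' f.
Proof.
move=> CC' af _ A mA; have := af measurableT A mA.
by apply: sub_sigma_algebra2; exact: cylinder_subset.
Qed.

Lemma adapted_coord C k : C k -> adapted C (X k).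
Proof.
move=> Ck _ A mA; rewrite setTI; apply: sub_sigma_algebra.
exists (fun j => if j == k then A else setT); split; first by move=> j; case: ifP.
apply/seteqP; split=> [w Aw j Cj|w /(_ k Ck)]; last by rewrite /preimage/= eqxx.
by rewrite /preimage/=; case: eqP => // ->.
Qed.

Hypothesis mX : forall k, measurable_fun setT (X k).

Lemma cylinder_measurable C : cylinder C `<=` measurable.
Proof.
move=> _ [A [mA ->]].
apply: fin_bigcap_measurable => [|k _]; first exact: finite_finset.
by rewrite -[X in measurable X]setTI; exact: mX.
Qed.

Lemma sigma_cylinder_measurable C : <<s cylinder C >> `<=` measurable.
Proof.
apply: smallest_sub; [exact: sigma_algebra_measurable|exact: cylinder_measurable].
Qed.

Lemma adapted_measurable C f : adapted C f -> measurable_fun setT f.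
Proof. by move=> af _ A mA; apply: sigma_cylinder_measurable (af measurableT A mA). Qed.

Hypothesis X_indep : forall A : K -> set R, (forall k, measurable (A k)) ->
  P (\bigcap_k X k @^-1` A k) = (\prod_k P (X k @^-1` A k))%E.

(** Both sides are finite measures of E: the restriction of P to the event of X k, and P scaled by
    the probability of that event. They agree on cylinders, hence on the generated sigma-algebra. *)
Lemma sigma_cylinder_indep C k E (B : set R) : ~~ C k -> <<s cylinder C >> E ->
  measurable B -> P (E `&` X k @^-1` B) = (P E * P (X k @^-1` B))%E.
Proof.
move=> Ck sE mB.
have mV : measurable (X k @^-1` B) by rewrite -[X in measurable X]setTI; exact: mX.
pose V := X k @^-1` B.
have PV0 : 0 <= fine (P V) by rewrite fine_ge0.
pose m1 := mrestr P mV; pose m2 := mscale (NngNum PV0) P.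
have fV : P V \is a fin_num by exact: fin_num_measure.
suff -> : P (E `&` V) = m2 E by rewrite /m2 /mscale/= fineK// muleC.
rewrite -[LHS]/(m1 E).
apply: (@g_sigma_algebra_measure_unique _ _ _ (cylinder C) _ (fun=> setT)) sE.
- exact: cylinder_measurable.
- by move=> _; exact: cylinderT.
- by rewrite bigcup_const//.
- exact: cylinderI.
- move=> _ [A [mA ->]].
  suff : P ((\bigcap_(k in [set k | C k]) X k @^-1` A k) `&` V) =
      (P V * P (\bigcap_(k in [set k | C k]) X k @^-1` A k))%E.
    by move=> E'; rewrite [LHS]E' /= /mscale/= fineK.
  rewrite muleC /V.
  (* Padding with the full line outside C turns the cylinder into a box over all coordinates, to
     which [X_indep] applies. [A1] inserts B at k, where [A0] is the full line. *)
  pose A0 j := if C j then A j else setT.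
  have mA0 j : measurable (A0 j) by rewrite /A0; case: ifP.
  pose A1 j := if j == k then B else A0 j.
  have mA1 j : measurable (A1 j) by rewrite /A1; case: ifP.
  have -> : \bigcap_(k in [set k | C k]) X k @^-1` A k = \bigcap_j X j @^-1` A0 j.
    apply/seteqP; split=> [w Aw j _|w Aw j Cj]; rewrite /preimage /A0/=.
      by case: ifPn => // Cj; exact: Aw.
    by have := Aw j I; rewrite /preimage /A0/= Cj.
  have -> : \bigcap_j X j @^-1` A0 j `&` X k @^-1` B = \bigcap_j X j @^-1` A1 j.
    apply/seteqP; split=> [w [Aw Bw] j _|w Aw]; rewrite /preimage /A1/=.
      by case: eqP => [->//|_]; exact: Aw.
    split=> [j _|]; last by have := Aw k I; rewrite /preimage /A1/= eqxx.
    have := Aw j I; rewrite /preimage /A1/=; case: eqP => // -> _.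
    by rewrite /A0 (negbTE Ck).
  rewrite !X_indep// (bigD1 k)//= [in RHS](bigD1 k)//=.
  rewrite /A1 eqxx {2}/A0 (negbTE Ck) preimage_setT probability_setT mul1e.
  rewrite muleC; congr (_ * _)%E; apply: eq_bigr => j /negbTE jk.
  by rewrite jk.
- by move=> _; rewrite /= /mrestr/= setTI ltey_eq fV.
Qed.

Lemma mean_adaptedM C k f (g : R -> R) : ~~ C k -> adapted C f ->
  measurable_fun setT g -> L1 P f -> L1 P (fun w => g (X k w)) ->
  L1 P (fun w => f w * g (X k w)) ->
  mean P (fun w => f w * g (X k w)) = mean P f * mean P (fun w => g (X k w)).
Proof.
move=> Ck af mg if_ ig ifg; apply: mean_indepM => // A B mA mB.
rewrite -[(fun w => g (X k w)) @^-1` B]/(X k @^-1` (g @^-1` B)).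
apply: (sigma_cylinder_indep Ck); first by have := af measurableT A mA; rewrite setTI.
by rewrite -[X in measurable X]setTI; exact: mg.
Qed.

End finite_independence.

(** * White noise and the Wald identities *)

Section white_noise.
Context {d : measure_display} {T : measurableType d} {R : realType}.
Variable P : probability T R.

(** The only properties of the Brownian increments that the discrete computations use: J time steps,
    n coordinates, variance h per step. *)
Record white_noise (J n : nat) (h : R) (xi : 'I_J * 'I_n -> T -> R) : Prop := {
  noise_indep : forall A : 'I_J * 'I_n -> set R, (forall k, measurable (A k)) ->
    P (\bigcap_k xi k @^-1` A k) = (\prod_k P (xi k @^-1` A k))%E ;
  noise_L2 : forall k, L2 P (xi k) ;
  noise_mean : forall k, mean P (xi k) = 0 ;
  noise_sqr : forall k, mean P (fun w => xi k w ^+ 2) = h }.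

Variables (J n : nat) (h : R) (xi : 'I_J * 'I_n -> T -> R).
Hypothesis wn : white_noise h xi.

Definition past (j : nat) : pred ('I_J * 'I_n) := fun k => (k.1 < j)%N.

(** The sum runs over all J steps with an indicator, so that the walk at a random index is still a
    sum of a fixed number of products. *)
Definition walk (j : nat) (i : 'I_n) (w : T) : R :=
  \sum_(l < J) ((l < j)%N%:R * xi (l, i) w).

(** Whether nu exceeds j is decided by the increments of index below j, so its indicator is
    independent of increment j. *)
Definition stopping (nu : T -> nat) :=
  (forall w, (nu w <= J)%N) /\
  forall j, adapted xi (past j) (fun w => (j < nu w)%N%:R).

Let mxi k : measurable_fun setT (xi k). Proof. by case: (noise_L2 wn k). Qed.

Lemma past_self (j : 'I_J) (i : 'I_n) : ~~ past j (j, i).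
Proof. by rewrite /past/= ltnn. Qed.

Lemma past_adapted_subset j j' f : (j <= j')%N -> adapted xi (past j) f ->
  adapted xi (past j') f.
Proof.
by move=> jj'; apply: adapted_subset => k; rewrite /past => /leq_trans; apply.
Qed.

Lemma adapted_noise j (l : 'I_J) i : (l < j)%N -> adapted xi (past j) (xi (l, i)).
Proof. by move=> lj; exact: adapted_coord. Qed.

Lemma adapted_walk (j k : nat) i : (k <= j)%N -> adapted xi (past j) (walk k i).
Proof.
move=> kj; apply: (@measurable_sum _ (g_sigma_algebraType (cylinder xi (past j)))) => l.
case: (boolP (l < k)%N) => lk.
  under eq_fun do rewrite mul1r.
  by apply: adapted_noise; exact: leq_trans lk kj.
under eq_fun do rewrite mul0r.
exact: measurable_cst.
Qed.

Lemma L2_walk j i : L2 P (walk j i).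
Proof. by apply: L2_sum => l; apply: L2Z; exact: (noise_L2 wn). Qed.

Lemma L2_bounded (f : T -> R) (C : R) : measurable_fun setT f ->
  (forall w, `|f w| <= C) -> L2 P f.
Proof.
move=> mf fC; apply: (L2_le mf (L2_cst P C)) => w.
by rewrite (le_trans (fC w))// ler_norm.
Qed.

Lemma L2_bounded_mul (f g : T -> R) : measurable_fun setT f ->
  (forall w, `|f w| <= 1) -> L2 P g -> L2 P (fun w => f w * g w).
Proof.
move=> mf f1 lg; apply: (L2_le _ lg) => [|w].
  by apply: measurable_funM => //; case: lg.
by rewrite normrM ler_piMl.
Qed.

Lemma mean_noise (j : 'I_J) i f : adapted xi (past j) f -> L2 P f ->
  mean P (fun w => f w * xi (j, i) w) = 0.
Proof.
move=> af lf; rewrite (mean_adaptedM mxi (noise_indep wn) (past_self j i) af (g := id))//.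
- by rewrite (noise_mean wn) mulr0.
- exact: L2_L1.
- exact: (L2_L1 (noise_L2 wn (j, i))).
- exact: L2_mul lf (noise_L2 wn (j, i)).
Qed.

Lemma mean_noise2 (j : 'I_J) i i' f : adapted xi (past j) f -> (forall w, `|f w| <= 1) ->
  mean P (fun w => f w * xi (j, i) w * xi (j, i') w) = (i == i')%:R * (h * mean P f).
Proof.
move=> af f1; have mf := adapted_measurable mxi af.
have lf : L2 P f by exact: L2_bounded mf f1.
have lfx : L2 P (fun w => f w * xi (j, i) w).
  exact: L2_bounded_mul mf f1 (noise_L2 wn (j, i)).
have [<-{i'}|ii'] := eqVneq i i'.
  under eq_mean do rewrite -mulrA -expr2.
  rewrite (mean_adaptedM mxi (noise_indep wn) (past_self j i) af (g := fun x => x ^+ 2))//.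
  - by rewrite mul1r (noise_sqr wn) mulrC.
  - exact: L2_L1.
  - by case: (noise_L2 wn (j, i)).
  - apply: eq_L1 (L2_mul lfx (noise_L2 wn (j, i))) => w.
    by rewrite -mulrA -expr2.
(* For two different coordinates at the same time, f times the first increment is a function of all
   increments except the second. *)
have jC : ~~ predC1 (j, i') (j, i') by rewrite /= eqxx.
have afx : adapted xi (predC1 (j, i')) (fun w => f w * xi (j, i) w).
  apply: measurable_funM.
    apply: adapted_subset af => k; rewrite /past /=.
    by apply: contraTneq => -> /=; rewrite ltnn.
  by apply: adapted_coord; rewrite /= xpair_eqE eqxx.
rewrite (mean_adaptedM mxi (noise_indep wn) jC afx (g := id))//.
- by rewrite (noise_mean wn) mulr0 mul0r.
- exact: L2_L1.
- exact: (L2_L1 (noise_L2 wn (j, i'))).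
- exact: L2_mul lfx (noise_L2 wn (j, i')).
Qed.

End white_noise.

Lemma sum_ltn_const (R : pzSemiRingType) (J k : nat) : (k <= J)%N ->
  \sum_(l < J) (l < k)%N%:R = k%:R :> R.
Proof.
move=> kJ; rewrite -natr_sum; congr (_%:R).
rewrite (eq_bigr (fun l : 'I_J => if (l < k)%N then 1%N else 0%N)); last first.
  by move=> l _; case: ltnP.
by rewrite -big_mkcond/= -(big_ord_widen _ (fun=> 1%N) kJ) sum1_card card_ord.
Qed.

Section wald.
Context {d : measure_display} {T : measurableType d} {R : realType}.
Variables (P : probability T R) (J n : nat) (h : R).
Variable xi : 'I_J * 'I_n -> T -> R.
Hypothesis wn : white_noise P h xi.
Implicit Types (nu rho : T -> nat) (i : 'I_n).

Let mxi k : measurable_fun setT (xi k). Proof. by case: (noise_L2 wn k). Qed.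

Let ind_le1 (b : bool) : `|b%:R| <= 1 :> R.
Proof. by case: b; rewrite ?normr1 ?normr0. Qed.

Let mind nu (l : nat) : stopping xi nu -> measurable_fun setT (fun w => (l < nu w)%N%:R : R).
Proof. by move=> [_ /(_ l)]; exact: adapted_measurable. Qed.

Lemma L2_stopping nu : stopping xi nu -> L2 P (fun w => (nu w)%:R).
Proof.
move=> snu; have -> : (fun w => (nu w)%:R : R) = fun w => \sum_(l < J) (l < nu w)%N%:R.
  by apply/funext => w; rewrite sum_ltn_const//; exact: snu.1.
by apply: L2_sum => l; apply: L2_bounded (mind l snu) _ => w; exact: ind_le1.
Qed.

Lemma L2_stopped nu i : stopping xi nu -> L2 P (fun w => walk xi (nu w) i w).
Proof.
move=> snu; apply: L2_sum => l.
by apply: L2_bounded_mul (mind l snu) _ (noise_L2 wn _) => w; exact: ind_le1.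
Qed.

Lemma mean_stopped nu i : stopping xi nu -> mean P (fun w => walk xi (nu w) i w) = 0.
Proof.
move=> snu; rewrite mean_sum => [|l]; last first.
  apply: L2_L1; apply: L2_bounded_mul (mind l snu) _ (noise_L2 wn _) => w.
  exact: ind_le1.
rewrite big1// => l _; apply: (mean_noise wn); first exact: snu.2.
by apply: L2_bounded (mind l snu) _ => w; exact: ind_le1.
Qed.

(** In the double sum over steps, an off-diagonal term vanishes because its later increment is
    independent of the earlier increment and of both indicators. The diagonal terms count the steps
    before both indices. *)
Lemma mean_stoppedM nu rho i i' : stopping xi nu -> stopping xi rho ->
  mean P (fun w => walk xi (nu w) i w * walk xi (rho w) i' w) =
  (i == i')%:R * (h * mean P (fun w => (minn (nu w) (rho w))%:R)).
Proof.
move=> snu srho.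
pose a nu' (l : 'I_J) k w := (l < nu' w)%N%:R * xi (l, k) w.
have La nu' l k : stopping xi nu' -> L2 P (a nu' l k).
  move=> s; apply: L2_bounded_mul (mind l s) _ (noise_L2 wn _) => w.
  exact: ind_le1.
have aa nu' (j l : 'I_J) k : stopping xi nu' -> (l < j)%N -> adapted xi (past j) (a nu' l k).
  move=> s lj; apply: measurable_funM; last exact: adapted_noise.
  by apply: past_adapted_subset (s.2 l); exact: ltnW.
have off nu' rho' (j l : 'I_J) k k' : stopping xi nu' -> stopping xi rho' -> (l < j)%N ->
    mean P (fun w => a nu' l k w * a rho' j k' w) = 0.
  move=> s s' lj; under eq_mean do rewrite mulrA.
  apply: (mean_noise wn).
    by apply: measurable_funM; [exact: aa|exact: s'.2].
  under eq_fun do rewrite mulrC.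
  by apply: L2_bounded_mul (mind j s') _ (La _ _ _ s) => w; exact: ind_le1.
have -> : (fun w => walk xi (nu w) i w * walk xi (rho w) i' w) =
    (fun w => \sum_(l < J) \sum_(j < J) a nu l i w * a rho j i' w).
  by apply/funext => w; rewrite /walk big_distrlr.
have iaa l j : L1 P (fun w => a nu l i w * a rho j i' w) by apply: L2_mul; exact: La.
rewrite mean_sum => [|l]; last exact: L1_sum.
have -> : (fun w => (minn (nu w) (rho w))%:R : R) =
    fun w => \sum_(l < J) ((l < nu w)%N%:R * (l < rho w)%N%:R).
  apply/funext => w; rewrite -(@sum_ltn_const R J); last first.
    by rewrite geq_min snu.1.
  by apply: eq_bigr => l _; rewrite ltn_min -natrM mulnb.
have indM_le1 (l : 'I_J) w : `|(l < nu w)%N%:R * (l < rho w)%N%:R| <= 1 :> R.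
  by rewrite normrM mulr_ile1.
have mindM (l : 'I_J) : adapted xi (past l) (fun w => (l < nu w)%N%:R * (l < rho w)%N%:R).
  by apply: measurable_funM; [exact: snu.2|exact: srho.2].
rewrite mean_sum; last first.
  move=> l; apply: L2_L1; apply: (L2_bounded P (adapted_measurable mxi (mindM l))).
  exact: indM_le1.
rewrite !mulr_sumr; apply: eq_bigr => l _.
rewrite mean_sum// (bigD1 l)//= big1 ?addr0 => [|j jl].
  rewrite -(mean_noise2 wn i i' (mindM l) (indM_le1 l)).
  by apply: eq_mean => w; rewrite /a; ring.
case: (ltngtP l j) => [lj|lj|/val_inj lj]; first exact: off.
  by under eq_mean do rewrite mulrC; exact: off.
by rewrite lj eqxx in jl.
Qed.

(* Discrete integration by parts: the increments after time l do not correlate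
   with the event that nu has not occurred by time l. *)
Lemma mean_stopping_stopped nu i : stopping xi nu ->
  mean P (fun w => (nu w)%:R * walk xi (nu w) i w) =
  mean P (fun w => \sum_(l < J) ((l < nu w)%N%:R * walk xi l i w)).
Proof.
move=> snu.
have mc (l j : 'I_J) : L1 P (fun w => (l < nu w)%N%:R * ((j < nu w)%N%:R * xi (j, i) w)).
  apply: L2_L1; apply: L2_bounded_mul (mind l snu) _ _ => [w|]; first exact: ind_le1.
  by apply: L2_bounded_mul (mind j snu) _ (noise_L2 wn _) => w; exact: ind_le1.
have mc' (l j : 'I_J) : L1 P (fun w => (l < nu w)%N%:R * ((j < l)%N%:R * xi (j, i) w)).
  apply: L2_L1; apply: L2_bounded_mul (mind l snu) _ _ => [w|]; first exact: ind_le1.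
  by apply: L2Z; exact: (noise_L2 wn).
have -> : (fun w => (nu w)%:R * walk xi (nu w) i w) = (fun w => \sum_(l < J) \sum_(j < J)
    (l < nu w)%N%:R * ((j < nu w)%N%:R * xi (j, i) w)).
  apply/funext => w; rewrite -(@sum_ltn_const R J); last exact: snu.1.
  by rewrite /walk big_distrlr.
have -> : (fun w => \sum_(l < J) (l < nu w)%N%:R * walk xi l i w) =
    (fun w => \sum_(l < J) \sum_(j < J)
    (l < nu w)%N%:R * ((j < l)%N%:R * xi (j, i) w)).
  by apply/funext => w; apply: eq_bigr => l _; rewrite /walk mulr_sumr.
rewrite mean_sum => [|l]; last exact: L1_sum.
rewrite [RHS]mean_sum => [|l]; last exact: L1_sum.
apply: eq_bigr => l _; rewrite !mean_sum//.
apply: eq_bigr => j _; case: ltnP => [jl|lj].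
  apply: eq_mean => w; case: (ltnP l (nu w)) => lnu; rewrite ?mul0r//.
  by rewrite (ltn_trans jl lnu).
under [RHS]eq_mean do rewrite mul0r mulr0.
rewrite mean_cst.
under eq_mean do rewrite mulrA.
apply: (mean_noise wn); first apply: measurable_funM.
- exact: past_adapted_subset (snu.2 l).
- exact: snu.2.
apply: L2_bounded_mul (mind l snu) _ _ => [w|]; first exact: ind_le1.
by apply: L2_bounded (mind j snu) _ => w; exact: ind_le1.
Qed.

End wald.

(** * Doob's maximal inequality *)

Section running_max.
Context {R : realDomainType}.
Implicit Types x : nat -> R.

Fixpoint running_max x (j : nat) : R :=
  if j is j'.+1 then Num.max (running_max x j') (x j) else x 0%N.

Lemma running_max_ge x j l : (l <= j)%N -> x l <= running_max x j.
Proof.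
elim: j => [|j IHj] /=; first by rewrite leqn0 => /eqP->.
by rewrite leq_eqVlt ltnS le_max => /predU1P[->|/IHj->]; rewrite ?lexx ?orbT.
Qed.

Lemma running_max_attained x j : exists2 l, (l <= j)%N & running_max x j = x l.
Proof.
elim: j => [|j [l lj IHj]] /=; first by exists 0%N.
by case: leP => _; [exists j.+1|exists l => //; exact: leqW].
Qed.

(* The running maximum only increases at times when it equals x, so summation
   by parts bounds its square by a discrete stochastic integral. *)
Lemma running_max_sqr_le x j : x 0%N = 0 ->
  running_max x j ^+ 2 <= 2 * x j * running_max x j -
    2 * \sum_(l < j) running_max x l * (x l.+1 - x l).
Proof.
move=> x0; elim: j => [|j IHj] /=.
  by rewrite big_ord0 x0 !mulr0 subr0 expr2 mulr0.
rewrite big_ord_recr/=; move: IHj; set r := running_max x j; set s := \sum_(i < j) _.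
by case: (leP r (x j.+1)) => rx IHj; have := sqr_ge0 (x j.+1 - r); nra.
Qed.

End running_max.

Section doob.
Context {d : measure_display} {T : measurableType d} {R : realType}.
Variables (P : probability T R) (J n : nat) (h : R).
Variable xi : 'I_J * 'I_n -> T -> R.
Hypothesis wn : white_noise P h xi.
Variables (nu : T -> nat) (i : 'I_n) (e : R).
Hypotheses (snu : stopping xi nu) (e2 : e ^+ 2 = 1).

Let mxi k : measurable_fun setT (xi k). Proof. by case: (noise_L2 wn k). Qed.

Let M (l : nat) (w : T) := e * walk xi (minn l (nu w)) i w.

Let ind (l : nat) (w : T) : R := (l < nu w)%N%:R.

Let ind_le1 l w : `|ind l w| <= 1.
Proof. by rewrite /ind; case: (l < nu w)%N; rewrite ?normr1 ?normr0. Qed.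

Let mind l : measurable_fun setT (ind l).
Proof. by case: snu => [_ /(_ l)]; exact: adapted_measurable. Qed.

Let ME l w : M l w = e * \sum_(j < J) ((j < l)%N%:R * (ind j w * xi (j, i) w)).
Proof.
congr (_ * _); apply: eq_bigr => j _.
by rewrite ltn_min /ind; case: (j < l)%N; case: (j < nu w)%N; rewrite ?mul0r ?mul1r ?mulr0.
Qed.

Let L2M l : L2 P (M l).
Proof.
rewrite (funext (ME l)); apply: L2Z; apply: L2_sum => j; apply: L2Z.
by apply: L2_bounded_mul (mind j) _ (noise_L2 wn _) => w; exact: ind_le1.
Qed.

Let adapted_M l j : (l <= j)%N -> adapted xi (past j) (M l).
Proof.
move=> lj; rewrite (funext (ME l)).
apply: measurable_funM; first exact: measurable_cst.
apply: (@measurable_sum _ (g_sigma_algebraType (cylinder xi (past j)))) => m.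
case: (ltnP m l) => ml; last first.
  under eq_fun do rewrite mul0r.
  exact: measurable_cst.
under eq_fun do rewrite mul1r.
have mj := leq_trans ml lj.
apply: measurable_funM; last exact: adapted_noise.
by apply: past_adapted_subset (snu.2 m); exact: ltnW.
Qed.

Let rm (j : nat) (w : T) := running_max (M ^~ w) j.

Let L2rm j : L2 P (rm j).
Proof.
elim: j => [|j IHj]; first exact: L2M.
exact: L2_max IHj (L2M j.+1).
Qed.

Let adapted_rm l j : (l <= j)%N -> adapted xi (past j) (rm l).
Proof.
elim: l => [|l IHl] lj; first exact: adapted_M.
by apply: measurable_maxr; [apply: IHl; exact: ltnW|exact: adapted_M].
Qed.

Let MD (l : 'I_J) w : M l.+1 w - M l w = e * (ind l w * xi (l, i) w).
Proof.
rewrite !ME -mulrBr -sumrB; congr (_ * _).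
rewrite (bigD1 l)//= ltnSn ltnn mul1r mul0r subr0 big1 ?addr0// => j jl.
rewrite -mulrBl ltnS leq_eqVlt; case: eqP => [/val_inj jl'|_]; last by rewrite subrr mul0r.
by rewrite jl' eqxx in jl.
Qed.

(** In the pathwise bound [running_max_sqr_le] the discrete stochastic integral has mean zero, since
    the running maximum before a step is adapted. The sign e lets the one-sided maximum be applied
    to the walk and to its opposite. *)
Lemma doob_maximal :
  L2 P (fun w => running_max (fun l => e * walk xi (minn l (nu w)) i w) J) /\
  mean P (fun w => running_max (fun l => e * walk xi (minn l (nu w)) i w) J ^+ 2)
    <= 4 * h * mean P (fun w => (nu w)%:R).
Proof.
split; first exact: (L2rm J).
have MJ w : M J w ^+ 2 = walk xi (nu w) i w * walk xi (nu w) i w.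
  by rewrite /M (minn_idPr _) ?(snu.1 w)// exprMn e2 mul1r expr2.
have iMJ : L1 P (fun w => M J w ^+ 2) by case: (L2M J).
have EMJ : mean P (fun w => M J w ^+ 2) = h * mean P (fun w => (nu w)%:R).
  under eq_mean do rewrite MJ.
  rewrite (mean_stoppedM wn i i snu snu) eqxx mul1r.
  by under eq_mean do rewrite minnn.
pose I (l : 'I_J) w := rm l w * (M l.+1 w - M l w).
have iI l : L1 P (I l).
  by apply: L2_mul; [exact: L2rm|exact: L2B].
have EI l : mean P (I l) = 0.
  have := mean_noise wn (j := l) i (f := fun w => e * (rm l w * ind l w)).
  rewrite /I => <-.
  - by apply: eq_mean => w; rewrite MD; ring.
  - apply: measurable_funM; first exact: measurable_cst.
    by apply: measurable_funM; [exact: adapted_rm|exact: snu.2].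
  - apply: L2Z; under eq_fun do rewrite mulrC.
    exact: L2_bounded_mul (mind l) (ind_le1 l) (L2rm l).
have path w : rm J w ^+ 2 <= 4 * M J w ^+ 2 - 4 * \sum_(l < J) I l w.
  have x0 : M 0%N w = 0.
    by rewrite ME big1 ?mulr0// => j _; rewrite mul0r.
  have : rm J w ^+ 2 <= 2 * M J w * rm J w - 2 * \sum_(l < J) I l w.
    exact: (@running_max_sqr_le R (M ^~ w) J x0).
  (* This square absorbs the cross term 2 M r into 2 M^2 + r^2 / 2, which is where the constant 4
     arises. *)
  have := sqr_ge0 (2 * M J w - rm J w); nra.
apply: le_trans (mean_le _ _ path) _.
- by case: (L2rm J).
- by apply: L1B; [exact: L1Z|apply: L1Z; exact: L1_sum].
rewrite meanB; [|exact: L1Z|by apply: L1Z; exact: L1_sum].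
rewrite !meanZ//; last exact: L1_sum.
by rewrite mean_sum// big1// mulr0 subr0 EMJ mulrA.
Qed.

End doob.

(** * Hitting indices of sequences *)

Section hit.
Context {R : realDomainType}.
Implicit Types (x : nat -> R) (Q : R).

(** The value J means that the level is not reached at any index below J; the entry at J itself is
    not inspected. *)
Definition hit (J : nat) x Q : nat := find (fun j => Q <= x j) (iota 0 J).

Lemma hit_le J x Q : (hit J x Q <= J)%N.
Proof. by rewrite -[leqRHS](size_iota 0) find_size. Qed.

Lemma before_hit J x Q j : (j < hit J x Q)%N -> x j < Q.
Proof.
move=> jh; have jJ := leq_trans jh (hit_le J x Q).
by have := before_find 0%N jh; rewrite nth_iota// add0n => /negbT; rewrite -ltNge.
Qed.

Lemma at_hit J x Q : (hit J x Q < J)%N -> Q <= x (hit J x Q).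
Proof.
move=> hJ; have : has (fun j => Q <= x j) (iota 0 J) by rewrite has_find size_iota.
by move=> /(nth_find 0%N); rewrite nth_iota.
Qed.

Lemma ltn_hit J x Q j :
  (j < hit J x Q)%N = (j < J)%N && [forall l : 'I_j.+1, x l < Q].
Proof.
apply/idP/andP => [jh|[jJ /forallP xQ]].
  split; first exact: leq_trans jh (hit_le J x Q).
  by apply/forallP => l; apply: (@before_hit J); exact: leq_trans (ltn_ord l) jh.
rewrite ltnNge; apply/negP => hj.
have := at_hit (leq_ltn_trans hj jJ); rewrite leNgt.
by have /= -> := xQ (Ordinal (leq_ltn_trans hj (ltnSn j))).
Qed.

Lemma hit_min J x Q j : (j < J)%N -> Q <= x j -> (hit J x Q <= j)%N.
Proof.
move=> jJ Qx; rewrite leqNgt; apply/negP => /before_hit.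
by rewrite ltNge Qx.
Qed.

Lemma hit_mono J J' x Q : (J <= J')%N -> (hit J x Q <= hit J' x Q)%N.
Proof.
move=> JJ'; case: (ltnP (hit J' x Q) J) => [hJ|]; last exact/leq_trans/hit_le.
by apply: hit_min => //; apply: at_hit; exact: leq_trans JJ'.
Qed.

Lemma eq_hit J x y Q : (forall j, (j < J)%N -> x j = y j) -> hit J x Q = hit J y Q.
Proof.
by move=> xy; apply: eq_in_find => j; rewrite mem_iota add0n => /andP[_ jJ]; rewrite xy.
Qed.

(** A hit of the subsampled sequence is a hit of the full one, and without a hit the two cutoffs
    coincide. *)
Lemma hit_stride J p x Q : (0 < p)%N ->
  (hit (J * p) x Q <= hit J (fun l => x (l * p)%N) Q * p)%N.
Proof.
move=> p0; have := hit_le J (fun l => x (l * p)%N) Q; rewrite leq_eqVlt => /predU1P[->|hJ].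
  exact: hit_le.
by apply: hit_min; [rewrite ltn_pmul2r|exact: at_hit hJ].
Qed.

End hit.

Section hitting_stopping.
Context {d : measure_display} {T : measurableType d} {R : realType}.
Variables (J n : nat) (xi : 'I_J * 'I_n -> T -> R).

(* The factor p lets a grid coarser than that of xi be watched, and m is a
   deterministic delay. *)
Lemma stopping_hit (x : nat -> T -> R) (Q : R) (J0 p m : nat) :
  (0 < p)%N -> (J0 * p + m <= J)%N -> (forall l, adapted xi (past l) (x l)) ->
  stopping xi (fun w => hit J0 (fun l => x (l * p)%N w) Q * p + m)%N.
Proof.
move=> p0 JpmJ ax; split=> [w|j].
  by apply: leq_trans JpmJ; rewrite leq_add2r leq_mul2r hit_le orbT.
case: (ltnP j m) => jm.
  rewrite (_ : (fun w => _) = fun=> 1); first exact: measurable_cst.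
  by apply/funext => w; rewrite (leq_trans jm (leq_addl _ _)).
apply: (@past_adapted_subset _ _ _ _ _ xi (j - m)%N); first exact: leq_subr.
(* Stopping has not occurred by time j exactly when q < J0 and the samples 0 to q are all below Q.
   Their times l * p are at most j - m, and a finite product of indicators is visibly adapted. *)
pose q := ((j - m) %/ p)%N.
have -> : (fun w => (j < hit J0 (fun l => x (l * p)%N w) Q * p + m)%N%:R) =
    (fun w => \prod_(l < q.+1) ((q < J0)%N%:R * (x (l * p)%N w < Q)%R%:R) : R).
  apply/funext => w.
  rewrite addnC -ltn_subLR// -ltn_divLR// ltn_hit -/q.
  apply/esym; case: (boolP (q < J0)%N) => qJ /=; last first.
    by rewrite big_ord_recl mul0r mul0r.
  under eq_bigr do rewrite mul1r.
  case: (boolP [forall l : 'I_q.+1, _]) => [/forallP xQ|].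
    by rewrite big1// => l _; have /= -> := xQ l.
  rewrite negb_forall => /existsP[l /negbTE xl].
  by rewrite (bigD1 l)//= xl mul0r.
apply: (@measurable_prod _ (g_sigma_algebraType (cylinder xi (past (j - m))))) => l _.
apply: measurable_funM; first exact: measurable_cst.
have axl : adapted xi (past (j - m)) (x (l * p)%N).
  apply: past_adapted_subset (ax _).
  by rewrite -leq_divRL// -ltnS.
rewrite (_ : (fun w => _) = fun w => if x (l * p)%N w < Q then 1 else 0); last first.
  by apply/funext => w; case: (_ < Q).
apply: measurable_fun_ifT; [|exact: measurable_cst|exact: measurable_cst].
by apply: measurable_fun_ltr => //; exact: measurable_cst.
Qed.

End hitting_stopping.

Section maximal_square.
Context {d : measure_display} {T : measurableType d} {R : realType}.
Variables (P : probability T R) (J n : nat) (h : R).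
Variable xi : 'I_J * 'I_n -> T -> R.

Definition stopped_max (e : R) (nu : T -> nat) (i : 'I_n) (w : T) : R :=
  running_max (fun l => e * walk xi (minn l (nu w)) i w) J.

(** Both one-sided maxima are nonnegative because the walk starts at 0, so the sum of their squares
    dominates the square of the walk without absolute values in the maximum. *)
Definition maxsq (nu : T -> nat) (i : 'I_n) (w : T) : R :=
  stopped_max 1 nu i w ^+ 2 + stopped_max (-1) nu i w ^+ 2.

Lemma walk0 i w : walk xi 0 i w = 0.
Proof. by rewrite /walk big1// => l _; rewrite mul0r. Qed.

Lemma stopped_max_ge0 e nu i w : 0 <= stopped_max e nu i w.
Proof.
have := @running_max_ge R (fun l => e * walk xi (minn l (nu w)) i w) J 0%N isT.
by rewrite min0n walk0 mulr0.
Qed.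

Lemma stopped_max_ge e nu i w l : (nu w <= J)%N -> (l <= nu w)%N ->
  e * walk xi l i w <= stopped_max e nu i w.
Proof.
move=> nuJ lnu; have lJ := leq_trans lnu nuJ.
have := @running_max_ge R (fun l => e * walk xi (minn l (nu w)) i w) J l lJ.
by rewrite (minn_idPl lnu).
Qed.

Lemma stopped_max_attained e nu i w : exists2 l, (l <= nu w)%N &
  stopped_max e nu i w = e * walk xi l i w.
Proof.
rewrite /stopped_max.
have [l _ ->] := running_max_attained (fun l => e * walk xi (minn l (nu w)) i w) J.
by exists (minn l (nu w)) => //; exact: geq_minr.
Qed.

Lemma maxsq_ge nu i w l : (nu w <= J)%N -> (l <= nu w)%N ->
  walk xi l i w ^+ 2 <= maxsq nu i w.
Proof.
move=> nuJ lnu.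
have := stopped_max_ge 1 i nuJ lnu; have := stopped_max_ge (-1) i nuJ lnu; have := stopped_max_ge0 1 nu i w.
have := stopped_max_ge0 (-1) nu i w; rewrite /maxsq.
set a := stopped_max _ _ _ _; set b := stopped_max _ _ _ _; set x := walk _ _ _ _.
move=> a0 b0; rewrite mulN1r mul1r => xa xb.
by have [x0|x0] := leP 0 x; nra.
Qed.

Hypothesis wn : white_noise P h xi.
Variables (nu : T -> nat) (i : 'I_n).
Hypothesis snu : stopping xi nu.

Lemma L1_maxsq : L1 P (maxsq nu i).
Proof.
have [[_ l1] _] := doob_maximal wn i snu (expr1n R 2).
have [[_ l2] _] := doob_maximal wn i snu (sqrr_sign R 1).
exact: L1D.
Qed.

Lemma mean_maxsq : mean P (maxsq nu i) <= 8 * h * mean P (fun w => (nu w)%:R).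
Proof.
have [[_ l1] m1] := doob_maximal wn i snu (expr1n R 2).
have [[_ l2] m2] := doob_maximal wn i snu (sqrr_sign R 1).
rewrite meanD//; lra.
Qed.

End maximal_square.

(** * Brownian motions on dyadic grids *)

Section brownian_grid.
Context {d : measure_display} {T : measurableType d} {R : realType}.
Variables (P : probability T R) (n : nat) (B : 'I_n -> R -> {RV P >-> R}).
Hypothesis B_brownian : forall i, standard_brownian_motion (B i).
Hypothesis B_indep : independent_processes P (fun i t w => B i t w).

Definition brownian_increment (h : R) (J : nat) (k : 'I_J * 'I_n) (w : T) : R :=
  B k.2 (k.1.+1%:R * h) w - B k.2 (k.1%:R * h) w.

Lemma walk_brownian h J j i w : (j <= J)%N ->
  walk (brownian_increment h (J := J)) j i w = B i (j%:R * h) w - B i 0 w.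
Proof.
move=> jJ; rewrite /walk.
rewrite (eq_bigr (fun l : 'I_J => if (l < j)%N then
    B i (l.+1%:R * h) w - B i (l%:R * h) w else 0)); last first.
  by move=> l _; case: ifP => _; rewrite ?mul1r ?mul0r.
rewrite -big_mkcond/=.
rewrite -(big_ord_widen _ (fun l => B i (l.+1%:R * h) w - B i (l%:R * h) w) jJ).
by rewrite -(big_mkord xpredT (fun l => B i (l.+1%:R * h) w - B i (l%:R * h) w))
  telescope_sumr// mul0r.
Qed.

Lemma sigma_of_process_increment i (s t : R) (A : set R) : 0 <= s -> 0 <= t ->
  measurable A ->
  sigma_of_process (fun t w => B i t w) ((fun w => B i t w - B i s w) @^-1` A).
Proof.
move=> s0 t0 mA.
pose G := \bigcup_(t in [set t : R | 0 <= t]) sigma_of_variable (fun w => B i t w).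
have mB u : 0 <= u -> @measurable_fun _ _ (g_sigma_algebraType G) R setT (fun w => B i u w).
  move=> u0 _ U mU; apply: sub_sigma_algebra; exists u => //.
  by exists U.
have := measurable_funB (mB t t0) (mB s s0).
by move=> /(_ measurableT A mA); rewrite setTI.
Qed.

(** Independence of the array is obtained in two stages: across coordinates from the independence of
    the motions, then along time from the independent increments of each. *)
Lemma brownian_white_noise h J : 0 < h -> white_noise P h (brownian_increment h (J := J)).
Proof.
move=> h0.
have tS (l : nat) : (l%:R * h : R) < l.+1%:R * h by rewrite ltr_pM2r// ltr_nat.
have t0 (l : nat) : 0 <= l%:R * h :> R by rewrite mulr_ge0// ltW.
have mincr (k : 'I_J * 'I_n) : measurable_fun setT (brownian_increment h k).
  by apply: measurable_funB; exact: measurable_funP.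
have law (k : 'I_J * 'I_n) (A : set R) : measurable A ->
    P (brownian_increment h k @^-1` A) = normal_prob 0 (Num.sqrt h) A.
  move=> mA.
  have tE : k.1.+1%:R * h - k.1%:R * h = h by rewrite -mulrBl -natrB// subSnn mul1r.
  have := brownian_gaussian (B_brownian k.2) (t0 k.1) (tS k.1) mA.
  by rewrite tE.
have sh : 0 < Num.sqrt h by rewrite sqrtr_gt0.
split.
- move=> A mA.
  pose E i := \bigcap_(l in [set: 'I_J]) (brownian_increment h (l, i) @^-1` A (l, i)).
  have -> : \bigcap_k brownian_increment h k @^-1` A k =
      \bigcap_(i in [set` [set: 'I_n]%SET]) E i.
    apply/seteqP; split=> [w Aw i _ l _|w Ew [l i] _]; first exact: Aw.
    by apply: Ew => //=; rewrite finset.in_setT.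
  rewrite B_indep; last first.
    move=> i _; pose GT := g_sigma_algebraType (\bigcup_(t in [set t : R | 0 <= t])
      sigma_of_variable (fun w => B i t w)).
    apply: (@fin_bigcap_measurable _ GT); first exact: finite_finset.
    by move=> l _; apply: sigma_of_process_increment.
  have PE i : P (E i) = (\prod_(l < J) P (brownian_increment h (l, i) @^-1` A (l, i)))%E.
    have := brownian_independent (B_brownian i) (k := J) (t := fun l => l%:R * h).
    have ndt : {homo (fun l : nat => l%:R * h) : a b / (a <= b)%N >-> a <= b}.
      by move=> a b ab; rewrite ler_pM2r// ler_nat.
    move=> /(_ (t0 0%N) ndt [set: 'I_J]%SET (fun l => brownian_increment h (l, i) @^-1` A (l, i))).
    rewrite (_ : [set` [set: 'I_J]%SET] = setT); last first.
      by apply/seteqP; split=> // l _ /=; rewrite finset.in_setT.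
    move=> ->; last by move=> l _; exists (A (l, i)) => //; rewrite setTI.
    by apply: eq_bigl => l; rewrite finset.in_setT.
  under eq_bigr do rewrite PE.
  rewrite exchange_big pair_big /=.
  by apply: eq_big => [[l i]|[l i] _]//=; rewrite finset.in_setT.
- by move=> k; exact: L2_gaussian sh (mincr k) (law k).
- by move=> k; exact: mean_gaussian sh (mincr k) (law k).
- by move=> k; rewrite (mean_sqr_gaussian sh (mincr k) (law k)) sqr_sqrtr// ltW.
Qed.

End brownian_grid.

(** * Hitting times on nested grids and a uniform bound on the maxima *)

Section grid_hitting.
Context {d : measure_display} {Omega : measurableType d} {R : realType}.
Variables (P : probability Omega R) (n : nat) (B : 'I_n -> R -> {RV P >-> R}).
Hypothesis B_brownian : forall i, standard_brownian_motion (B i).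
Hypothesis B_indep : independent_processes P (fun i t w => B i t w).
Variables D sigma : 'I_n -> R.
Hypotheses (Dtot_gt0 : 0 < \sum_(i < n) D i) (sigma_ge0 : forall i, 0 <= sigma i).
Variables (Q h0 : R) (m0 : nat).
Hypotheses (Q_ge0 : 0 <= Q) (h0_gt0 : 0 < h0).

Let Dtot := \sum_(i < n) D i.

(** B i 0 vanishes only almost surely. Subtracting it makes the identification with the walks, and
    the value 0 at time 0, hold on every path. *)
Definition centered i t w : R := B i t w - B i 0 w.

Definition total_demand t w : R := \sum_(i < n) (D i * t + sigma i * centered i t w).

Definition mesh k : R := h0 / 2 ^+ k.

(** 4^k steps of length h0 / 2^k reach the time 2^k h0, which tends to infinity while the mesh tends
    to 0. The other m0 2^k steps leave room for the delay m0 h0. *)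
Definition horizon k := (4 ^ k + m0 * 2 ^ k)%N.

Definition noise k := brownian_increment B (mesh k) (J := horizon k).

Arguments noise : clear implicits.

Definition hit_index k w : nat := hit (4 ^ k) (fun j => total_demand (j%:R * mesh k) w) Q.

(** The hit on the fixed grid of mesh h0, cut off at the same time 2^k h0 as [hit_index]. It is
    nondecreasing in k, as only the cutoff changes. *)
Definition coarse_index k w : nat := hit (2 ^ k) (fun j => total_demand (j%:R * h0) w) Q.

Definition delayed_hit k w : nat := (hit_index k w + m0 * 2 ^ k)%N.

Definition delayed_coarse k w : nat := (coarse_index k w * 2 ^ k + m0 * 2 ^ k)%N.

Lemma mesh_gt0 k : 0 < mesh k.
Proof. by rewrite divr_gt0// exprn_gt0. Qed.

Lemma meshS k : mesh k = 2 * mesh k.+1.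
Proof. by rewrite /mesh exprS; field; rewrite expf_neq0. Qed.

Lemma mesh_pow2 k : (2 ^ k)%:R * mesh k = h0.
Proof. by rewrite /mesh natrX; field; rewrite expf_neq0. Qed.

Lemma white_noise_mesh k : white_noise P (mesh k) (noise k).
Proof. exact: brownian_white_noise (mesh_gt0 k). Qed.

Lemma walk_centered k j i w : (j <= horizon k)%N ->
  walk (noise k) j i w = centered i (j%:R * mesh k) w.
Proof. exact: walk_brownian. Qed.

Lemma hit_index_coarse k w : (hit_index k w <= coarse_index k w * 2 ^ k)%N.
Proof.
rewrite /hit_index -[4%N]/(2 * 2)%N expnMn.
have -> : coarse_index k w =
    hit (2 ^ k) (fun l => total_demand ((l * 2 ^ k)%:R * mesh k) w) Q.
  by apply: eq_hit => j _; rewrite natrM -mulrA mesh_pow2.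
by apply: (hit_stride _ (fun j => total_demand (j%:R * mesh k) w)); rewrite expn_gt0.
Qed.

Lemma delayed_hit_coarse k w : (delayed_hit k w <= delayed_coarse k w)%N.
Proof. by rewrite leq_add2r hit_index_coarse. Qed.

Lemma delayed_coarse_horizon k w : (delayed_coarse k w <= horizon k)%N.
Proof.
by rewrite leq_add2r -[4%N]/(2 * 2)%N expnMn leq_mul2r hit_le orbT.
Qed.

(** The total demand rewritten through the increments, since adaptedness refers to them. *)
Let demand_walk k j w : R :=
  \sum_(i < n) (D i * (j%:R * mesh k) + sigma i * walk (noise k) j i w).

Let adapted_demand k j : adapted (noise k) (past j) (demand_walk k j).
Proof.
apply: (@measurable_sum _ (g_sigma_algebraType (cylinder (noise k) (past j)))) => i.
apply: measurable_funD; first exact: measurable_cst.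
apply: measurable_funM; first exact: measurable_cst.
exact: adapted_walk.
Qed.

Let demand_walkE k j w : (j <= horizon k)%N ->
  demand_walk k j w = total_demand (j%:R * mesh k) w.
Proof. by move=> jk; apply: eq_bigr => i _; rewrite walk_centered. Qed.

Lemma stopping_hit_index k m : (m <= m0 * 2 ^ k)%N ->
  stopping (noise k) (fun w => hit_index k w + m)%N.
Proof.
move=> mk; have := @stopping_hit _ _ _ _ _ (noise k) (demand_walk k) Q (4 ^ k) 1 m isT.
rewrite muln1 leq_add2l => /(_ mk (@adapted_demand k)).
congr stopping; apply/funext => w; rewrite muln1; congr (_ + _)%N.
apply: eq_hit => j j4; rewrite muln1 demand_walkE//.
by rewrite (leq_trans (ltnW j4))// leq_addr.
Qed.

Lemma stopping_delayed_coarse k : stopping (noise k) (delayed_coarse k).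
Proof.
have p0 : (0 < 2 ^ k)%N by rewrite expn_gt0.
have := @stopping_hit _ _ _ _ _ (noise k) (demand_walk k) Q
  (2 ^ k) (2 ^ k) (m0 * 2 ^ k) p0.
rewrite -expnMn => /(_ (leqnn _) (@adapted_demand k)).
congr stopping; apply/funext => w; congr (_ * _ + _)%N.
apply: eq_hit => j j2; rewrite demand_walkE ?natrM -?mulrA ?mesh_pow2//.
apply: leq_trans (leq_addr _ _).
by rewrite -[4%N]/(2 * 2)%N expnMn leq_mul2r (ltnW j2) orbT.
Qed.

(** The maxima run up to the coarse index, which is later than the hit on grid k, in order to be
    monotone in k. *)
Definition max_energy k w : R := \sum_(i < n) maxsq (noise k) (delayed_coarse k) i w.

Lemma centered_sqr_le k i j w : (j <= delayed_coarse k w)%N ->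
  centered i (j%:R * mesh k) w ^+ 2 <= max_energy k w.
Proof.
move=> jk; have dk := delayed_coarse_horizon k w.
rewrite -walk_centered; last exact: leq_trans dk.
rewrite /max_energy (bigD1 i)//= (le_trans (maxsq_ge _ i dk jk))// lerDl.
by apply: sumr_ge0 => j' _; rewrite addr_ge0// sqr_ge0.
Qed.

(** Point l of grid k is point 2 l of grid k + 1, and the time up to which the maximum is taken can
    only increase. *)
Lemma max_energy_nondecreasing w : nondecreasing_seq (max_energy ^~ w).
Proof.
apply/nondecreasing_seqP => k; apply: ler_sum => i _.
have le_max e : stopped_max (noise k) e (delayed_coarse k) i w <=
    stopped_max (noise k.+1) e (delayed_coarse k.+1) i w.
  have [l ld ->] := stopped_max_attained (noise k) e (delayed_coarse k) i w.
  have ld' : (2 * l <= delayed_coarse k.+1 w)%N.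
    rewrite (leq_trans (leq_mul (leqnn 2) ld))// /delayed_coarse mulnDr.
    apply: leq_add; last by rewrite expnS mulnCA.
    rewrite mulnCA -expnS leq_mul2r; apply/orP; right.
    by apply: hit_mono; rewrite leq_exp2l.
  rewrite walk_centered ?(leq_trans ld)// ?delayed_coarse_horizon//.
  rewrite meshS mulrA -natrM mulnC -walk_centered; last first.
    exact: leq_trans ld' (delayed_coarse_horizon _ _).
  by apply: stopped_max_ge => //; exact: delayed_coarse_horizon.
by rewrite lerD// lerXn2r// nnegrE stopped_max_ge0.
Qed.

Lemma max_energy_ge0 k w : 0 <= max_energy k w.
Proof. by apply: sumr_ge0 => i _; rewrite addr_ge0// sqr_ge0. Qed.

Lemma L1_max_energy k : L1 P (max_energy k).
Proof.
apply: L1_sum => i.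
exact: (L1_maxsq (white_noise_mesh k) i (stopping_delayed_coarse k)).
Qed.

Lemma L1_delayed_coarse k : L1 P (fun w => (delayed_coarse k w)%:R).
Proof.
exact/L2_L1/(L2_stopping (white_noise_mesh k))/stopping_delayed_coarse.
Qed.

Lemma mean_max_energy k : mean P (max_energy k) <=
  8 * n%:R * (mesh k * mean P (fun w => (delayed_coarse k w)%:R)).
Proof.
rewrite mean_sum => [|i]; last first.
  exact: (L1_maxsq (white_noise_mesh k) i (stopping_delayed_coarse k)).
apply: (@le_trans _ _ (\sum_(i < n) 8 * mesh k * mean P (fun w => (delayed_coarse k w)%:R))).
  apply: ler_sum => i _.
  exact: (mean_maxsq (white_noise_mesh k) i (stopping_delayed_coarse k)).
rewrite sumr_const card_ord -mulr_natr le_eqVlt; apply/orP; left; apply/eqP; ring.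
Qed.

(** One coarse step before the index the demand is still below Q, so the drift up to then is at most
    Q plus the size of the noise, itself bounded by the square root of the energy. The term Dtot *
    h0 pays for the last step. *)
Lemma coarse_time_le k w (G : R) : max_energy k w <= G ->
  Dtot * ((coarse_index k w)%:R * h0) <=
  Q + Dtot * h0 + (\sum_(i < n) sigma i) * Num.sqrt G.
Proof.
move=> HG; have G0 := le_trans (max_energy_ge0 k w) HG.
have s0 : 0 <= (\sum_(i < n) sigma i) * Num.sqrt G.
  by rewrite mulr_ge0 ?sqrtr_ge0// sumr_ge0.
have D0 : 0 < Dtot := Dtot_gt0.
case E : (coarse_index k w) => [|j].
  by rewrite mul0r mulr0 !addr_ge0// mulr_ge0// ltW.
have jc : (j < coarse_index k w)%N by rewrite E.
have := before_hit jc; rewrite /total_demand big_split/= -mulr_suml -/Dtot.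
set S := \sum_(i < n) _ => DS.
suff Sle : - S <= (\sum_(i < n) sigma i) * Num.sqrt G.
  by rewrite -natr1 mulrDl mul1r mulrDr; lra.
rewrite /S -sumrN mulr_suml; apply: ler_sum => i _; rewrite -mulrN ler_wpM2l//.
rewrite (le_trans (ler_norm _))// normrN -sqrtr_sqr ler_sqrt//.
apply: le_trans HG.
rewrite -(mesh_pow2 k) mulrA -natrM; apply: centered_sqr_le.
by rewrite /delayed_coarse (leq_trans _ (leq_addr _ _))// leq_mul2r (ltnW jc) orbT.
Qed.

Let sqrt_le (b G : R) : 0 < b -> 0 <= G -> Num.sqrt G <= b * G + (4 * b)^-1.
Proof.
move=> b0 G0; rewrite -{2}(sqr_sqrtr G0); set x := Num.sqrt G.
have -> : b * x ^+ 2 + (4 * b)^-1 = x + (2 * b * x - 1) ^+ 2 / (4 * b).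
  by field; rewrite gt_eqF.
by rewrite lerDl divr_ge0 ?sqr_ge0// mulr_ge0// ltW.
Qed.

(** Doob bounds the mean energy by the mean coarse time, and [coarse_time_le] bounds that time by a
    square root of the energy. Since sqrt G <= b G + 1 / (4 b) for every b > 0, a small b lets the
    energy be absorbed. *)
Lemma mean_max_energy_bounded : exists C, forall k, mean P (max_energy k) <= C.
Proof.
have D0 : 0 < Dtot := Dtot_gt0.
pose s := \sum_(i < n) sigma i; have s0 : 0 <= s by rewrite sumr_ge0.
(* With b = Dtot / (16 a) the factor s * b * (8 n) is at most Dtot / 2, so half of Dtot * e survives
   on the left. The summand 1 keeps a positive even if n s = 0. *)
pose a := n%:R * s + 1 : R.
have a0 : 0 < a by rewrite ltr_wpDl// mulr_ge0.
pose b := Dtot / (16 * a); have b0 : 0 < b by rewrite divr_gt0// mulr_gt0.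
pose c := Q + Dtot * h0 + s * (4 * b)^-1.
pose t := m0%:R * h0 : R.
have t0 : 0 <= t by rewrite mulr_ge0// ltW.
pose C := 2 * c / Dtot + t.
exists (8 * n%:R * (C + t)) => k.
pose e := h0 * mean P (fun w => (coarse_index k w)%:R).
have iH := L1_max_energy k.
have snc : stopping (noise k) (delayed_coarse k) := stopping_delayed_coarse k.
have E w : mesh k * (delayed_coarse k w)%:R = h0 * (coarse_index k w)%:R + t.
  by rewrite /delayed_coarse natrD !natrM mulrDr /t -(mesh_pow2 k); ring.
have ic : L1 P (fun w => (coarse_index k w)%:R).
  have := L1Z (h0^-1) (L1B (L1Z (mesh k) (L1_delayed_coarse k)) (L1_cst P t)).
  by apply: eq_L1 => w; rewrite E; field; rewrite gt_eqF.
have Ee : mesh k * mean P (fun w => (delayed_coarse k w)%:R) = e + t.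
  rewrite -meanZ; last exact: L1_delayed_coarse.
  by under eq_mean do rewrite E; rewrite meanD ?mean_cst ?meanZ//; [exact: L1Z|exact: L1_cst].
have mH := mean_max_energy k; rewrite Ee in mH.
apply: (le_trans mH); rewrite ler_wpM2l ?mulr_ge0// lerD2r /C.
have De : Dtot * e <= c + s * b * mean P (max_energy k).
  rewrite /e -!meanZ//; last exact: L1Z.
  rewrite -[c](mean_cst P) -meanD; [|exact: L1_cst|exact: L1Z].
  apply: mean_le => [||w]; first by do 2 apply: L1Z.
    by apply: L1D; [exact: L1_cst|exact: L1Z].
  have := coarse_time_le (lexx (max_energy k w)).
  have := sqrt_le b0 (max_energy_ge0 k w); rewrite -/s => /(ler_wpM2l s0).
  rewrite mulrDr mulrA /c [h0 * _]mulrC; lra.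
have sb : s * b * (8 * n%:R) <= Dtot / 2.
  have -> : s * b * (8 * n%:R) = Dtot / 2 * ((n%:R * s) / a).
    by rewrite /b; field; rewrite gt_eqF.
  by rewrite ler_piMr ?divr_ge0 ?(ltW D0)// ler_pdivrMr// mul1r lerDl.
have et : 0 <= e + t.
  by rewrite addr_ge0// mulr_ge0 ?(ltW h0_gt0)// mean_ge0.
have De2 : Dtot * e <= c + Dtot / 2 * (e + t).
  apply: (le_trans De); rewrite lerD2l.
  apply: (@le_trans _ _ (s * b * (8 * n%:R * (e + t)))).
    by rewrite ler_wpM2l// mulr_ge0// ltW.
  by rewrite mulrA ler_wpM2r.
rewrite -lerBlDr ler_pdivlMr//; lra.
Qed.

Lemma max_energy_dominated :
  exists2 g, L1 P g & {ae P, forall w k, max_energy k w <= g w}.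
Proof.
have [C HC] := mean_max_energy_bounded.
apply: (monotone_domination (C := C)) => //.
- exact: L1_max_energy.
- exact: max_energy_ge0.
- exact: max_energy_nondecreasing.
Qed.

End grid_hitting.

Arguments noise {_ _ _ _ _} _ _ _ _ _ _.

(** * Riemann sums *)

Lemma cvg_within_seq {R : realType} (f : R -> R) (A : set R) (a : nat -> R) (S : R) :
  {within A, continuous f} -> A S -> (forall k, A (a k)) -> a @ \oo --> S ->
  f \o a @ \oo --> f S.
Proof.
move=> /subspace_continuousP cf AS Aa aS.
apply: cvg_comp (cf _ AS) => P /aS aP.
have : \forall k \near \oo, A (a k) -> P (a k) := aP.
by apply: filterS => k; apply; exact: Aa.
Qed.

(** Paths are controlled at nonnegative times only. Freezing them at their value at 0 gives the
    globally continuous integrand wanted for the Riemann sums. *)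
Lemma continuous_extension0 {R : realType} (f : R -> R) :
  {within `[0, +oo[, continuous f} -> continuous (fun u : R => f (Num.max u 0)).
Proof.
move=> /subspace_continuousP cf u.
have mA (x : R) : `[0, +oo[%classic (Num.max x 0).
  by rewrite /= in_itv/= le_max lexx orbT.
have cm : (fun x : R => Num.max x 0) @ u --> Num.max u 0.
  exact: (@continuous_max R R id (cst 0) u cvg_id (cvg_cst 0)).
apply: (@cvg_comp _ _ _ (fun x : R => Num.max x 0) f _ _ _ _ (cf _ (mA u))) => S /cm mS.
have : \forall x \near u, `[0, +oo[%classic (Num.max x 0) -> S (Num.max x 0) := mS.
by apply: filterS => x; apply; exact: mA.
Qed.

Section riemann_sums.
Context {R : realType}.
Let mu := @lebesgue_measure R.
Variable v : R -> R.
Hypothesis cv : continuous v.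

Lemma segment_uniformly_continuous (M e : R) : 0 < e ->
  \forall r \near 0^'+, forall x, 0 <= x <= M ->
    forall y, `|x - y| < r -> `|v x - v y| < e.
Proof.
move=> e0.
have cover : \forall r \near 0^'+,
    `[0, M]%classic `<=` (fun x => forall y, `|x - y| < r -> `|v x - v y| < e).
  apply: (compact_near_coveringP `[0, M]).1; first exact: segment_compact.
  move=> x _.
  have e2 : 0 < e / 2 by rewrite divr_gt0.
  have /cvgrPdist_lt/(_ _ e2) := cv (x := x).
  move=> /nbhs_ballP[q /= q0 vq].
  near=> x' r => y x'y.
  have xx' : `|x - x'| < q / 2.
    near: x'; apply: (nbhsx_ballx x (q / 2)); rewrite divr_gt0//.
  have rq : r < q / 2.
    by near: r; apply: nbhs_right_lt; rewrite divr_gt0.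
  have h1 : `|v x - v x'| < e / 2.
    apply: vq; rewrite /ball/= (lt_trans xx')// ltr_pdivrMr// ltr_pMr// ltr1n//.
  have h2 : `|v x - v y| < e / 2.
    apply: vq; rewrite /ball/= (_ : x - y = (x - x') + (x' - y)); last by ring.
    by rewrite (le_lt_trans (ler_normD _ _))// (splitr q) ltrD// (lt_trans x'y).
  rewrite (_ : v x' - v y = (v x - v y) - (v x - v x')); last by ring.
  by rewrite (le_lt_trans (ler_normB _ _))// (splitr e) ltrD.
apply: filterS cover => r rK x xM; exact: rK.
Unshelve. all: by end_near. Qed.

Let V (t : R) : R := \int[mu]_(u in `[0, t]) v u.

Let iv a b : mu.-integrable `[a, b] (EFin \o v).
Proof.
apply: continuous_compact_integrable; first exact: segment_compact.
exact: continuous_subspaceT.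
Qed.

Let cV (M : R) : 0 <= M -> {within `[0, M], continuous V}.
Proof. by move=> M0; exact: parameterized_integral_continuous. Qed.

Let dV (t : R) : 0 < t -> is_derive t 1 V (v t).
Proof.
move=> t0; have tt : t < t + 1 by rewrite ltrDl.
have [dVt <-] := @continuous_FTC1_closed _ v 0 t (t + 1) tt (iv 0 (t + 1)) t0 (cv (x := t)).
by rewrite derive1E; split.
Qed.

Let cell (a b : R) : 0 <= a -> a < b -> exists2 c, a <= c <= b & V b - V a = v c * (b - a).
Proof.
move=> a0 ab.
have [||c] := @MVT R V v a b ab.
- by move=> x; rewrite in_itv/= => /andP[ax _]; apply: dV; exact: le_lt_trans ax.
- apply: (continuous_subspaceW _ (cV (le_trans a0 (ltW ab)))).
  by move=> x /=; rewrite !in_itv/= => /andP[ax ->]; rewrite (le_trans a0 ax).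
by rewrite in_itv/= => /andP[ac cb] E; exists c => //; rewrite !ltW.
Qed.

Let V0 : V 0 = 0.
Proof. by rewrite /V set_itv1 Rintegral_set1. Qed.

(** On each cell the mean value theorem turns the integral into h * v c for some c in the cell, so a
    cell contributes an error of at most h * e. *)
Let riemann_error (M e r h : R) (N : nat) : (forall x, 0 <= x <= M ->
    forall y, `|x - y| < r -> `|v x - v y| < e) ->
  0 < h < r -> N%:R * h <= M ->
  `|\sum_(l < N) h * v (l%:R * h) - V (N%:R * h)| <= N%:R * h * e.
Proof.
move=> uc /andP[h0 hr]; elim: N => [|N IHN] NM.
  by rewrite big_ord0 !mul0r V0 subrr normr0.
have NN : N%:R * h < N.+1%:R * h by rewrite ltr_pM2r// ltr_nat.
have Nh0 : 0 <= N%:R * h by rewrite mulr_ge0// ltW.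
have {}IHN := IHN (le_trans (ltW NN) NM).
have [c /andP[Nc cN] E] := cell Nh0 NN.
have dh : N.+1%:R * h - N%:R * h = h by rewrite -mulrBl -natrB// subSnn mul1r.
rewrite dh in E.
have cN' : `|v (N%:R * h) - v c| <= e.
  apply/ltW/uc; first by rewrite Nh0 (le_trans (ltW NN)).
  by rewrite distrC ger0_norm ?subr_ge0// (le_lt_trans _ hr)// -[leRHS]dh lerD2r.
rewrite big_ord_recr/= (_ : V (N.+1%:R * h) = V (N%:R * h) + v c * h); last first.
  by rewrite -E; ring.
rewrite (_ : _ - _ = (\sum_(l < N) h * v (l%:R * h) - V (N%:R * h)) +
  h * (v (N%:R * h) - v c)); last by ring.
rewrite (le_trans (ler_normD _ _))// -natr1 mulrDl mul1r mulrDl lerD//.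
by rewrite normrM gtr0_norm// ler_pM2l.
Qed.

Lemma cvg_riemann_sum (h : nat -> R) (N : nat -> nat) (S M : R) :
  (forall k, 0 < h k) -> h @ \oo --> 0 ->
  (forall k, (N k)%:R * h k <= M) -> (fun k => (N k)%:R * h k) @ \oo --> S ->
  (fun k => \sum_(l < N k) h k * v (l%:R * h k)) @ \oo --> \int[mu]_(u in `[0, S]) v u.
Proof.
move=> h_gt0 h0 NM NS.
have Nh0 k : 0 <= (N k)%:R * h k by rewrite mulr_ge0// ltW.
have M0 : 0 <= M := le_trans (Nh0 0%N) (NM 0%N).
have S0 : 0 <= S.
  by rewrite -(cvg_lim (@Rhausdorff R) NS); apply: limr_ge; [apply/cvg_ex; exists S|exact: nearW].
have SM : S <= M.
  by rewrite -(cvg_lim (@Rhausdorff R) NS); apply: limr_le; [apply/cvg_ex; exists S|exact: nearW].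
have VS : (fun k => V ((N k)%:R * h k)) @ \oo --> V S.
  apply: (cvg_within_seq (cV M0)) NS => [|k]; rewrite /= in_itv/= ?S0//.
  by rewrite Nh0 NM.
apply/cvgrPdist_lt => e e0.
(* The accumulated error is at most M times this modulus, hence below e / 2; dividing by M + 1 also
   covers M = 0. *)
have e1 : 0 < e / 2 / (M + 1) by rewrite divr_gt0 ?divr_gt0// ltr_wpDl.
have [r /= r0 ur] := segment_uniformly_continuous M e1.
have ucr : forall x, 0 <= x <= M -> forall y, `|x - y| < r / 2 -> `|v x - v y| < e / 2 / (M + 1).
  apply: ur; last by rewrite /= divr_gt0.
  by rewrite /= sub0r normrN ger0_norm ?divr_ge0 ?ltW// ltr_pdivrMr// ltr_pMr// ltr1n.
near=> k.
have hk : 0 < h k < r / 2.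
  rewrite h_gt0/=; near: k.
  have r2 : 0 < r / 2 by rewrite divr_gt0.
  have /cvgrPdist_lt/(_ _ r2) := h0.
  by apply: filterS => k; rewrite sub0r normrN gtr0_norm.
have err := riemann_error ucr hk (NM k).
have Vk : `|V S - V ((N k)%:R * h k)| < e / 2.
  by near: k; have /cvgrPdist_lt := VS; apply; rewrite divr_gt0.
rewrite -/(V S).
have -> : V S - \sum_(l < N k) h k * v (l%:R * h k) = (V S - V ((N k)%:R * h k)) -
    (\sum_(l < N k) h k * v (l%:R * h k) - V ((N k)%:R * h k)) by ring.
rewrite (le_lt_trans (ler_normB _ _))// [ltRHS](splitr e) ltr_leD//.
apply: (le_trans err); rewrite mulrA ler_pdivrMr ?ltr_wpDl// mulrC ler_wpM2l//.
  by rewrite divr_ge0// ltW.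
by rewrite (le_trans (NM k))// lerDl.
Unshelve. all: by end_near. Qed.

End riemann_sums.

(** * Passage times as limits along the grids *)

Section passage_time.
Context {R : realType}.
Variables (x : R -> R) (Q h0 : R) (K j0 : nat).
Hypotheses (Q_ge0 : 0 <= Q) (h0_gt0 : 0 < h0) (x0 : x 0 = 0).
Hypothesis cx : {within `[0, +oo[, continuous x}.
Hypotheses (j0K : (j0 < 2 ^ K)%N) (Qj0 : Q <= x (j0%:R * h0)).

Lemma mesh_cvg0 : mesh h0 @ \oo --> 0.
Proof.
have : geometric h0 2^-1 @ \oo --> (0 : R).
  by apply: cvg_geometric; rewrite ger0_norm ?invr_ge0// invf_lt1// ltr1n.
by apply: cvg_trans; apply: near_eq_cvg; apply: nearW => k; rewrite /geometric/= /mesh exprVn.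
Qed.

Let N k := hit (4 ^ k) (fun j => x (j%:R * mesh h0 k)) Q.

Let t k := (N k)%:R * mesh h0 k.

Let t_ge0 k : 0 <= t k.
Proof. by rewrite mulr_ge0// ltW// mesh_gt0. Qed.

Let N_lt k : (K <= k)%N -> (N k < 4 ^ k)%N.
Proof.
move=> Kk; have jk : (j0 < 2 ^ k)%N by rewrite (leq_trans j0K)// leq_exp2l.
have jk4 : (j0 * 2 ^ k < 4 ^ k)%N.
  by rewrite -[4%N]/(2 * 2)%N expnMn ltn_pmul2r// expn_gt0.
apply: (leq_ltn_trans _ jk4); apply: hit_min => //.
by rewrite natrM -mulrA mesh_pow2.
Qed.

Let Qt k : (K <= k)%N -> Q <= x (t k).
Proof. by move=> /N_lt; exact: at_hit. Qed.

Let t_noninc k : (K <= k)%N -> t k.+1 <= t k.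
Proof.
move=> Kk; rewrite /t (meshS h0 k) mulrA ler_pM2r ?mesh_gt0// -natrM ler_nat mulnC.
apply: hit_min.
  rewrite expnS (@leq_ltn_trans (4 * N k)%N)//; first by rewrite leq_mul2r orbT.
  by rewrite ltn_pmul2l// N_lt.
by rewrite /= mulnC natrM -mulrA -meshS; exact: Qt.
Qed.

(** From K on the level is really hit before the cutoff, and a hit persists on finer grids, so the
    times t k decrease to a limit. The level is reached at t k but not one grid step earlier, and
    continuity forces x theta = Q. *)
Lemma passage_time_exists : exists theta : R,
  [/\ 0 <= theta, t @ \oo --> theta, x theta = Q &
    forall s : R, 0 <= s -> Q < x s -> theta <= s].
Proof.
have [theta tt] : exists theta : R, t @ \oo --> theta.
  have ndt : nonincreasing_seq (fun k => t (k + K)).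
    by apply/nonincreasing_seqP => k; rewrite addSn t_noninc// leq_addl.
  exists (inf (range (fun k => t (k + K)))); rewrite -(cvg_shiftn K).
  by apply: nonincreasing_cvgn => //; exists 0 => _ [k _ <-]; exact: t_ge0.
have th0 : 0 <= theta.
  by rewrite -(cvg_lim (@Rhausdorff R) tt); apply: limr_ge; [apply/cvg_ex; exists theta|exact: nearW].
have inA (s : R) : 0 <= s -> `[0, +oo[%classic s by move=> s0; rewrite /= in_itv/= s0.
have xlim (a : nat -> R) (s : R) : 0 <= s -> (forall k, 0 <= a k) -> a @ \oo --> s ->
    x \o a @ \oo --> x s.
  by move=> s0 a0 as_; apply: (cvg_within_seq cx) as_ => [|k]; exact: inA.
exists theta; split => //.
- apply/eqP; rewrite eq_le; apply/andP; split; last first.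
    have xt := xlim t theta th0 t_ge0 tt.
    rewrite -(cvg_lim (@Rhausdorff R) xt); apply: limr_ge; first by apply/cvg_ex; exists (x theta).
    near=> k; rewrite /=; apply: Qt; near: k; exact: nbhs_infty_ge.
  (* The grid point preceding the hit. If the hit is at index 0, the predecessor is again 0 and x 0
     = 0 <= Q. *)
  pose u k := (N k).-1%:R * mesh h0 k.
  have u0 k : 0 <= u k by rewrite mulr_ge0// ltW// mesh_gt0.
  have ut : u @ \oo --> theta.
    apply: (@squeeze_cvgr _ _ _ _ (fun k => t k - mesh h0 k) t).
    - apply: nearW => k; rewrite /u /t -{2}[mesh h0 k]mul1r -mulrBl.
      rewrite !ler_pM2r ?mesh_gt0// lerBlDr natr1 !ler_nat.
      by case: (N k) => //= m; rewrite leqnn leqnSn.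
    - by rewrite -[theta]subr0; apply: cvgB => //; exact: mesh_cvg0.
    - exact: tt.
  have xu := xlim u theta th0 u0 ut.
  rewrite -(cvg_lim (@Rhausdorff R) xu); apply: limr_le; first by apply/cvg_ex; exists (x theta).
  apply: nearW => k; rewrite /= /u; case E : (N k) => [|m] /=.
    by rewrite mul0r x0.
  by apply/ltW/(@before_hit _ (4 ^ k) (fun j => x (j%:R * mesh h0 k))); rewrite -/(N k) E.
- move=> s s0 Qs.
  (* The first grid point beyond s. As Q < x s is strict, continuity keeps the demand above Q there
     for large k, so the hit is not later. *)
  pose p k := (Num.truncn (s / mesh h0 k)).+1.
  have sm k : 0 <= s / mesh h0 k by rewrite divr_ge0// ltW// mesh_gt0.
  have ps k : s <= (p k)%:R * mesh h0 k <= s + mesh h0 k.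
    have := truncn_itv (sm k); rewrite ler_pdivlMr ?mesh_gt0// ltr_pdivrMr ?mesh_gt0//.
    by move=> /andP[p1 p2]; rewrite (ltW p2)/= -natr1 mulrDl mul1r lerD2r.
  have p0 k : 0 <= (p k)%:R * mesh h0 k by case/andP: (ps k) => /(le_trans s0).
  have cp : (fun k => (p k)%:R * mesh h0 k) @ \oo --> s.
    apply: (@squeeze_cvgr _ _ _ _ (cst s) (fun k => s + mesh h0 k)).
    - by apply: nearW => k; exact: ps.
    - exact: cvg_cst.
    - by rewrite -[X in _ --> X]addr0; apply: cvgD; [exact: cvg_cst|exact: mesh_cvg0].
  have /cvgrPdist_lt/(_ (x s - Q)) := xlim _ s s0 p0 cp.
  rewrite subr_gt0 => /(_ Qs) xp.
  rewrite -(cvg_lim (@Rhausdorff R) tt) -(cvg_lim (@Rhausdorff R) cp).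
  apply: ler_lim; [by apply/cvg_ex; exists theta|by apply/cvg_ex; exists s|].
  apply: filterS xp => k /=; rewrite ltr_norml => /andP[_ xp].
  rewrite /t ler_pM2r ?mesh_gt0// ler_nat.
  case: (ltnP (p k) (4 ^ k)) => pk; last exact: leq_trans (hit_le _ _ _) pk.
  by apply: hit_min => //; apply: ltW; lra.
Unshelve. all: by end_near. Qed.

End passage_time.

Lemma cvg_sumr {R : realType} {T : Type} {F : set_system T} {FF : Filter F}
    (I : Type) (r : seq I) (f : I -> T -> R) (l : I -> R) :
  (forall i, f i @ F --> l i) ->
  (fun u => \sum_(i <- r) f i u) @ F --> \sum_(i <- r) l i.
Proof.
move=> fl; elim: r => [|i r IHr].
  rewrite big_nil (_ : (fun u => _) = cst 0); first exact: cvg_cst.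
  by apply/funext => u; rewrite big_nil.
rewrite big_cons (_ : (fun u => _) = f i + (fun u => \sum_(j <- r) f j u)).
  exact: cvgD.
by apply/funext => u; rewrite big_cons.
Qed.

Section grid_limits.
Context {d : measure_display} {Omega : measurableType d} {R : realType}.
Variables (P : probability Omega R) (n : nat) (B : 'I_n -> R -> {RV P >-> R}).
Hypothesis B_brownian : forall i, standard_brownian_motion (B i).
Hypothesis B_indep : independent_processes P (fun i t w => B i t w).
Variables D sigma : 'I_n -> R.
Hypotheses (Dtot_gt0 : 0 < \sum_(i < n) D i) (sigma_ge0 : forall i, 0 <= sigma i).
Variables (Q h0 : R) (m0 : nat).
Hypotheses (Q_ge0 : 0 <= Q) (h0_gt0 : 0 < h0).

Let Dtot := \sum_(i < n) D i.
Let delay : R := m0%:R * h0.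

Local Notation W := (centered B).
Local Notation X := (total_demand B D sigma).
Local Notation N k w := (hit_index B D sigma Q h0 k w).
Local Notation N' k w := (delayed_hit B D sigma Q h0 m0 k w).

Definition grid_passage k w : R := (N k w)%:R * mesh h0 k.

(** The limit has its intended meaning only where it exists, which [ae_passage] shows for almost
    every path. *)
Definition first_passage w : R := limn (grid_passage ^~ w).

Local Notation t := grid_passage.
Let s k w : R := grid_passage k w + delay.

Lemma ae_centered_continuous :
  {ae P, forall w i, {within `[0, +oo[, continuous (fun u => W i u w)}}.
Proof.
have H (i : 'I_n) : {ae P, forall w, {within `[0, +oo[, continuous (fun u => W i u w)}}.
  apply: filterS (brownian_continuous (B_brownian i)) => w cB u.
  by apply: cvgB; [exact: cB|exact: cvg_cst].
exact: filter_forall H.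
Qed.

(** The dominating energy g is integrable, so its square root is square-integrable and one Y bounds
    the times and the motions together. The clause 1 <= Y lets Y ^+ 2 dominate linear terms and
    constants as well. *)
Lemma envelope : exists Y : Omega -> R, L2 P Y /\ {ae P, forall w,
  [/\ 1 <= Y w, forall k, (coarse_index B D sigma Q h0 k w)%:R * h0 <= Y w,
      forall k, 0 <= s k w <= Y w &
      forall k i l, (l <= N' k w)%N -> `|W i (l%:R * mesh h0 k) w| <= Y w]}.
Proof.
have [g ig Hg] := max_energy_dominated B_brownian B_indep Dtot_gt0 sigma_ge0 m0 Q_ge0 h0_gt0.
pose ss := \sum_(i < n) sigma i; have ss0 : 0 <= ss by exact: sumr_ge0.
pose K : R := (Q + Dtot * h0 + ss) / Dtot + delay + 1.
have D0 : 0 < Dtot by [].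
have delay0 : 0 <= delay by rewrite mulr_ge0// ltW.
have q0 : 0 <= (Q + Dtot * h0 + ss) / Dtot.
  by rewrite divr_ge0 ?(ltW D0)// !addr_ge0// mulr_ge0// ltW.
have K1 : 1 <= K by rewrite /K lerDr addr_ge0.
pose Y w := K * (1 + Num.sqrt (g w)).
exists Y; split.
  apply: L2Z; apply: L2D; first exact: L2_cst.
  have mg := L1_measurable ig.
  have ms : measurable_fun setT (fun w => Num.sqrt (g w)).
    exact: (measurableT_comp (continuous_measurable_fun (@sqrt_continuous R)) mg).
  split=> //; apply: (L1_le _ (L1_norm ig)); first exact: measurable_funX.
  move=> w; rewrite ger0_norm ?sqr_ge0//; case: (leP 0 (g w)) => g0.
    by rewrite sqr_sqrtr// ler_norm.
  rewrite ler0_sqrtr ?(ltW g0)// expr2 mul0r; exact: normr_ge0.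
apply: filterS Hg => w Hgw.
have r0 : 0 <= Num.sqrt (g w) := sqrtr_ge0 _.
have r1 : 1 <= 1 + Num.sqrt (g w) by rewrite lerDl.
have Y1 : 1 <= Y w by apply: (le_trans K1); rewrite /Y ler_peMr// (le_trans ler01).
have cY k : (coarse_index B D sigma Q h0 k w)%:R * h0 + delay <= Y w.
  have := coarse_time_le Dtot_gt0 sigma_ge0 Q_ge0 h0_gt0 (Hgw k).
  rewrite -/Dtot -/ss mulrC -ler_pdivlMr// => /le_trans c1.
  apply: (@le_trans _ _ ((Q + Dtot * h0 + ss * Num.sqrt (g w)) / Dtot + delay)).
    by rewrite lerD2r; exact: c1.
  have -> : Y w = (Q + Dtot * h0 + ss) * (1 + Num.sqrt (g w)) / Dtot +
      (delay + 1) * (1 + Num.sqrt (g w)).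
    by rewrite /Y /K; field; rewrite gt_eqF.
  have Dh : 0 <= Dtot * h0 by rewrite mulr_ge0// ltW.
  have := mulr_ge0 Q_ge0 r0; have := mulr_ge0 Dh r0; have := mulr_ge0 delay0 r0 => dr Dr Qr.
  apply: lerD; last by rewrite mulrDl mulrDr; lra.
  rewrite ler_pM2r ?invr_gt0// mulrDr mulr1 2!mulrDl; lra.
have rY : Num.sqrt (g w) <= Y w.
  by rewrite (@le_trans _ _ (1 + Num.sqrt (g w)))// ?lerDr// /Y ler_peMl// (le_trans _ r1).
split => //.
- by move=> k; apply: le_trans (cY k); rewrite lerDl.
- move=> k; have tk : 0 <= t k w by rewrite mulr_ge0// ltW// mesh_gt0.
  rewrite /s addr_ge0//=.
  apply: le_trans (cY k); rewrite lerD2r /grid_passage.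
  have -> : (coarse_index B D sigma Q h0 k w)%:R * h0 =
      (coarse_index B D sigma Q h0 k w * 2 ^ k)%:R * mesh h0 k.
    by rewrite natrM -mulrA mesh_pow2.
  by rewrite ler_pM2r ?mesh_gt0// ler_nat; exact: hit_index_coarse.
- move=> k i l lN.
  rewrite -sqrtr_sqr.
  apply: le_trans rY; rewrite ler_sqrt; last first.
    by apply: le_trans (Hgw k); exact: max_energy_ge0.
  apply: le_trans (Hgw k); apply: centered_sqr_le => //.
  by apply: leq_trans lN _; exact: delayed_hit_coarse.
Qed.

Lemma total_demand0 w : X 0 w = 0.
Proof. by apply: big1 => i _; rewrite mulr0 /centered subrr mulr0 addr0. Qed.

Lemma total_demand_continuous w : (forall i, {within `[0, +oo[, continuous (fun u => W i u w)}) ->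
  {within `[0, +oo[, continuous (fun u => X u w)}.
Proof.
have cid : {within `[0, +oo[, continuous (fun u : R => u)}.
  by apply: continuous_subspaceT => u; exact: cvg_id.
move=> cW u; apply: cvg_sumr => i.
apply: cvgD; first by apply: cvgM; [exact: cvg_cst|exact: cid].
by apply: cvgM; [exact: cvg_cst|exact: cW].
Qed.

Lemma ae_passage : {ae P, forall w, [/\ 0 <= first_passage w,
  grid_passage ^~ w @ \oo --> first_passage w, X (first_passage w) w = Q &
  forall u : R, 0 <= u -> Q < X u w -> first_passage w <= u]}.
Proof.
have [Y [_ HY]] := envelope.
apply: filterS2 ae_centered_continuous HY => w cW [_ cY _ _].
(* The cutoff time 2^K h0 exceeds the envelope, so the coarse index lies strictly below its cutoff
   and is a genuine hit. *)
pose K := (Num.truncn (Y w / h0)).+1.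
have YK : Y w < (2 ^ K)%:R * h0.
  rewrite -ltr_pdivrMr//; apply: (lt_trans (truncnS_gt _)).
  by rewrite ltr_nat ltn_expl.
have cK : (coarse_index B D sigma Q h0 K w < 2 ^ K)%N.
  by rewrite -(ltr_nat R) -(ltr_pM2r h0_gt0) (le_lt_trans (cY K)).
have QX := at_hit cK.
have cX := total_demand_continuous cW.
have [theta [th0 tth Xth thle]] :=
  passage_time_exists Q_ge0 h0_gt0 (total_demand0 w) cX cK QX.
have tE : first_passage w = theta by exact: (cvg_lim (@Rhausdorff R) tth).
by rewrite tE.
Qed.

End grid_limits.

(** * Exact moments on the grids *)

Section grid_means.
Context {d : measure_display} {Omega : measurableType d} {R : realType}.
Variables (P : probability Omega R) (n : nat) (B : 'I_n -> R -> {RV P >-> R}).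
Hypothesis B_brownian : forall i, standard_brownian_motion (B i).
Hypothesis B_indep : independent_processes P (fun i t w => B i t w).
Variables D sigma : 'I_n -> R.
Variables (Q h0 : R) (m0 : nat).
Hypothesis h0_gt0 : 0 < h0.

Let Dtot := \sum_(i < n) D i.
Let sigma2 := \sum_(i < n) sigma i ^+ 2.
Let delay : R := m0%:R * h0.

Local Notation noise := (noise B h0 m0).
Local Notation W := (centered B).
Local Notation X := (total_demand B D sigma).
Local Notation N k w := (hit_index B D sigma Q h0 k w).
Local Notation N' k w := (delayed_hit B D sigma Q h0 m0 k w).
Local Notation t := (grid_passage B D sigma Q h0).

Definition delayed_passage k w : R := (N' k w)%:R * mesh h0 k.

Local Notation s := delayed_passage.

Lemma delayed_passageE k w : s k w = t k w + delay.
Proof. by rewrite /delayed_passage natrD mulrDl natrM -mulrA mesh_pow2. Qed.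

Let wn k : white_noise P (mesh h0 k) (noise k).
Proof. exact: white_noise_mesh. Qed.

Let stN k : stopping (noise k) (fun w => N k w).
Proof.
have := @stopping_hit_index _ _ _ P _ B D sigma Q h0 m0 k 0%N (leq0n _).
by congr stopping; apply/funext => w; rewrite addn0.
Qed.

Let stN' k : stopping (noise k) (fun w => N' k w).
Proof. exact: stopping_hit_index. Qed.

Let walkt k i w : walk (noise k) (N k w) i w = W i (t k w) w.
Proof. by rewrite walk_centered//; exact: (stN k).1. Qed.

Let walks k i w : walk (noise k) (N' k w) i w = W i (s k w) w.
Proof. by rewrite walk_centered//; exact: (stN' k).1. Qed.

Lemma L2_grid_passage k : L2 P (t k).
Proof.
apply: (eq_L2 _ (L2Z (mesh h0 k) (L2_stopping (wn k) (stN k)))) => w.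
by rewrite mulrC.
Qed.

Lemma L2_delayed_passage k : L2 P (s k).
Proof.
apply: (eq_L2 _ (L2Z (mesh h0 k) (L2_stopping (wn k) (stN' k)))) => w.
by rewrite mulrC.
Qed.

Lemma L2_centered_passage k i : L2 P (fun w => W i (t k w) w).
Proof. exact: (eq_L2 (walkt k i) (L2_stopped (wn k) i (stN k))). Qed.

Lemma L2_centered_delayed k i : L2 P (fun w => W i (s k w) w).
Proof. exact: (eq_L2 (walks k i) (L2_stopped (wn k) i (stN' k))). Qed.

Lemma mean_centered_passage k i : mean P (fun w => W i (t k w) w) = 0.
Proof.
by rewrite -(eq_mean P (walkt k i)) (mean_stopped (wn k) i (stN k)).
Qed.

Lemma mean_centered_delayed k i : mean P (fun w => W i (s k w) w) = 0.
Proof.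
by rewrite -(eq_mean P (walks k i)) (mean_stopped (wn k) i (stN' k)).
Qed.

Let mean_mesh k (f : Omega -> nat) : L2 P (fun w => (f w)%:R) ->
  mesh h0 k * mean P (fun w => (f w)%:R) = mean P (fun w => (f w)%:R * mesh h0 k).
Proof.
by move=> /L2_L1 l; rewrite -meanZ//; apply: eq_mean => w; rewrite mulrC.
Qed.

Lemma mean_centered_passageM k i j :
  mean P (fun w => W i (t k w) w * W j (t k w) w) = (i == j)%:R * mean P (t k).
Proof.
under eq_mean do rewrite -!walkt.
rewrite (mean_stoppedM (wn k) i j (stN k) (stN k)); congr (_ * _).
under eq_mean do rewrite minnn.
exact: mean_mesh (L2_stopping (wn k) (stN k)).
Qed.

Lemma mean_passage_delayedM k i j :
  mean P (fun w => W i (t k w) w * W j (s k w) w) = (i == j)%:R * mean P (t k).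
Proof.
under eq_mean do rewrite -walkt -walks.
rewrite (mean_stoppedM (wn k) i j (stN k) (stN' k)); congr (_ * _).
under eq_mean do rewrite (minn_idPl (leq_addr _ _)).
exact: mean_mesh (L2_stopping (wn k) (stN k)).
Qed.

Let sum_widen k w (f : nat -> R) :
  \sum_(l < horizon m0 k) ((l < N' k w)%N%:R * f l) = \sum_(l < N' k w) f l.
Proof.
rewrite (big_ord_widen _ f ((stN' k).1 w)) [RHS]big_mkcond/=.
by apply: eq_bigr => l _; case: ifP => _; rewrite ?mul1r ?mul0r.
Qed.

Lemma L1_riemann k i :
  L1 P (fun w => \sum_(l < N' k w) mesh h0 k * W i (l%:R * mesh h0 k) w).
Proof.
have iS : L1 P (fun w => \sum_(l < horizon m0 k)
    ((l < N' k w)%N%:R * (mesh h0 k * walk (noise k) l i w))).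
  apply: L1_sum => l; apply: L2_L1.
  apply: L2_bounded_mul; last by apply: L2Z; exact: (L2_walk (wn k)).
  - have mxi j : measurable_fun setT (noise k j) by case: (noise_L2 (wn k) j).
    have [_ /(_ l) al] := stN' k; exact: (adapted_measurable mxi al).
  - by move=> w; case: (_ < _)%N; rewrite ?normr1 ?normr0.
apply: eq_L1 iS => w; rewrite -(sum_widen k w (fun l => mesh h0 k * W i (l%:R * mesh h0 k) w)); apply: eq_bigr => l _.
by rewrite walk_centered// ltnW.
Qed.

Lemma mean_riemann k i :
  mean P (fun w => \sum_(l < N' k w) mesh h0 k * W i (l%:R * mesh h0 k) w) =
  mean P (fun w => s k w * W i (s k w) w).
Proof.
transitivity (mesh h0 k * mean P (fun w => \sum_(l < horizon m0 k)
    ((l < N' k w)%N%:R * walk (noise k) l i w))).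
  rewrite -meanZ.
    apply: eq_mean => w; rewrite -(sum_widen k w (fun l => mesh h0 k * W i (l%:R * mesh h0 k) w)) mulr_sumr; apply: eq_bigr => l _.
    by rewrite walk_centered ?(ltnW (ltn_ord l))//; ring.
  have := L1Z (mesh h0 k)^-1 (L1_riemann k i); apply: eq_L1 => w.
  rewrite -(sum_widen k w (fun l => mesh h0 k * W i (l%:R * mesh h0 k) w)) mulr_sumr; apply: eq_bigr => l _.
  rewrite walk_centered ?(ltnW (ltn_ord l))//; field.
  by rewrite gt_eqF// mesh_gt0.
rewrite -(mean_stopping_stopped (wn k) i (stN' k)) -meanZ.
  by apply: eq_mean => w; rewrite walks /delayed_passage; ring.
exact: L2_mul (L2_stopping (wn k) (stN' k)) (L2_stopped (wn k) i (stN' k)).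
Qed.

Lemma total_demand_split u w : X u w = Dtot * u + \sum_(i < n) sigma i * W i u w.
Proof. by rewrite /total_demand big_split/= -mulr_suml. Qed.

Lemma L2_noise_passage k : L2 P (fun w => \sum_(i < n) sigma i * W i (t k w) w).
Proof. by apply: L2_sum => i; apply: L2Z; exact: L2_centered_passage. Qed.

Lemma L2_demand_passage k : L2 P (fun w => X (t k w) w).
Proof.
have := L2D (L2Z Dtot (L2_grid_passage k)) (L2_noise_passage k).
by apply: eq_L2 => w; rewrite total_demand_split.
Qed.

Lemma mean_demand_passage k : mean P (fun w => X (t k w) w) = Dtot * mean P (t k).
Proof.
under eq_mean do rewrite total_demand_split.
rewrite meanD; last 2 first.
- exact: L2_L1 (L2Z Dtot (L2_grid_passage k)).
- exact: L2_L1 (L2_noise_passage k).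
rewrite meanZ; last exact: L2_L1 (L2_grid_passage k).
rewrite mean_sum => [|i]; last by apply: L1Z; exact: L2_L1 (L2_centered_passage k i).
rewrite big1 ?addr0// => i _; rewrite meanZ; last exact: L2_L1 (L2_centered_passage k i).
by rewrite mean_centered_passage mulr0.
Qed.

(** Once X at passage is replaced by its limit Q, this second Wald identity determines the second
    moment of the passage time. *)
Lemma mean_noise_passage_sqr k :
  mean P (fun w => (X (t k w) w - Dtot * t k w) ^+ 2) = sigma2 * mean P (t k).
Proof.
have lW i j : L1 P (fun w => W i (t k w) w * W j (t k w) w).
  exact: L2_mul (L2_centered_passage k i) (L2_centered_passage k j).
have -> : (fun w => (X (t k w) w - Dtot * t k w) ^+ 2) = (fun w => \sum_(i < n) \sum_(j < n)
    (sigma i * sigma j) * (W i (t k w) w * W j (t k w) w)).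
  apply/funext => w; rewrite total_demand_split addrC addKr expr2 big_distrlr/=.
  by apply: eq_bigr => i _; apply: eq_bigr => j _; ring.
rewrite mean_sum => [|i]; last by apply: L1_sum => j; exact: L1Z.
rewrite /sigma2 mulr_suml; apply: eq_bigr => i _.
rewrite mean_sum => [|j]; last exact: L1Z.
rewrite (bigD1 i)//= big1 ?addr0 => [|j ji]; rewrite meanZ// mean_centered_passageM.
  by rewrite eqxx mul1r expr2.
by rewrite eq_sym (negbTE ji) mul0r mulr0.
Qed.

(** Only the increments up to the undelayed passage correlate, so the delay does not enter the
    right-hand side. In the limit this is the covariance of the passage time with W_j. *)
Lemma mean_noise_passage_delayed k j :
  mean P (fun w => (X (t k w) w - Dtot * t k w) * W j (s k w) w) =
  sigma j * mean P (t k).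
Proof.
have lW i : L1 P (fun w => W i (t k w) w * W j (s k w) w).
  exact: L2_mul (L2_centered_passage k i) (L2_centered_delayed k j).
have -> : (fun w => (X (t k w) w - Dtot * t k w) * W j (s k w) w) =
    (fun w => \sum_(i < n) sigma i * (W i (t k w) w * W j (s k w) w)).
  apply/funext => w; rewrite total_demand_split addrC addKr mulr_suml.
  by apply: eq_bigr => i _; rewrite mulrA.
rewrite mean_sum => [|i]; last exact: L1Z.
rewrite (bigD1 j)//= big1 ?addr0 => [|i ij]; rewrite meanZ// mean_passage_delayedM.
  by rewrite eqxx mul1r.
by rewrite (negbTE ij) mul0r mulr0.
Qed.

End grid_means.

(** * Limits of the moments along the grids *)

Section passage_limits.
Context {d : measure_display} {Omega : measurableType d} {R : realType}.
Variables (P : probability Omega R) (n : nat) (B : 'I_n -> R -> {RV P >-> R}).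
Hypothesis B_brownian : forall i, standard_brownian_motion (B i).
Hypothesis B_indep : independent_processes P (fun i t w => B i t w).
Variables D sigma : 'I_n -> R.
Hypotheses (Dtot_gt0 : 0 < \sum_(i < n) D i) (sigma_ge0 : forall i, 0 <= sigma i).
Hypothesis D_ge0 : forall i, 0 <= D i.
Variables (Q h0 : R) (m0 : nat).
Hypotheses (Q_ge0 : 0 <= Q) (h0_gt0 : 0 < h0).

Let Dtot := \sum_(i < n) D i.
Let ss := \sum_(i < n) sigma i.
Let sigma2 := \sum_(i < n) sigma i ^+ 2.
Let delay : R := m0%:R * h0.

Local Notation W := (centered B).
Local Notation X := (total_demand B D sigma).
Local Notation N' k w := (delayed_hit B D sigma Q h0 m0 k w).
Local Notation t := (grid_passage B D sigma Q h0).
Local Notation s := (delayed_passage B D sigma Q h0 m0).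
Local Notation theta := (first_passage B D sigma Q h0).

Let D0 : 0 < Dtot. Proof. exact: Dtot_gt0. Qed.
Let ss0 : 0 <= ss. Proof. exact: sumr_ge0. Qed.
Let delay0 : 0 <= delay. Proof. by rewrite mulr_ge0// ltW. Qed.

Let good : exists Y : Omega -> R, L2 P Y /\ {ae P, forall w,
  [/\ 1 <= Y w, forall k, 0 <= t k w <= Y w, forall k, 0 <= s k w <= Y w,
      forall k i l, (l <= N' k w)%N -> `|W i (l%:R * mesh h0 k) w| <= Y w &
    [/\ 0 <= theta w, t ^~ w @ \oo --> theta w, X (theta w) w = Q &
      forall i, {within `[0, +oo[, continuous (fun u => W i u w)}]]}.
Proof.
have [Y [lY HY]] := envelope B_brownian B_indep Dtot_gt0 sigma_ge0 m0 Q_ge0 h0_gt0.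
exists Y; split => //.
have Hp := ae_passage B_brownian B_indep Dtot_gt0 sigma_ge0 m0 Q_ge0 h0_gt0.
have Hc := ae_centered_continuous B_brownian.
apply: filterS3 HY Hp Hc => w [Y1 _ sY WY] [th0 tth Xth _] cW.
have t0 k : 0 <= t k w by rewrite mulr_ge0// ltW// mesh_gt0.
split => //.
- by move=> k; rewrite t0/=; have /andP[_] := sY k; apply: le_trans; rewrite lerDl.
- by move=> k; rewrite delayed_passageE; exact: sY.
Qed.

Let inA (u : R) : 0 <= u -> `[0, +oo[%classic u.
Proof. by move=> u0; rewrite /= in_itv/= u0. Qed.

Let X_bound Y w (u : R) : 0 <= u <= Y -> (forall i, `|W i u w| <= Y) ->
  `|X u w| <= (Dtot + ss) * Y.
Proof.
move=> /andP[u0 uY] WY; rewrite total_demand_split (le_trans (ler_normD _ _))// mulrDl.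
rewrite lerD//.
  by rewrite normrM !ger0_norm ?(ltW D0)// ler_wpM2l// ltW.
rewrite (le_trans (ler_norm_sum _ _ _))// mulr_suml ler_sum// => i _.
by rewrite normrM ger0_norm// ler_wpM2l.
Qed.

Let bounds Y w k : 1 <= Y ->
  (forall k, 0 <= t k w <= Y) -> (forall k, 0 <= s k w <= Y) ->
  (forall k i l, (l <= N' k w)%N -> `|W i (l%:R * mesh h0 k) w| <= Y) ->
  [/\ forall i, `|W i (t k w) w| <= Y, forall i, `|W i (s k w) w| <= Y,
    `|X (t k w) w| <= (Dtot + ss) * Y & `|X (t k w) w - Dtot * t k w| <= ss * Y].
Proof.
move=> Y1 tY sY WY.
have Wt i : `|W i (t k w) w| <= Y by apply: WY; exact: leq_addr.
split => //.
- by move=> i; apply: WY.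
- exact: X_bound.
rewrite total_demand_split addrC addKr (le_trans (ler_norm_sum _ _ _))//.
rewrite mulr_suml ler_sum// => i _.
by rewrite normrM ger0_norm// ler_wpM2l.
Qed.

Let demand_cvg (Y : R) w : (forall k, 0 <= t k w <= Y) -> 0 <= theta w ->
  t ^~ w @ \oo --> theta w -> X (theta w) w = Q ->
  (forall i, {within `[0, +oo[, continuous (fun u => W i u w)}) ->
  (fun k => X (t k w) w) @ \oo --> Q.
Proof.
move=> tY th0 tth Xth /total_demand_continuous cX.
have tA k : `[0, +oo[%classic (t k w) by apply: inA; have /andP[] := tY k.
have := cvg_within_seq (cX D sigma) (inA th0) tA tth.
by rewrite Xth.
Qed.

(** On almost every path the demand at the grid passage tends to Q. Domination carries this to the
    means, and the first Wald identity is then solved for the mean time. *)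
Lemma cvg_mean_passage : (fun k => mean P (t k)) @ \oo --> Q / Dtot.
Proof.
have [Y [[mY iY] HY]] := good.
have lX k : L1 P (fun w => X (t k w) w).
  exact: L2_L1 (L2_demand_passage B_brownian B_indep D sigma Q m0 h0_gt0 k).
have : (fun k => mean P (fun w => X (t k w) w)) @ \oo --> Q.
  apply: (mean_cvg_cst lX _ (L1Z (Dtot + ss) iY)).
    apply: filterS HY => w [_ tY _ _ [th0 tth Xth cW]].
    exact: demand_cvg tY th0 tth Xth cW.
  apply: filterS HY => w [Y1 tY sY WY _] k.
  have [_ _ XY _] := bounds k Y1 tY sY WY.
  apply: (le_trans XY); rewrite ler_wpM2l ?addr_ge0 ?(ltW D0)//.
  by rewrite expr2 ler_peMl// (le_trans ler01).
move=> cX.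
have -> : (fun k => mean P (t k)) = (fun k => mean P (fun w => X (t k w) w) / Dtot).
  apply/funext => k; rewrite mean_demand_passage// mulrC mulKf// gt_eqF//.
by apply: cvgM; [exact: cX|exact: cvg_cst].
Qed.

Let L1t k : L1 P (t k).
Proof. exact: L2_L1 (L2_grid_passage B_brownian B_indep D sigma Q m0 h0_gt0 k). Qed.

Let L1t2 k : L1 P (fun w => t k w ^+ 2).
Proof. exact: (L2_grid_passage B_brownian B_indep D sigma Q m0 h0_gt0 k).2. Qed.

(** f is the error of putting Q for the demand in the squared noise, and its mean tends to 0.
    Expanding (Q - Dtot t)^2 then leaves a linear equation for the second moment. *)
Lemma cvg_mean_passage_sqr : (fun k => mean P (fun w => t k w ^+ 2)) @ \oo -->
  (Q ^+ 2 + sigma2 * (Q / Dtot)) / Dtot ^+ 2.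
Proof.
have [Y [[mY iY] HY]] := good.
pose f k w := (Q - Dtot * t k w) ^+ 2 - (X (t k w) w - Dtot * t k w) ^+ 2.
have L1n k : L1 P (fun w => (X (t k w) w - Dtot * t k w) ^+ 2).
  have lX := L2_demand_passage B_brownian B_indep D sigma Q m0 h0_gt0 k.
  have lt := L2_grid_passage B_brownian B_indep D sigma Q m0 h0_gt0 k.
  by case: (L2B lX (L2Z Dtot lt)).
have L1q k : L1 P (fun w => (Q - Dtot * t k w) ^+ 2).
  have lt := L2_grid_passage B_brownian B_indep D sigma Q m0 h0_gt0 k.
  by case: (L2B (L2_cst P Q) (L2Z Dtot lt)).
have L1f k : L1 P (f k) by exact: L1B.
have cf : (fun k => mean P (f k)) @ \oo --> 0.
  apply: (mean_cvg_cst L1f _ (L1Z ((Q + Dtot) ^+ 2 + ss ^+ 2) iY)).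
    apply: filterS HY => w [_ tY _ _ [th0 tth Xth cW]].
    have cX := demand_cvg tY th0 tth Xth cW.
    have cDt : (fun k => Dtot * t k w) @ \oo --> Dtot * theta w.
      by apply: cvgM; [exact: cvg_cst|exact: tth].
    rewrite -(subrr ((Q - Dtot * theta w) ^+ 2)).
    apply: cvgB; rewrite expr2.
      by apply: cvgM; apply: cvgB => //; exact: cvg_cst.
    by apply: cvgM; apply: cvgB.
  apply: filterS HY => w [Y1 tY sY WY _] k.
  have [_ _ _ XY] := bounds k Y1 tY sY WY.
  have Y0 : 0 <= Y w by rewrite (le_trans ler01).
  rewrite (le_trans (ler_normB _ _))// mulrDl lerD// normrX -exprMn lerXn2r ?nnegrE//.
    by rewrite mulr_ge0// addr_ge0// ltW.
    rewrite (le_trans (ler_normB _ _))// mulrDl lerD//.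
      by rewrite ger0_norm// ler_peMr.
    have /andP[t0 tY'] := tY k.
    by rewrite normrM !ger0_norm// ?(ltW D0)// ler_wpM2l// ltW.
  by rewrite mulr_ge0.
have E k : mean P (fun w => t k w ^+ 2) =
    (mean P (f k) + (2 * Q * Dtot + sigma2) * mean P (t k) - Q ^+ 2) / Dtot ^+ 2.
  rewrite meanB// mean_noise_passage_sqr// -/sigma2.
  have -> : mean P (fun w => (Q - Dtot * t k w) ^+ 2) = Q ^+ 2 -
      2 * Q * Dtot * mean P (t k) + Dtot ^+ 2 * mean P (fun w => t k w ^+ 2).
    rewrite -!meanZ// -[in RHS](mean_cst P (Q ^+ 2)) -meanB; [|exact: L1_cst|exact: L1Z].
    rewrite -meanD; [|by apply: L1B; [exact: L1_cst|exact: L1Z]|exact: L1Z].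
    by apply: eq_mean => w; ring.
  by field; rewrite gt_eqF.
under eq_fun do rewrite E.
have -> : (Q ^+ 2 + sigma2 * (Q / Dtot)) / Dtot ^+ 2 =
    (0 + (2 * Q * Dtot + sigma2) * (Q / Dtot) - Q ^+ 2) / Dtot ^+ 2.
  by field; rewrite gt_eqF.
apply: cvgM; last exact: cvg_cst.
apply: cvgB; last exact: cvg_cst.
apply: cvgD; first exact: cf.
by apply: cvgM; [exact: cvg_cst|exact: cvg_mean_passage].
Qed.

(** The same substitution of Q for the demand, now multiplied by W_j. The delay drops out because
    W_j at the delayed time has mean zero. *)
Lemma cvg_mean_passage_centered j :
  (fun k => mean P (fun w => s k w * W j (s k w) w)) @ \oo -->
  - (sigma j * (Q / Dtot) / Dtot).
Proof.
have [Y [[mY iY] HY]] := good.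
pose f k w := (Q - X (t k w) w) * W j (s k w) w.
have lX k := L2_demand_passage B_brownian B_indep D sigma Q m0 h0_gt0 k.
have lt k := L2_grid_passage B_brownian B_indep D sigma Q m0 h0_gt0 k.
have lW k := L2_centered_delayed B_brownian B_indep D sigma Q m0 h0_gt0 k j.
have L1f k : L1 P (f k) by apply: L2_mul => //; apply: L2B => //; exact: L2_cst.
have cf : (fun k => mean P (f k)) @ \oo --> 0.
  apply: (mean_cvg_cst L1f _ (L1Z (Q + (Dtot + ss)) iY)).
    apply: filterS HY => w [_ tY sY _ [th0 tth Xth cW]].
    have cX := demand_cvg tY th0 tth Xth cW.
    have st : s ^~ w @ \oo --> theta w + delay.
      under eq_fun do rewrite delayed_passageE.
      by apply: cvgD; [exact: tth|exact: cvg_cst].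
    have sA k : `[0, +oo[%classic (s k w) by apply: inA; have /andP[] := sY k.
    have cWs := cvg_within_seq (cW j) (inA (addr_ge0 th0 delay0)) sA st.
    rewrite -(mul0r (W j (theta w + delay) w)) -(subrr Q).
    by apply: cvgM; [apply: cvgB => //; exact: cvg_cst|exact: cWs].
  apply: filterS HY => w [Y1 tY sY WY _] k.
  have [_ Ws XY _] := bounds k Y1 tY sY WY.
  have Y0 : 0 <= Y w by rewrite (le_trans ler01).
  rewrite /f normrM expr2 mulrA ler_pM//.
  rewrite (le_trans (ler_normB _ _))// [leRHS]mulrDl lerD//.
  by rewrite ger0_norm// ler_peMr.
have E k : mean P (fun w => s k w * W j (s k w) w) =
    - (mean P (f k) + sigma j * mean P (t k)) / Dtot.
  rewrite -(mean_noise_passage_delayed B_brownian B_indep D sigma Q m0 h0_gt0 k j).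
  rewrite -meanD//; last by apply: L2_mul => //; apply: L2B => //; exact: L2Z.
  have -> : mean P (fun w => s k w * W j (s k w) w) = mean P (fun w => t k w * W j (s k w) w).
    under eq_mean do rewrite {1}delayed_passageE mulrDl.
    rewrite meanD; [|exact: L2_mul|by apply: L1Z; exact: L2_L1].
    by rewrite meanZ ?mean_centered_delayed ?mulr0 ?addr0//; exact: L2_L1.
  have lQ : L1 P (fun w => Q * W j (s k w) w) by apply: L1Z; exact: L2_L1.
  have lD : L1 P (fun w => Dtot * (t k w * W j (s k w) w)) by apply: L1Z; exact: L2_mul.
  have -> : (fun w => f k w + (X (t k w) w - Dtot * t k w) * W j (s k w) w) =
      (fun w => Q * W j (s k w) w - Dtot * (t k w * W j (s k w) w)).
    by apply/funext => w; rewrite /f; ring.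
  rewrite meanB// !meanZ; [|exact: L2_mul|exact: L2_L1].
  rewrite mean_centered_delayed//; field; rewrite gt_eqF//.
under eq_fun do rewrite E.
have -> : - (sigma j * (Q / Dtot) / Dtot) = - (0 + sigma j * (Q / Dtot)) / Dtot.
  by rewrite add0r mulNr.
apply: cvgM; last exact: cvg_cst.
apply: cvgN; apply: cvgD; first exact: cf.
by apply: cvgM; [exact: cvg_cst|exact: cvg_mean_passage].
Qed.

Lemma has_mean_passage : has_mean P theta (Q / Dtot).
Proof.
have [Y [[mY iY] HY]] := good.
apply: (has_mean_lim L1t _ iY _ cvg_mean_passage).
  by apply: filterS HY => w [_ _ _ _ [_ tth _ _]].
apply: filterS HY => w [Y1 tY _ _ _] k.
have /andP[t0 tY'] := tY k; rewrite ger0_norm// (le_trans tY')//.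
by rewrite expr2 ler_peMl// (le_trans ler01).
Qed.

Let L1s k : L1 P (s k).
Proof. exact: L2_L1 (L2_delayed_passage B_brownian B_indep D sigma Q m0 h0_gt0 k). Qed.

Let L1W k i : L1 P (fun w => W i (s k w) w).
Proof. exact: L2_L1 (L2_centered_delayed B_brownian B_indep D sigma Q m0 h0_gt0 k i). Qed.

Let mean_s k : mean P (s k) = mean P (t k) + delay.
Proof.
rewrite -[delay](mean_cst P) -meanD//; last exact: L1_cst.
by apply: eq_mean => w; rewrite delayed_passageE.
Qed.

Let s_cvg w : t ^~ w @ \oo --> theta w -> s ^~ w @ \oo --> theta w + delay.
Proof.
move=> tth; under eq_fun do rewrite delayed_passageE.
by apply: cvgD; [exact: tth|exact: cvg_cst].
Qed.

Variable c : 'I_n -> R.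

Lemma has_mean_linear_cost :
  has_mean P (fun w => \sum_(i < n) c i *
      (D i * (theta w + delay) + sigma i * W i (theta w + delay) w))
    ((\sum_(i < n) c i * D i) * (Q / Dtot + delay)).
Proof.
have [Y [[mY iY] HY]] := good.
pose f k w := \sum_(i < n) c i * (D i * s k w + sigma i * W i (s k w) w).
have L1f k i : L1 P (fun w => c i * (D i * s k w + sigma i * W i (s k w) w)).
  by apply: L1Z; apply: L1D; exact: L1Z.
apply: (@has_mean_lim _ _ _ P f _ (fun w => (\sum_(i < n) `|c i| * (D i + sigma i)) * Y w ^+ 2)).
- by move=> k; exact: L1_sum.
- apply: filterS HY => w [_ _ sY _ [th0 tth _ cW]].
  have st := s_cvg tth.
  have sA k : `[0, +oo[%classic (s k w) by apply: inA; have /andP[] := sY k.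
  apply: cvg_sumr => i; apply: cvgM; first exact: cvg_cst.
  apply: cvgD; first by apply: cvgM; [exact: cvg_cst|exact: st].
  apply: cvgM; first exact: cvg_cst.
  exact: (cvg_within_seq (cW i) (inA (addr_ge0 th0 delay0)) sA st).
- exact: L1Z.
- apply: filterS HY => w [Y1 tY sY WY _] k.
  have [_ Ws _ _] := bounds k Y1 tY sY WY.
  rewrite (le_trans (ler_norm_sum _ _ _))// mulr_suml ler_sum// => i _.
  have Y0 : 0 <= Y w by rewrite (le_trans ler01).
  have YY : Y w <= Y w ^+ 2 by rewrite expr2 ler_peMl.
  have /andP[s0 sY'] := sY k.
  rewrite normrM -mulrA ler_wpM2l//.
  rewrite (le_trans (ler_normD _ _))// mulrDl lerD// normrM ger0_norm// ler_wpM2l//.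
    by rewrite ger0_norm// (le_trans sY').
  exact: le_trans (Ws i) YY.
- have -> : (fun k => mean P (f k)) =
      (fun k => (\sum_(i < n) c i * D i) * (mean P (t k) + delay)).
    apply/funext => k; rewrite mean_sum//.
    rewrite mulr_suml; apply: eq_bigr => i _.
    rewrite meanZ; last by apply: L1D; exact: L1Z.
    rewrite meanD; [|exact: L1Z|exact: L1Z].
    by rewrite !meanZ// mean_centered_delayed// mulr0 addr0 mean_s mulrA.
  apply: cvgM; first exact: cvg_cst.
  by apply: cvgD; [exact: cvg_mean_passage|exact: cvg_cst].
Qed.

Let sum_grid k w : \sum_(l < N' k w) mesh h0 k * (l%:R * mesh h0 k) =
  (s k w ^+ 2 - mesh h0 k * s k w) / 2.
Proof.
rewrite /delayed_passage; elim: (N' k w) => [|N IHN].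
  by rewrite big_ord0 !mul0r expr2 !(mul0r, mulr0) subrr mul0r.
by rewrite big_ord_recr/= IHN -natr1; field.
Qed.

(** The integral is the pathwise limit of left Riemann sums. Their drift part is (s^2 - mesh s) / 2
    in closed form, and their noise part has the mean of s W(s) by [mean_riemann]. The generic
    coefficients c become the waiting costs omega in the application. *)
Lemma has_mean_waiting_cost :
  has_mean P (fun w => \sum_(i < n) \int[lebesgue_measure]_(u in `[0, theta w + delay])
      (c i * (D i * u + sigma i * W i u w)))
    (\sum_(i < n) c i * (D i * ((Q ^+ 2 + sigma2 * (Q / Dtot)) / Dtot ^+ 2 +
       2 * delay * (Q / Dtot) + delay ^+ 2) / 2 - sigma i ^+ 2 * (Q / Dtot) / Dtot)).
Proof.
have [Y [[mY iY] HY]] := good.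
pose v i w u := c i * (D i * u + sigma i * W i u w).
pose f k w := \sum_(i < n) \sum_(l < N' k w) mesh h0 k * v i w (l%:R * mesh h0 k).
have L1R k i := L1_riemann B_brownian B_indep D sigma Q m0 h0_gt0 k i.
have L1s2 k : L1 P (fun w => s k w ^+ 2).
  exact: (L2_delayed_passage B_brownian B_indep D sigma Q m0 h0_gt0 k).2.
have fE k w : f k w = \sum_(i < n) c i * (D i / 2 * (s k w ^+ 2 - mesh h0 k * s k w) +
    sigma i * \sum_(l < N' k w) mesh h0 k * W i (l%:R * mesh h0 k) w).
  apply: eq_bigr => i _; rewrite mulrAC -mulrA -sum_grid.
  rewrite mulrDr !mulr_sumr -big_split/=; apply: eq_bigr => l _.
  by rewrite /v; ring.
have L1i k i : L1 P (fun w => c i * (D i / 2 * (s k w ^+ 2 - mesh h0 k * s k w) +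
    sigma i * \sum_(l < N' k w) mesh h0 k * W i (l%:R * mesh h0 k) w)).
  apply: L1Z; apply: L1D; last exact: L1Z.
  by apply: L1Z; apply: L1B => //; exact: L1Z.
apply: (@has_mean_lim _ _ _ P f _ (fun w => (\sum_(i < n) `|c i| * (D i + sigma i)) * Y w ^+ 2)).
- by move=> k; apply: eq_L1 (L1_sum _ _ (L1i k)) => w; rewrite fE.
- apply: filterS HY => w [_ _ sY _ [th0 tth _ cW]].
  have st := s_cvg tth.
  apply: cvg_sumr => i.
  have cv : {within `[0, +oo[, continuous (v i w)}.
    have cid : {within `[0, +oo[, continuous (fun u : R => u)}.
      by apply: continuous_subspaceT => u; exact: cvg_id.
    move=> u; apply: cvgM; first exact: cvg_cst.
    apply: cvgD; first by apply: cvgM; [exact: cvg_cst|exact: cid].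
    by apply: cvgM; [exact: cvg_cst|exact: cW].
  have m_ge0 k : 0 <= mesh h0 k by rewrite ltW// mesh_gt0.
  have := cvg_riemann_sum (continuous_extension0 cv) (mesh_gt0 h0_gt0) (mesh_cvg0 h0)
    (N := fun k => N' k w) (M := Y w) _ st.
  have -> : (fun k => \sum_(l < N' k w) mesh h0 k * v i w (Num.max (l%:R * mesh h0 k) 0)) =
      (fun k => \sum_(l < N' k w) mesh h0 k * v i w (l%:R * mesh h0 k)).
    apply/funext => k; apply: eq_bigr => l _.
    by rewrite (max_idPl _)// mulr_ge0.
  have -> : \int[lebesgue_measure]_(u in `[0, theta w + delay]) v i w (Num.max u 0) =
      \int[lebesgue_measure]_(u in `[0, theta w + delay]) v i w u.
    apply: eq_Rintegral => u; rewrite inE/= in_itv/= => /andP[u0 _].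
    by rewrite (max_idPl _).
  by apply => k; have /andP[] := sY k.
- exact: L1Z.
- apply: filterS HY => w [Y1 tY sY WY _] k.
  rewrite (le_trans (ler_norm_sum _ _ _))// mulr_suml ler_sum// => i _.
  have Y0 : 0 <= Y w by rewrite (le_trans ler01).
  have /andP[s0 sY'] := sY k.
  have m0' : 0 <= mesh h0 k by rewrite ltW// mesh_gt0.
  rewrite (le_trans (ler_norm_sum _ _ _))//.
  apply: (@le_trans _ _ (\sum_(l < N' k w) mesh h0 k * (`|c i| * (D i + sigma i) * Y w))).
    apply: ler_sum => l _; rewrite normrM (ger0_norm m0') ler_wpM2l//.
    rewrite normrM -mulrA ler_wpM2l// (le_trans (ler_normD _ _))// mulrDl lerD//.
      have lm : 0 <= l%:R * mesh h0 k by rewrite mulr_ge0.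
      rewrite normrM !ger0_norm// ler_wpM2l// (le_trans _ sY')//.
      by rewrite /delayed_passage ler_wpM2r// ler_nat ltnW.
    by rewrite normrM (ger0_norm (sigma_ge0 i)) ler_wpM2l//; apply: WY; exact: ltnW.
  rewrite sumr_const card_ord -mulr_natl mulrA -/(s k w).
  rewrite expr2 mulrCA ler_wpM2l// ?ler_wpM2r// mulr_ge0// addr_ge0//.
- pose S2 k := mean P (fun w => t k w ^+ 2) + 2 * delay * mean P (t k) + delay ^+ 2.
  have mean_s2 k : mean P (fun w => s k w ^+ 2) = S2 k.
    have -> : (fun w => s k w ^+ 2) =
        (fun w => (t k w ^+ 2 + 2 * delay * t k w) + delay ^+ 2).
      by apply/funext => w; rewrite delayed_passageE -/delay; ring.
    rewrite meanD; [|by apply: L1D => //; exact: L1Z|exact: L1_cst].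
    by rewrite meanD//; [rewrite mean_cst meanZ|exact: L1Z].
  have -> : (fun k => mean P (f k)) = (fun k => \sum_(i < n) c i *
      (D i / 2 * (S2 k - mesh h0 k * (mean P (t k) + delay)) +
      sigma i * mean P (fun w => s k w * W i (s k w) w))).
    apply/funext => k; under eq_mean do rewrite fE.
    rewrite mean_sum//; apply: eq_bigr => i _.
    have i1 : L1 P (fun w => D i / 2 * (s k w ^+ 2 - mesh h0 k * s k w)).
      by apply: L1Z; apply: L1B => //; exact: L1Z.
    rewrite meanZ; last by apply: L1D => //; exact: L1Z.
    rewrite meanD//; last exact: L1Z.
    rewrite meanZ; last by apply: L1B => //; exact: L1Z.
    rewrite meanB//; last exact: L1Z.
    by rewrite meanZ// meanZ// mean_s2 mean_s mean_riemann.
  apply: cvg_sumr => i; apply: cvgM; first exact: cvg_cst.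
  (* The zero term is the limit of the discretization correction, mesh times the mean delayed
     time. *)
  have -> : forall a b : R, D i * a / 2 - b = D i / 2 * (a - 0 * (Q / Dtot + delay)) + - b.
    by move=> a b; ring.
  apply: cvgD; last first.
    have cWs := @cvg_mean_passage_centered i.
    rewrite (_ : - _ = sigma i * - (sigma i * (Q / Dtot) / Dtot)); last by ring.
    by apply: cvgM; [exact: cvg_cst|exact: cWs].
  apply: cvgM; first exact: cvg_cst.
  apply: cvgB; last first.
    apply: cvgM; first exact: mesh_cvg0.
    by apply: cvgD; [exact: cvg_mean_passage|exact: cvg_cst].
  apply: cvgD; last exact: cvg_cst.
  apply: cvgD; first exact: cvg_mean_passage_sqr.
  by apply: cvgM; [exact: cvg_cst|exact: cvg_mean_passage].
Qed.

End passage_limits.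

(** * Costs of the policies *)

Section policies.
Context {d : measure_display} {Omega : measurableType d} {R : realType}.
Variables (P : probability Omega R) (n : nat) (B : 'I_n -> R -> {RV P >-> R}).
Hypothesis B_brownian : forall i, standard_brownian_motion (B i).
Hypothesis B_indep : independent_processes P (fun i t w => B i t w).
Variables D sigma : 'I_n -> R.
Hypotheses (Dtot_gt0 : 0 < \sum_(i < n) D i) (sigma_ge0 : forall i, 0 <= sigma i).
Hypothesis D_ge0 : forall i, 0 <= D i.

Let Dtot := \sum_(i < n) D i.
Let sigma2 := \sum_(i < n) sigma i ^+ 2.
Let N := cumulative_demand D sigma B.

Local Notation X := (total_demand B D sigma).
Local Notation theta Q h0 := (first_passage B D sigma Q h0).

Let D0 : 0 < Dtot. Proof. exact: Dtot_gt0. Qed.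

Let started (w : Omega) := forall i, B i 0 w = 0.

Let ae_started : {ae P, forall w, started w}.
Proof. by apply: filter_forall => i; exact: brownian_start (B_brownian i). Qed.

Let sum_demand w (t : R) : started w -> \sum_(i < n) N i t w = X t w.
Proof. by move=> w0; apply: eq_bigr => i _; rewrite /centered w0 subr0. Qed.

Let hitting_le w Q (u : R) : started w -> 0 < u -> Q <= X u w ->
  (hitting_time N Q w <= u%:E)%E.
Proof.
move=> w0 u0 Qu; apply: ereal_inf_lbound; exists u => //; split=> //.
by rewrite sum_demand.
Qed.

Let hitting_ge w Q (a : R) : started w ->
  (forall u, 0 < u -> Q <= X u w -> a <= u) -> (a%:E <= hitting_time N Q w)%E.
Proof.
move=> w0 aQ; apply: le_ereal_inf_tmp => _ [u [u0 Qu] <-]; rewrite lee_fin.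
by apply: aQ => //; rewrite -sum_demand.
Qed.

Let passage_gt0 w Q (u : R) : 0 < Q -> 0 <= u -> X u w = Q -> 0 < u.
Proof.
move=> Q0 u0 XQ; rewrite lt_neqAle u0 andbT; apply/eqP => u00.
by move: Q0; rewrite -XQ -u00 total_demand0 ltxx.
Qed.

Let fin_between (a b : R) (x : \bar R) : (a%:E <= x)%E -> (x <= b%:E)%E -> x = (fine x)%:E.
Proof.
by case: x => [r|//|//].
Qed.

Let passage Q h0 : 0 <= Q -> 0 < h0 -> {ae P, forall w, [/\ 0 <= theta Q h0 w,
  X (theta Q h0 w) w = Q & forall u : R, 0 <= u -> Q < X u w -> theta Q h0 w <= u]}.
Proof.
move=> Q0 h00; have := ae_passage B_brownian B_indep Dtot_gt0 sigma_ge0 0%N Q0 h00.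
by apply: filterS => w [].
Qed.

Let harmonic0 (a : R) : (fun m => a * (m.+1%:R)^-1) @ \oo --> (0 : R).
Proof.
by rewrite -[X in _ --> X](mulr0 a); apply: cvgM; [exact: cvg_cst|exact: cvg_harmonic].
Qed.

Lemma first_passage0 h0 : 0 < h0 -> {ae P, forall w, theta 0 h0 w = 0}.
Proof.
move=> h00; have H := has_mean_passage B_brownian B_indep Dtot_gt0 sigma_ge0
  0%N (lexx 0) h00.
rewrite mul0r in H.
have ab : {ae P, forall w, `|theta 0 h0 w| <= theta 0 h0 w}.
  by apply: filterS (passage (lexx 0) h00) => w [th0 _ _]; rewrite ger0_norm.
have Z0 : {ae P, forall w, `|theta 0 h0 w| = 0}.
  apply: (@squeeze_ae0 _ _ _ P _ (fun=> theta 0 h0) (fun=> 0)) => [w|_|_|].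
  - exact: normr_ge0.
  - exact: ab.
  - exact: H.
  - exact: cvg_cst.
by apply: filterS Z0 => w /eqP; rewrite normr_eq0 => /eqP.
Qed.

Lemma hitting_time_passage Q h0 : 0 <= Q -> 0 < h0 ->
  {ae P, forall w, hitting_time N Q w = (theta Q h0 w)%:E}.
Proof.
move=> Q0 h00.
have mean_theta q : 0 <= q -> has_mean P (theta q h0) (q / Dtot).
  by move=> q0; exact: (has_mean_passage B_brownian B_indep Dtot_gt0 sigma_ge0 0%N q0 h00).
move: Q0; rewrite le_eqVlt => /predU1P[<-|Q0].
  (* At Q = 0 there is no lower level to compare with, and theta_0 = 0 is not a candidate since the
     infimum is over t > 0. Instead T_0 <= theta_q for small q > 0, and the mean q / D tends to
     0. *)
  have T0 : {ae P, forall w, `|fine (hitting_time N 0 w)| = 0}.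
    apply: (@squeeze_ae0 _ _ _ P _ (fun m => theta m.+1%:R^-1 h0) (fun m => Dtot^-1 * m.+1%:R^-1)).
    - by move=> w; exact: normr_ge0.
    - move=> m; have q0 : 0 < m.+1%:R^-1 :> R by rewrite invr_gt0.
      apply: filterS2 ae_started (passage (ltW q0) h00) => w w0 [th0 Xth _].
      have h1 : (hitting_time N 0 w <= (theta m.+1%:R^-1 h0 w)%:E)%E.
        by apply: hitting_le => //; [exact: passage_gt0 Xth|rewrite Xth ltW].
      have h2 : (0%:E <= hitting_time N 0 w)%E by apply: hitting_ge => // u /ltW.
      by rewrite ger0_norm ?fine_ge0// -lee_fin -(fin_between h2 h1).
    - move=> m; rewrite mulrC; apply: mean_theta; by rewrite invr_ge0.
    - exact: harmonic0.
  (* The level 1 only serves to show that the hitting time is finite, so that [fine] does not hide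
     an infinite value. *)
  have q0 : 0 < 1 :> R by [].
  apply: filterS3 T0 (first_passage0 h00) (filterI ae_started (passage (ltW q0) h00)).
  move=> w T0 -> [w0 [th0 Xth _]].
  have h1 : (hitting_time N 0 w <= (theta 1 h0 w)%:E)%E.
    by apply: hitting_le => //; [exact: passage_gt0 Xth|rewrite Xth].
  have h2 : (0%:E <= hitting_time N 0 w)%E by apply: hitting_ge => // u /ltW.
  by rewrite (fin_between h2 h1); move/eqP: T0; rewrite normr_eq0 => /eqP->.
have fin : {ae P, forall w, [/\ hitting_time N Q w = (fine (hitting_time N Q w))%:E
    & (fine (hitting_time N Q w)) <= theta Q h0 w]}.
  apply: filterS2 ae_started (passage (ltW Q0) h00) => w w0 [th0 Xth _].
  have h1 : (hitting_time N Q w <= (theta Q h0 w)%:E)%E.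
    by apply: hitting_le => //; [exact: passage_gt0 Xth|rewrite Xth].
  have h2 : (0%:E <= hitting_time N Q w)%E by apply: hitting_ge => // u /ltW.
  by have E := fin_between h2 h1; split => //; rewrite -lee_fin -E.
have T0 : {ae P, forall w, `|theta Q h0 w - fine (hitting_time N Q w)| = 0}.
  (* Levels strictly below Q that increase to Q: a time at which the demand is at least Q exceeds
     them strictly, as the minimality of theta requires. *)
  pose q m := Q - Q * m.+1%:R^-1.
  have q0 m : 0 <= q m by rewrite subr_ge0 ler_piMr ?(ltW Q0)// invf_le1// ler1n.
  have qQ m : q m < Q by rewrite ltrBlDr ltrDl mulr_gt0// invr_gt0.
  apply: (@squeeze_ae0 _ _ _ P _ (fun m w => theta Q h0 w - theta (q m) h0 w)
    (fun m => Q / Dtot - q m / Dtot)).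
  - by move=> w; exact: normr_ge0.
  - move=> m.
    apply: filterS3 ae_started fin (passage (q0 m) h00) => w w0 [E le] [th0 _ thle].
    have h2 : ((theta (q m) h0 w)%:E <= hitting_time N Q w)%E.
      apply: hitting_ge => // u u0 Qu; apply: thle (ltW u0) _.
      exact: lt_le_trans (qQ m) Qu.
    by rewrite ger0_norm ?subr_ge0// lerB// -lee_fin -E.
  - by move=> m; apply: has_meanB; apply: mean_theta => //; exact: ltW.
  - rewrite (_ : (fun m => _) = (fun m => (Q / Dtot) * m.+1%:R^-1)); first exact: harmonic0.
    by apply/funext => m; rewrite /q; ring.
apply: filterS2 fin T0 => w [E _] /eqP; rewrite normr_eq0 subr_eq0 => /eqP ->.
exact: E.
Qed.

Variables (A : R) (c omega : 'I_n -> R).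

Let S := \sum_(i < n) omega i * (2 * Dtot * sigma i ^+ 2 - D i * sigma2).

(* a is the mean hitting time Q / Dtot and T the additional delay. *)
Definition policy_cost (a T : R) : R :=
  A / (a + T) + \sum_(i < n) c i * D i +
  (\sum_(i < n) omega i * D i) / 2 * (a + T) - a / (a + T) * (S / (2 * Dtot ^+ 2)).

Let expectation_has_mean (f g : Omega -> R) (l : R) : has_mean P f l ->
  {ae P, forall w, g w = f w} -> ('E_P[g] = l%:E)%E.
Proof.
move=> fl gf; rewrite unlock -(has_mean_integral fl).
by apply: ae_eq_integral_nonmeasurable; apply: filterS gf => w /= -> _.
Qed.

(** One evaluation serves quantity, time and mixed policies. The hypothesis on tau covers every mesh
    h0 because the mesh is chosen inside according to T. *)
Lemma average_cost_passage (tau : Omega -> \bar R) (Q T : R) : 0 <= Q -> 0 <= T ->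
  0 < Q / Dtot + T ->
  (forall h0, 0 < h0 -> {ae P, forall w, tau w = (theta Q h0 w + T)%:E}) ->
  average_cost P A c omega N tau = (policy_cost (Q / Dtot) T)%:E.
Proof.
move=> Q0 T0 L0 tauE.
(* The delay must be a whole number of coarse steps: one step of length T, or no step of length 1
   when T = 0. *)
have [h0 [m0 [h00 mT]]] : exists h0 m0, 0 < h0 /\ m0%:R * h0 = T.
  move: T0; rewrite le_eqVlt => /predU1P[<-|T0].
    by exists 1, 0%N; rewrite mul0r.
  by exists T, 1%N; rewrite mul1r.
have {}tauE := tauE h0 h00.
have m1 := has_mean_passage B_brownian B_indep Dtot_gt0 sigma_ge0 m0 Q0 h00.
have m2 := has_mean_linear_cost B_brownian B_indep Dtot_gt0 sigma_ge0 D_ge0 m0 Q0 h00 c.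
have m3 := has_mean_waiting_cost B_brownian B_indep Dtot_gt0 sigma_ge0 D_ge0 m0 Q0 h00 omega.
rewrite mT in m2 m3.
rewrite /average_cost.
rewrite (expectation_has_mean m2); last first.
  apply: filterS2 ae_started tauE => w w0 ->; apply: eq_bigr => i _.
  by rewrite /N /cumulative_demand /centered w0 subr0.
rewrite (expectation_has_mean m3); last first.
  apply: filterS2 ae_started tauE => w w0 ->; apply: eq_bigr => i _.
  by apply: eq_Rintegral => u _; rewrite /N /cumulative_demand /centered w0 subr0.
have -> : (\int[P]_w tau w = (Q / Dtot + T)%:E)%E.
  have mT' : has_mean P (fun w => theta Q h0 w - - T) (Q / Dtot - - T).
    apply: has_meanB m1 _; have := L1_has_mean (L1_cst P (- T)).
    by rewrite mean_cst.
  rewrite opprK in mT'; rewrite -(has_mean_integral mT').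
  by apply: ae_eq_integral_nonmeasurable; apply: filterS tauE => w -> _.
rewrite -!EFinD inver gt_eqF// -/Dtot -/sigma2 -EFinM; congr EFin.
have Dn0 : Dtot != 0 by rewrite gt_eqF.
have Ln0 : Q / Dtot + T != 0 by rewrite gt_eqF.
have -> : \sum_(i < n) omega i * (D i * ((Q ^+ 2 + sigma2 * (Q / Dtot)) / Dtot ^+ 2 +
      2 * T * (Q / Dtot) + T ^+ 2) / 2 - sigma i ^+ 2 * (Q / Dtot) / Dtot) =
    (\sum_(i < n) omega i * D i) / 2 * (Q / Dtot + T) ^+ 2 -
    Q / Dtot * (S / (2 * Dtot ^+ 2)).
  rewrite /S; move: sigma2 => s2; rewrite !mulr_suml mulr_sumr -sumrB; apply: eq_bigr => i _.
  by field.
rewrite /policy_cost -/Dtot; set L := Q / Dtot + T in Ln0 *.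
by field; rewrite Dn0 Ln0.
Qed.

Lemma average_cost_quantity (Q : R) : 0 < Q ->
  average_cost P A c omega N (hitting_time N Q) = (policy_cost (Q / Dtot) 0)%:E.
Proof.
move=> Q0; apply: average_cost_passage; [exact: ltW|by []|by rewrite addr0 divr_gt0|].
move=> h0 h00; apply: filterS (hitting_time_passage (ltW Q0) h00) => w.
by rewrite addr0.
Qed.

Lemma average_cost_time (T : R) : 0 < T ->
  average_cost P A c omega N (fun=> T%:E) = (policy_cost 0 T)%:E.
Proof.
move=> T0; have := @average_cost_passage (fun=> T%:E) 0 T (lexx 0) (ltW T0).
rewrite mul0r add0r; apply => // h0 h00.
by apply: filterS (first_passage0 h00) => w ->; rewrite add0r.
Qed.

Lemma average_cost_joint (Q T : R) : 0 <= Q -> 0 <= T -> 0 < Q / Dtot + T ->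
  average_cost P A c omega N (clearing_time N Q T) = (policy_cost (Q / Dtot) T)%:E.
Proof.
move=> Q0 T0 L0; apply: average_cost_passage => // h0 h00.
by apply: filterS (hitting_time_passage Q0 h00) => w Qw; rewrite /clearing_time Qw.
Qed.

Hypotheses (A_gt0 : 0 < A) (omegaD_gt0 : 0 < \sum_(i < n) omega i * D i).

Let m := \sum_(i < n) omega i * D i.

Definition optimal_cycle : R := Num.sqrt (2 * A / m).

Lemma optimal_cycle_gt0 : 0 < optimal_cycle.
Proof. by rewrite sqrtr_gt0 divr_gt0// mulr_gt0. Qed.

(* Both optimal pure policies have the mean cycle length of the economic order
   quantity formula. *)
Lemma eoq_bound (L : R) : 0 < L ->
  A / optimal_cycle + m / 2 * optimal_cycle <= A / L + m / 2 * L.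
Proof.
move=> L0; have l0 := optimal_cycle_gt0; set l := optimal_cycle in l0 *.
have m0 : 0 < m := omegaD_gt0.
have l2 : A = m / 2 * l ^+ 2.
  rewrite sqr_sqrtr; first by field; rewrite gt_eqF.
  by rewrite divr_ge0 ?mulr_ge0// ltW.
rewrite -subr_ge0 {1 2}l2.
have -> : m / 2 * l ^+ 2 / L + m / 2 * L - (m / 2 * l ^+ 2 / l + m / 2 * l) =
    m / 2 * (l - L) ^+ 2 / L by field; rewrite !gt_eqF.
by rewrite divr_ge0 ?(ltW L0)// mulr_ge0 ?sqr_ge0// divr_ge0 ?(ltW m0).
Qed.

End policies.

(** * Comparison of the policies *)

Theorem theorem12 (d : measure_display) (Omega : measurableType d)
    (R : realType) (P : probability Omega R) (n : nat) (n_gt0 : (0 < n)%N)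
    (B : 'I_n -> R -> {RV P >-> R})
    (B_brownian : forall i, standard_brownian_motion (B i))
    (B_indep : independent_processes P (fun i t w => B i t w))
    (D sigma : 'I_n -> R)
    (D_gt0 : forall i, 0 < D i) (sigma_gt0 : forall i, 0 < sigma i)
    (A_D : R) (A_D_gt0 : 0 < A_D)
    (c omega : 'I_n -> R) (omega_gt0 : forall i, 0 < omega i) :
  let N := cumulative_demand D sigma B in
  let AC := average_cost P A_D c omega N in
  let Dtot := \sum_(i < n) D i in
  let sigma2 := \sum_(i < n) sigma i ^+ 2 in
  let S := \sum_(i < n) omega i * (2 * Dtot * sigma i ^+ 2 - D i * sigma2) in
  let AC_quantity := fun Q : R => AC (hitting_time N Q) in
  let AC_time := fun T : R => AC (fun _ => T%:E) in
  let AC_joint := fun QT : R * R => AC (clearing_time N QT.1 QT.2) in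
  let admissible :=
    [set QT : R * R | [/\ 0 <= QT.1, 0 <= QT.2 & QT <> (0, 0)]] in
  (0 < S ->
    (exists Q : R, minimizes_on [set Q : R | 0 < Q] AC_quantity Q) /\
    (forall Q : R, minimizes_on [set Q : R | 0 < Q] AC_quantity Q ->
       minimizes_on admissible AC_joint (Q, 0)))
  /\
  (S < 0 ->
    (exists T : R, minimizes_on [set T : R | 0 < T] AC_time T) /\
    (forall T : R, minimizes_on [set T : R | 0 < T] AC_time T ->
       minimizes_on admissible AC_joint (0, T))).
Proof.
move=> N AC Dtot sigma2 S AC_quantity AC_time AC_joint admissible.
have i0 : 'I_n := Ordinal n_gt0.
have D0 : 0 < Dtot.
  rewrite /Dtot (bigD1 i0)//= ltr_wpDr// sumr_ge0// => i _; exact: ltW.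
have sg0 i : 0 <= sigma i := ltW (sigma_gt0 i).
have Dg0 i : 0 <= D i := ltW (D_gt0 i).
pose m := \sum_(i < n) omega i * D i.
have m0 : 0 < m.
  rewrite /m (bigD1 i0)//= ltr_wpDr ?mulr_gt0// sumr_ge0// => i _.
  by rewrite mulr_ge0// ltW.
pose cost := policy_cost D sigma A_D c omega.
have quantityE Q : 0 < Q -> AC_quantity Q = (cost (Q / Dtot) 0)%:E.
  exact: average_cost_quantity.
have timeE T : 0 < T -> AC_time T = (cost 0 T)%:E by exact: average_cost_time.
have cycle_gt0 (QT : R * R) : admissible QT -> 0 < QT.1 / Dtot + QT.2.
  case: QT => Q T [/= Q0 T0 QT0]; rewrite lt_neqAle addr_ge0 ?divr_ge0 ?(ltW D0)// andbT.
  apply/eqP => /esym/eqP; rewrite paddr_eq0 ?divr_ge0 ?(ltW D0)// => /andP[q0 /eqP t0].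
  apply: QT0; rewrite t0; congr (_, _); apply/eqP.
  by move: q0; rewrite mulf_eq0 invr_eq0 (gt_eqF D0) orbF.
have jointE (QT : R * R) : admissible QT -> AC_joint QT = (cost (QT.1 / Dtot) QT.2)%:E.
  by move=> adm; have [Q0 T0 _] := adm; apply: average_cost_joint => //; exact: cycle_gt0.
pose base L := A_D / L + \sum_(i < n) c i * D i + m / 2 * L.
pose r := S / (2 * Dtot ^+ 2).
have costE a T : cost a T = base (a + T) - a / (a + T) * r by [].
pose l := optimal_cycle D A_D omega.
have l0 : 0 < l by exact: optimal_cycle_gt0.
have base_min (L : R) : 0 < L -> base l <= base L.
  by move=> L0; have := eoq_bound A_D_gt0 m0 L0; rewrite /base -/m -/l; lra.
have cost_quantity (Q : R) : 0 < Q -> cost (Q / Dtot) 0 = base (Q / Dtot) - r.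
  by move=> Q0; rewrite costE addr0 divff ?mul1r// gt_eqF// divr_gt0.
have cost_time T : cost 0 T = base T by rewrite costE add0r mul0r mul0r subr0.
have ratio (a T : R) : 0 <= a -> 0 <= T -> 0 < a + T -> 0 <= a / (a + T) <= 1.
  move=> a0 T0 aT; apply/andP; split; first by rewrite divr_ge0// ltW.
  by rewrite ler_pdivrMr// mul1r lerDl.
have r_scale : 0 < (2 * Dtot ^+ 2)^-1 by rewrite invr_gt0 mulr_gt0// exprn_gt0.
split=> S0.
- have r0 : 0 < r by rewrite /r mulr_gt0.
  split.
    (* The level whose mean hitting time is the optimal cycle length l. *)
    exists (l * Dtot); split=> [|Q /= Q0]; first by rewrite /= mulr_gt0.
    rewrite !quantityE ?mulr_gt0// lee_fin !cost_quantity ?mulr_gt0//.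
    by rewrite mulfK ?gt_eqF// lerD2r base_min// divr_gt0.
  move=> Q [/= Q0 Qmin].
  have admQ : admissible (Q, 0).
    by split => /=; [exact: ltW|exact: lexx|case=> Q00; move: Q0; rewrite Q00 ltxx].
  split=> // -[Q' T'] adm; have L0 := cycle_gt0 _ adm.
  rewrite (jointE _ admQ) -(quantityE _ Q0)/=.
  (* The competitor is compared with the quantity policy of the same mean cycle length L, whose
     level is L * Dtot; the minimizer Q costs no more than that one. *)
  set L := Q' / Dtot + T' in L0.
  have LD : 0 < L * Dtot by rewrite mulr_gt0.
  apply: (le_trans (Qmin _ LD)); rewrite quantityE// jointE// lee_fin cost_quantity//.
  rewrite costE -/L mulfK ?gt_eqF// lerD2l lerN2 ler_piMl ?(ltW r0)//.
  have [/= Q'0 T'0 _] := adm.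
  by have /andP[] := ratio _ _ (divr_ge0 Q'0 (ltW D0)) T'0 L0.
- have r0 : r < 0 by rewrite /r nmulr_rlt0.
  split.
    exists l; split=> // T /= T0.
    by rewrite !timeE// lee_fin !cost_time base_min.
  move=> T [/= T0 Tmin].
  have admT : admissible (0, T).
    by split => /=; [exact: lexx|exact: ltW|case=> T00; move: T0; rewrite T00 ltxx].
  split=> // -[Q' T'] adm; have L0 := cycle_gt0 _ adm.
  rewrite (jointE _ admT) /= mul0r -(timeE _ T0).
  (* Here the comparison is with the deterministic cycle of the same mean length L. *)
  set L := Q' / Dtot + T' in L0.
  apply: (le_trans (Tmin _ L0)); rewrite timeE// jointE// lee_fin cost_time.
  rewrite costE -/L lerDl oppr_ge0 mulr_ge0_le0 ?(ltW r0)//.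
  have [/= Q'0 T'0 _] := adm.
  by have /andP[] := ratio _ _ (divr_ge0 Q'0 (ltW D0)) T'0 L0.
Qed.
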